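(* Groups of the form $H \ltimes N$, where $N$ is Abelian, $H$ is $O(1)$-generated, and $|H|$ and $|N|$ are coprime, are identified by $(O(1), O(1))$-WL Version II. Consequently, isomorphism between a group of the form $H \ltimes N$ (with $N$ Abelian, $H$ $O(1)$-generated, and $|H|$, $|N|$ coprime) and an arbitrary group can be decided in $\textsf{L}$.
   Context: Groups are finite and given by their Cayley (multiplication) tables. $(k,r)$-WL Version II denotes running the $k$-dimensional Weisfeiler--Leman algorithm for groups, Version II (Brachter \& Schweitzer), for $r$ rounds, where the initial coloring counts as the first round; in Version II, two $k$-tuples of group elements receive the same initial color iff the map between them extends to an isomorphism of the generated subgroups. A group is identified by WL if WL distinguishes it from every non-isomorphic group. *)

(* Defs.v *)
From HB Require Import structures.
From mathcomp Require Import all_boot all_fingroup all_solvable.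
From mathcomp Require Import finmap multiset.

Set Implicit Arguments.
Unset Strict Implicit.
Unset Printing Implicit Defensive.

Local Open Scope mset_scope.
Local Open Scope nat_scope.

(* In MathComp, N ><| H = G says that N is the normal factor; 'm(H) is the
   least size of a generating set of H. *)
Definition coprime_abelian_sdprod (d : nat) (gT : finGroupType) : Prop :=
  exists N H : {group gT},
    [/\ (N ><| H)%g = [set: gT], abelian N, 'm(H)%g <= d & coprime #|H| #|N|].

Section WeisfeilerLeman.

Variable k : nat.

Definition tuple_gen (gT : finGroupType) (t : k.-tuple gT) : {set gT} :=
  <<[set x in t]>>%g.

Definition marked_isog (gT hT : finGroupType)
    (t : k.-tuple gT) (u : k.-tuple hT) : bool :=
  [exists f : {ffun gT -> hT},
    misom (tuple_gen t) (tuple_gen u) f &&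
    [forall i, f (tnth t i) == tnth u i]].

Definition subst_tuple (T : Type) (t : k.-tuple T) (i : 'I_k) (x : T) :
    k.-tuple T :=
  [tuple if j == i then x else tnth t j | j < k].

(* WL is run on two groups in parallel, so both use one type of colors. *)
Fixpoint wl_color_type (C0 : choiceType) (r : nat) : choiceType :=
  if r is r'.+1 then
    (wl_color_type C0 r' * {mset k.-tuple (wl_color_type C0 r')})%type
  else C0.

(* [wl_color col0 r] is the coloring after r refinement steps, hence after
   r.+1 rounds when the initial coloring is counted as the first round. *)
Fixpoint wl_color (gT : finGroupType) (C0 : choiceType)
    (col0 : k.-tuple gT -> C0) (r : nat) : k.-tuple gT -> wl_color_type C0 r :=
  match r return k.-tuple gT -> wl_color_type C0 r with
  | 0 => col0
  | r'.+1 => fun t =>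
      (wl_color col0 r' t,
       seq_mset [seq [tuple wl_color col0 r' (subst_tuple t i x) | i < k]
                | x <- enum gT])
  end.

(* The initial color of a tuple t of xT, where xT is gT or hT, is its
   marked-isomorphism class among the k-tuples of gT and of hT. *)
Definition wl2_init (gT hT xT : finGroupType) (t : k.-tuple xT) :
    ({set k.-tuple gT} * {set k.-tuple hT})%type :=
  ([set u | marked_isog t u], [set u | marked_isog t u]).

Definition wl2_histogram (gT hT xT : finGroupType) (r : nat) :=
  seq_mset [seq wl_color (@wl2_init gT hT xT) r.-1 t
           | t <- enum {: k.-tuple xT}].

Definition wl2_distinguishes (r : nat) (gT hT : finGroupType) : Prop :=
  wl2_histogram gT hT gT r <> wl2_histogram gT hT hT r.

Definition wl2_identifies (r : nat) (gT : finGroupType) : Prop :=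
  forall hT : finGroupType,
    ~~ ([set: gT] \isog [set: hT]) -> wl2_distinguishes r gT hT.

End WeisfeilerLeman.

Variant move := MoveLeft | Stay | MoveRight.

Variant input_symbol (A : Type) := LeftEnd | RightEnd | Letter of A.
Arguments LeftEnd {A}.
Arguments RightEnd {A}.

(* Deterministic Turing machine with a two-way read-only input tape and
   finitely many one-way infinite work tapes; [tm_halt q = Some b] means that q
   is a halting state, accepting iff b. *)
Record turing_machine (A : finType) := TuringMachine {
  tm_state : finType;
  tm_letter : finType;
  tm_tapes : nat;
  tm_blank : tm_letter;
  tm_start : tm_state;
  tm_halt : tm_state -> option bool;
  tm_trans : tm_state -> input_symbol A -> tm_tapes.-tuple tm_letter ->
             tm_state * move * tm_tapes.-tuple (tm_letter * move)
}.

Record tm_config (A : finType) (M : turing_machine A) := TMConfig {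
  cfg_state : tm_state M;
  cfg_input_head : nat;
  cfg_head : 'I_(tm_tapes M) -> nat;
  cfg_tape : 'I_(tm_tapes M) -> nat -> tm_letter M
}.

Definition shift_head (m : move) (p : nat) : nat :=
  match m with MoveLeft => p.-1 | Stay => p | MoveRight => p.+1 end.

Section Run.

Variables (A : finType) (M : turing_machine A) (x : seq A).

Definition input_at (p : nat) : input_symbol A :=
  nth RightEnd (LeftEnd :: [seq Letter a | a <- x]) p.

Definition tm_init : tm_config M :=
  TMConfig (tm_start M) 0 (fun=> 0) (fun _ _ => tm_blank M).

(* The input head cannot leave the two end markers: otherwise its position
   would be an unbounded counter not charged to the space. *)
Definition tm_step (c : tm_config M) : tm_config M :=
  if tm_halt (cfg_state c) is Some _ then c else
  let: (q, m, w) :=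
    tm_trans (cfg_state c) (input_at (cfg_input_head c))
             [tuple cfg_tape c i (cfg_head c i) | i < tm_tapes M] in
  TMConfig q (minn (shift_head m (cfg_input_head c)) (size x).+1)
    (fun i => shift_head (tnth w i).2 (cfg_head c i))
    (fun i p => if p == cfg_head c i then (tnth w i).1 else cfg_tape c i p).

Definition tm_run (t : nat) : tm_config M := iter t tm_step tm_init.

End Run.

Definition in_logspace (A : finType) (L : pred (seq A)) : Prop :=
  exists (M : turing_machine A) (c : nat), forall x : seq A,
    (exists t, tm_halt (cfg_state (tm_run M x t)) = Some (L x)) /\
    (forall t i, cfg_head (tm_run M x t) i < c * (trunc_log 2 (size x)).+1).

Definition cayley_table_of (n : nat) (m : 'I_n -> 'I_n -> 'I_n)
    (gT : finGroupType) : Prop :=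
  exists e : 'I_n -> gT,
    bijective e /\ forall i j, e (m i j) = (e i * e j)%g.

(* Tables are written row by row over the alphabet {0, 1, separator}, where
   None is the separator: every entry is a binary numeral (least significant
   bit first, of the bit length of n) followed by a separator, and each row,
   as well as the whole table, is closed by one more separator. *)
Definition encode_entry (n i : nat) : seq (option bool) :=
  rcons [seq Some (odd (i %/ 2 ^ b)) | b <- iota 0 (trunc_log 2 n).+1] None.

Definition encode_table (n : nat) (m : 'I_n -> 'I_n -> 'I_n) :
    seq (option bool) :=
  rcons (flatten [seq rcons (flatten [seq encode_entry n (m i j)
                                     | j <- enum 'I_n]) None
                 | i <- enum 'I_n]) None.

(* Main.v *)
Require Import Defs.
From HB Require Import structures.
From mathcomp Require Import all_boot all_order all_fingroup all_solvable all_algebra.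
From mathcomp Require Import finmap multiset.
From mathcomp Require Import zify ring lra.
From Stdlib Require Import Classical FunctionalExtensionality.

(** Both halves rest on one criterion.  Let [G = H |x N] with [N] abelian and
    [|H|], [|N|] coprime, and let the tuple [h] generate [H].  Suppose that for
    some tuple [h'] of a group [K] there is a bijection [Phi : G^2 -> K^2] such
    that [(h, x, y)] and [(h', Phi (x, y))] are marked-isomorphic for all [x, y].
    Then [N' = {x | x^|N| = 1}] is an abelian normal subgroup of [K]
    complemented by [H' = <<h'>>], and the modules [N] and [N'] over [H = H']
    have equally many elements with each annihilator.  By coprimality the
    submodule generated by an element of maximal [p]-power order has an
    invariant complement, so [N] and [N'] can be compared by splitting off such
    submodules one after the other; they are isomorphic, hence so are [G], [K].

    Three rounds of [(d + 2)]-dimensional WL produce such a [Phi].  For the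
    logspace algorithm it suffices to count, for all [x, y], the pairs with a
    marked-isomorphic tuple on either side, so one must decide marked
    isomorphism of bounded-length tuples [t, u] in logarithmic space.  That is
    reachability in the Cayley graph of the group generated by the pairs
    [(t_i, u_i)].  In the manner of Reingold and of Rozenman and Vadhan, a step of
    the graph is replaced by several steps whose labels follow a walk on a
    constant-size expander; this multiplies the spectral gap by a constant.  After
    logarithmically many levels every vertex is hit, and the resulting recursive
    walk is run by an odometer with one constant-size cell per level.

    Algorithms are written for machines that sweep back and forth over
    [log |x|] cells of constant size, a model closed under composition, calls
    and loops; a single theorem compiles it to Turing machines. *)

Set Implicit Arguments.
Unset Strict Implicit.
Unset Printing Implicit Defensive.

(** * Coprime modules and their complements *)

(** Coprimality serves twice: it makes [N] the solution set of [x ^+ #|N| = 1], which any [Phi] as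
    above must respect, and it makes complements of submodules invariant. Two free entries are
    needed because commutativity of [N'], and with it closure under products, concerns pairs; the
    annihilator counts would need only one. The annihilators of two modules are compared through
    words over one abstract group.

    A group of order [n] with [R] generators, 1 among them, starts with a gap of [1 / (4 R^2 n^2)].
    Each level multiplies the gap by [16 R^2] until it reaches [7/8], so [W] levels suffice if
    [n <= 2^W]; then [W] steps, each with factor [1/8], bring the squared norm below what a missed
    vertex would force. The argument gives some initial stack of labels, not a fixed one, so the
    machine tries all stacks as well as all words. *)

Module CoprimeModules.
Local Open Scope group_scope.

Section Splitting.
Variable gT : finGroupType.
Implicit Types (N M H L : {group gT}) (x y z : gT).

Lemma abelian_mem_pcore pi N x : abelian N -> x \in N -> pi.-elt x -> x \in 'O_pi(N).
Proof.
move=> cNN Nx px.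
by rewrite (mem_normal_Hall (nilpotent_pcore_Hall pi (abelian_nil cNN)) (pcore_normal _ _) Nx).
Qed.

(** A homocyclic subgroup of full exponent is a direct factor: the last hypothesis says that every
    cyclic factor of [M] has order exactly [p ^ e.+1]. A subgroup [L] maximal among those that
    contain the [p']-part and meet [M] trivially is a complement, since an element outside [M * L]
    could be corrected by an element of [M] and then added to [L]. *)
Lemma homocyclic_splits p e N M : prime p -> abelian N -> M \subset N ->
    p.-group M ->
    (forall y, y \in N -> p.-elt y -> y ^+ (p ^ e.+1) = 1) ->
    (forall z, z \in M -> z ^+ (p ^ e) = 1 -> exists2 z1, z1 \in M & z = z1 ^+ p) ->
  [splits N, over M].
Proof.
move=> p_pr cNN sMN pM expN homM; set K := 'O_p^'(N).
have comN y z : y \in N -> z \in N -> commute y z by move=> Ny Nz; apply: (centsP cNN).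
pose P := fun L : {group gT} => [&& K \subset L, L \subset N & M :&: L == 1].
have PK : P 'O_p^'(N)%G.
  rewrite /P subxx pcore_sub /=; apply/eqP; apply: coprime_TIg.
  exact: (pnat_coprime pM (pcore_pgroup _ _)).
have [L /maxgroupP[/and3P[sKL sLN /eqP tiML] maxL] _] := maxgroup_exists PK.
have sMLN : M <*> L \subset N by rewrite join_subG sMN sLN.
have cML : L \subset 'C(M) by apply: sub_abelian_cent2 cNN sLN sMN.
have MLE : M <*> L = M * L by rewrite cent_joinEr.
have powK y : y \in N -> y ^+ (p ^ e.+1) \in L.
  move=> Ny; apply: (subsetP sKL); rewrite -[y in y ^+ _](consttC p).
  have Nyp pi : y.`_pi \in N by apply: groupX.
  rewrite expgMn; last exact: comN.
  rewrite (expN y.`_p) ?p_elt_constt // mul1g.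
  by apply: groupX; apply: abelian_mem_pcore; rewrite ?p_elt_constt.
suff sNML : N \subset M * L.
  apply/splitsP; exists L; apply/complP; split=> //.
  by apply/eqP; rewrite eqEsubset sNML -MLE sMLN.
apply/subsetP => y0 Ny0; apply/negPn/negP => notML.
have [k [nk yk]] : exists k, y0 ^+ (p ^ k) \notin M * L /\ y0 ^+ (p ^ k.+1) \in M * L.
  have exk : exists k, y0 ^+ (p ^ k) \in M * L.
    by exists e.+1; rewrite -MLE mem_gen // inE powK ?orbT.
  case: (ex_minnP exk) => -[|k] kin kmin; first by rewrite expg1 (negPf notML) in kin.
  by exists k; split=> //; apply/negP => /kmin; rewrite ltnn.
set y := y0 ^+ (p ^ k) in nk; have Ny : y \in N by apply: groupX.
have yp : y ^+ p \in M * L by rewrite /y -expgM -expnSr.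
case/mulsgP: yp => m l Mm Ll ypE.
have Nm := subsetP sMN m Mm; have Nl := subsetP sLN l Ll.
(* The [p]-part of [y ^+ (p ^ e.+1)] vanishes, so this power lies in [L]; hence [m ^+ (p ^ e)] lies
   in both [M] and [L]. *)
have me1 : m ^+ (p ^ e) = 1.
  apply/set1P; rewrite -[[set 1]]tiML inE groupX //=.
  have : (m * l) ^+ (p ^ e) \in L by rewrite -ypE -expgM -expnS powK.
  rewrite expgMn; last exact: comN.
  by rewrite groupMr // groupX.
have [m1 Mm1 mE] := homM m Mm me1; have Nm1 := subsetP sMN m1 Mm1.
(* Dividing by [m1] keeps the coset of [M * L] and moves the [p]-th power into [L]. *)
pose z := y * m1^-1; have Nz : z \in N by rewrite groupM ?groupV.
have zp : z ^+ p = l.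
  rewrite expgMn; last by apply: comN; rewrite ?groupV.
  by rewrite ypE expgVn -mE (comN m l Nm Nl) mulgK.
have notz : z \notin M * L.
  rewrite -MLE in nk *; apply: contra nk => zML; rewrite -[y](mulgKV m1) -/z.
  by rewrite groupM // mem_gen // inE Mm1.
have LzP : ~~ P (L <*> <[z]>)%G.
  apply/negP => Pz; have eqL := maxL _ Pz (joing_subl _ _).
  case/negP: notz; rewrite -MLE mem_gen // inE; apply/orP; right.
  by rewrite -eqL mem_gen // inE cycle_id orbT.
have sLzN : L <*> <[z]> \subset N by rewrite join_subG sLN cycle_subG.
have cLz : <[z]> \subset 'C(L) by apply: sub_abelian_cent2 cNN _ sLN; rewrite cycle_subG.
move: LzP; rewrite /P (subset_trans sKL (joing_subl _ _)) sLzN /=.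
case/trivgPn => u; rewrite inE /= cent_joinEr // => /andP[Mu /mulsgP[l1 v Ll1 /cycleP[j ->] uE]] nu.
(* Here [u] in [M] equals [l1 * z ^+ j]. If [p] divides [j], then [u] lies in [L] too and is 1;
   otherwise [z ^+ j] and [z ^+ p] both lie in [M * L], and Bezout puts [z] there. *)
case/negP: nu; apply/eqP; case: (boolP (p %| j)) => [/dvdnP[i jE]|ndvd].
  apply/set1P; rewrite -[[set 1]]tiML inE Mu uE groupM //.
  by rewrite jE mulnC expgM zp groupX.
case/negP: notz.
have zj : z ^+ j \in M <*> L.
  rewrite -(mulKg l1 (z ^+ j)) -uE groupM ?groupV ?mem_gen ?inE ?Mu ?Ll1 ?orbT //.
have zpML : z ^+ p \in M <*> L by rewrite zp mem_gen // inE Ll orbT.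
have [a _ /dvdnP[b abE]] := Bezoutl j (prime_gt0 p_pr).
have cop : gcdn p j = 1%N by apply/eqP; rewrite -/(coprime p j) prime_coprime.
rewrite cop in abE.
have : z ^+ (1 + a * j) \in M <*> L by rewrite abE mulnC expgM groupX.
by rewrite -MLE expgD expg1 (mulnC a) expgM groupMr // groupX.
Qed.

(** A Maschke theorem for abelian groups of any exponent, by Gaschutz: [M] has a complement in [N],
    and the index of [N] in [N <*> H] is prime to [#|M|], so [M] has a complement [W] in [N <*> H].
    The group [W :&: N] is normalised by [W], and by [M] because [N] is abelian, hence by their
    product. *)
Lemma invariant_complement N M H : abelian N -> M \subset N ->
    H \subset 'N(N) -> H \subset 'N(M) -> coprime #|N| #|H| ->
    [splits N, over M] ->
  exists L : {group gT}, [/\ M :&: L = 1, M * L = N & H \subset 'N(L)].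
Proof.
move=> cNN sMN nNH nMH coNH splitN; pose X := (N <*> H)%G.
have XE : X = N * H :> {set gT} by rewrite /= norm_joinEr.
have sNX : N \subset X := joing_subl _ _.
have cNM : N \subset 'C(M) by apply: sub_abelian_cent2 cNN (subxx _) sMN.
have nsMX : M <| X.
  rewrite /normal (subset_trans sMN sNX) join_subG nMH andbT.
  exact: cents_norm.
have nsNX : N <| X by rewrite /normal sNX join_subG normG nNH.
have tiNH : N :&: H = 1 by apply: coprime_TIg.
have coMX : coprime #|M| #|X : N|.
  rewrite -divgS // XE TI_cardMg // mulKn ?cardG_gt0 //.
  exact: coprimeSg coNH.
move: splitN; rewrite -(Gaschutz_split nsMX sMN sNX (abelianS sMN cNN) coMX).
case/splitsP => W /complP[tiMW MWX].
have sWX : W \subset X by rewrite -MWX mulG_subr.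
exists (W :&: N)%G; split.
- by rewrite /= setIA tiMW; apply/setIidPl; rewrite sub1G.
- by rewrite /= group_modl // MWX; apply/setIidPr.
apply: subset_trans (joing_subr N H) _; rewrite -/X.
have -> : N <*> H = M * W by rewrite MWX.
rewrite mul_subG //.
  rewrite cents_norm // centsC; apply: sub_abelian_cent2 cNN _ sMN.
  exact: subsetIr.
by rewrite normsI ?normG // (subset_trans sWX) // normal_norm.
Qed.

(** [<<x ^: H>>] is the cyclic submodule generated by [x]. For exponent dividing [p ^ e.+1] the
    condition says that it is homocyclic, in the form that [homocyclic_splits] takes. *)
Definition homocyclic_gen p e H x :=
  forall z, z \in <<x ^: H>> -> z ^+ (p ^ e) = 1 ->
    exists2 z1, z1 \in <<x ^: H>> & z = z1 ^+ p.

Lemma class_gen_sub N H x : H \subset 'N(N) -> x \in N -> <<x ^: H>> \subset N.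
Proof. by move=> nNH Nx; rewrite gen_subG class_sub_norm. Qed.

Lemma class_gen_norm H x : H \subset 'N(<<x ^: H>>).
Proof. by apply: norms_gen; apply: class_norm. Qed.

Lemma class_gen_pgroup p N H x : abelian N -> H \subset 'N(N) -> x \in N ->
  p.-elt x -> p.-group <<x ^: H>>.
Proof.
move=> cNN nNH Nx px; apply: pgroupS (pcore_pgroup p N).
apply: class_gen_sub; last exact: abelian_mem_pcore.
exact: (char_norm_trans (pcore_char p N)).
Qed.

End Splitting.

(** Maximal order alone is not enough, since the submodule may have parts of smaller exponent. Among
    the elements of full [p]-power order, [x] is taken with the smallest submodule [M]. In the
    elementary abelian [M / 'Phi(M)] the image of ['Ohm_e(M)] has an invariant complement
    [L / 'Phi(M)]. A component of [x] in [L] still has full order, so minimality gives [L = M], and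
    then ['Ohm_e(M)] lies in ['Phi(M)], the group of [p]-th powers. *)
Lemma exists_homocyclic_gen (gT : finGroupType) (N H : {group gT}) : abelian N -> H \subset 'N(N) ->
    coprime #|N| #|H| -> N :!=: 1 ->
  exists p e x, [/\ prime p, x \in N, p.-elt x, x != 1 &
     (forall y, y \in N -> p.-elt y -> y ^+ (p ^ e.+1) = 1) /\
     homocyclic_gen p e H x].
Proof.
move=> cNN nNH coNH ntN.
have comN y z : y \in N -> z \in N -> commute y z by move=> Ny Nz; apply: (centsP cNN).
pose p := pdiv #|N|; have p_pr : prime p by rewrite pdiv_prime // cardG_gt1.
have [w Nw ow] := Cauchy p_pr (pdiv_dvd #|N|).
have [e [expN [x1 [Nx1 px1 x1e]]]] : exists e,
    (forall y, y \in N -> p.-elt y -> y ^+ (p ^ e.+1) = 1) /\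
    exists x1, [/\ x1 \in N, p.-elt x1 & x1 ^+ (p ^ e) != 1].
  pose Pe k := [forall y in N, p.-elt y ==> (y ^+ (p ^ k) == 1)].
  have exP : exists k, Pe k.
    exists (logn p #|N|); apply/forall_inP => y Ny; apply/implyP => py.
    by rewrite -order_dvdn -p_part -(part_pnat_id py) partn_dvd // order_dvdG.
  case: (ex_minnP exP) => -[|e] Pee mine.
    have /forall_inP /(_ w Nw) := Pee; rewrite expg1 /p_elt ow pnat_id //= => /eqP w1.
    by move: ow p_pr; rewrite w1 order1 => <-.
  exists e; split.
    by move=> y Ny py; apply/eqP; have /forall_inP/(_ y Ny)/implyP := Pee; apply.
  have : ~~ Pe e by apply/negP => /mine; rewrite ltnn.
  rewrite /Pe negb_forall_in => /exists_inP[y Ny].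
  by rewrite negb_imply => /andP[]; exists y.
pose good y := [&& y \in N, p.-elt y & y ^+ (p ^ e) != 1].
have good1 : good x1 by rewrite /good Nx1 px1.
case: (@arg_minnP _ x1 good (fun y => #|<<y ^: H>>|) good1) => x /and3P[Nx px xe] minx.
exists p, e, x; split=> //; first by apply: contraNneq xe => ->; rewrite expg1n.
split=> //.
set M := <<x ^: H>>%G; rewrite /homocyclic_gen -/M.
have sMN : M \subset N by apply: class_gen_sub.
have pM : p.-group M by apply: class_gen_pgroup cNN nNH Nx px.
have cMM : abelian M by apply: abelianS cNN.
have nMH : H \subset 'N(M) by apply: class_gen_norm.
have Mx : x \in M by rewrite mem_gen ?class_refl.
pose P1 := 'Phi(M)%G.
have nP1H : H \subset 'N(P1) by apply: char_norm_trans (Phi_char M) nMH.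
have sP1M : P1 \subset M by apply: Phi_sub.
have nP1M : M \subset 'N(P1) by apply: sub_abelian_norm.
pose K := 'Ohm_e(M)%G.
have KE z : (z \in K) = (z \in M) && (z ^+ (p ^ e) == 1).
  rewrite /K /= (OhmEabelian pM) ?inE //.
  exact: abelianS (Ohm_sub _ _) cMM.
have sKM : K \subset M by apply: Ohm_sub.
have PhiE : P1 = [set z ^+ p | z in M] :> {set gT}.
  by rewrite /P1 /= (Phi_Mho pM cMM) (MhoEabelian 1 pM cMM).
have sP1K : P1 \subset K.
  apply/subsetP => z zP; rewrite KE (subsetP sP1M) //=.
  move: zP; rewrite PhiE => /imsetP[y My ->]; rewrite -expgM -expnS.
  by rewrite expN ?(subsetP sMN) //; apply: mem_p_elt pM My.
have nKH : H \subset 'N(K) by apply: char_norm_trans (Ohm_char _ M) nMH.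
have abelMb : p.-abelem (M / P1) by apply: Phi_quotient_abelem.
have splitMb := abelem_splits abelMb (quotientS P1 sKM).
have coMbHb : coprime #|M / P1| #|H / P1|.
  by apply: coprime_morph; apply: coprimeSg coNH.
have [Lb [tiKL KLM nLH]] := invariant_complement (abelem_abelian abelMb)
   (quotientS P1 sKM) (quotient_norms P1 nMH) (quotient_norms P1 nKH) coMbHb splitMb.
have sLbM : Lb \subset M / P1 by rewrite -KLM mulG_subr.
pose L := (coset P1 @*^-1 Lb)%G.
have LbE : L / P1 = Lb by apply: cosetpreK.
have sLM : L \subset M.
  by rewrite -(quotientGK (_ : P1 <| M)) ?morphpreS // /normal sP1M.
have nLH' : H \subset 'N(L).
  apply/subsetP => h Hh; rewrite inE; apply/subsetP => _ /imsetP[z zL ->].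
  have nh := subsetP nP1H h Hh; case/morphpreP: zL => nz zL.
  apply/morphpreP; rewrite groupJ //; split=> //.
  by rewrite morphJ // memJ_norm // (subsetP nLH) // mem_quotient.
(* [x] is a product of elements of ['Phi(M)], ['Ohm_e(M)] and [L]; the first two are killed by
   [p ^ e]. *)
have [y Ly ye] : exists2 y, y \in L & y ^+ (p ^ e) = x ^+ (p ^ e).
  have : coset P1 x \in M / P1 by rewrite mem_quotient.
  rewrite -KLM => /mulsgP[kb lb /morphimP[k nk Kk kbE] lbL cosE]; move: lbL.
  rewrite -LbE => /morphimP[y ny Ly lbE].
  have Mk := subsetP sKM k Kk; have My := subsetP sLM y Ly.
  rewrite kbE lbE -morphM // in cosE.
  have /rcosetP[z P1z xE] : x \in P1 :* (k * y).
    by apply/rcoset_kercosetP; rewrite ?groupM // (subsetP nP1M).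
  exists y => //; rewrite xE mulgA.
  have Kzk : z * k \in K by rewrite groupM // (subsetP sP1K).
  rewrite expgMn; last by apply: comN; apply: (subsetP sMN) => //; apply: (subsetP sKM).
  by move: Kzk; rewrite KE => /andP[_ /eqP ->]; rewrite mul1g.
have My := subsetP sLM y Ly.
have Ny := subsetP sMN y My.
have goody : good y by rewrite /good Ny ye xe (mem_p_elt pM).
have sML : M \subset L.
  have sL : <<y ^: H>> \subset L by apply: class_gen_sub.
  have cML : #|M| <= #|L| by apply: leq_trans (minx _ goody) (subset_leq_card sL).
  by have /eqP <- : L == M :> {set gT} by rewrite eqEcard sLM.
have sKP : K \subset P1.
  rewrite -quotient_sub1 ?(subset_trans sKM) // -tiKL subsetI subxx /=.
  by rewrite -LbE quotientS // (subset_trans sKM).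
move=> z Mz ze; have : z \in P1 by rewrite (subsetP sKP) // KE Mz ze eqxx.
by rewrite PhiE => /imsetP[z1 Mz1 ->]; exists z1.
Qed.

(** * Words over an abstract operator group acting on a module *)

Section WordAction.
Variables (aT gT : finGroupType) (rho : aT -> gT) (N H : {group gT}).
Implicit Types (w : seq aT) (x y : gT).

(** The action of the group-ring element that is the sum of the letters. Sums suffice, because in a
    finite [N] repeating a word [#|N|.-1] times inverts its value. Letters from an abstract [aT] let
    the same word act on two modules. *)
Definition ev w x : gT := \prod_(a <- w) x ^ rho a.

Definition wmodule := [/\ {morph rho : a b / a * b}, H = rho @: setT :> {set gT},
  abelian N, H \subset 'N(N) & coprime #|N| #|H|].

Definition killed (I : seq (seq aT)) x := all (fun w => ev w x == 1) I.

Definition cnt (I : seq (seq aT)) := #|[set x in N | killed I x]|.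

Hypothesis modN : wmodule.

Lemma rho1 : rho 1 = 1.
Proof.
by case: modN => rhoM _ _ _ _; apply: (mulgI (rho 1)); rewrite -rhoM !mulg1.
Qed.

Lemma rho_in a : rho a \in H.
Proof. by case: modN => _ -> _ _ _; apply: imset_f; rewrite inE. Qed.

Lemma comN x y : x \in N -> y \in N -> commute x y.
Proof. by case: modN => _ _ cNN _ _ Nx Ny; apply: (centsP cNN). Qed.

Lemma act_in x a : x \in N -> x ^ rho a \in N.
Proof.
by case: modN => _ _ _ nNH _ Nx; rewrite memJ_norm // (subsetP nNH) ?rho_in.
Qed.

Lemma ev_cat w w' x : ev (w ++ w') x = ev w x * ev w' x.
Proof. exact: big_cat. Qed.

Lemma ev_cons a w x : ev (a :: w) x = x ^ rho a * ev w x.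
Proof. exact: big_cons. Qed.

Lemma ev_in w x : x \in N -> ev w x \in N.
Proof. by move=> Nx; apply: group_prod => a _; apply: act_in. Qed.

Lemma evM w x y : x \in N -> y \in N -> ev w (x * y) = ev w x * ev w y.
Proof.
move=> Nx Ny; elim: w => [|a w IH]; first by rewrite /ev !big_nil mulg1.
have cY := comN (act_in a Ny) (ev_in w Nx).
rewrite !ev_cons IH conjMg; move: (x ^ rho a) (y ^ rho a) cY => X Y cY.
by rewrite -!mulgA (mulgA Y) cY -!mulgA.
Qed.

Lemma ev1 w : ev w 1 = 1.
Proof. by elim: w => [|a w IH]; rewrite ?ev_cons ?IH ?conj1g ?mulg1 // /ev big_nil. Qed.

Lemma ev_act w x b : ev [seq a * b | a <- w] x = ev w x ^ rho b.
Proof.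
case: modN => rhoM _ _ _ _.
elim: w => [|a w IH]; first by rewrite /ev !big_nil conj1g.
by rewrite /= !ev_cons IH conjMg rhoM conjgM.
Qed.

Definition rep k w : seq aT := flatten (nseq k w).

Lemma ev_rep k w x : ev (rep k w) x = ev w x ^+ k.
Proof.
elim: k => [|k IH]; first by rewrite /ev big_nil.
by rewrite /rep /= ev_cat -/(rep k w) IH expgS.
Qed.

Lemma ev_inv w x : x \in N -> ev (rep #|N|.-1 w) x = (ev w x)^-1.
Proof.
move=> Nx; apply/esym/eqP; rewrite eq_invg_mul ev_rep -expgS prednK ?cardG_gt0 //.
by rewrite expg_cardG // ev_in.
Qed.

Lemma ev_id x : ev [:: 1] x = x.
Proof. by rewrite ev_cons rho1 conjg1 /ev big_nil mulg1. Qed.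

Lemma class_genP x y : reflect (exists w, y = ev w x) (y \in <<x ^: H>>).
Proof.
have HE : H = rho @: setT :> {set gT} by case: modN.
apply: (iffP idP) => [|[w ->]]; last first.
  apply: group_prod => a _; rewrite mem_gen //; apply: imset_f; exact: rho_in.
case/gen_prodgP => n [c cin ->].
elim: n c cin => [|n IH] c cin; first by exists [::]; rewrite big_ord0 /ev big_nil.
have [|w wE] := IH (fun i => c (lift ord0 i)); first by move=> i; apply: cin.
rewrite big_ord_recl wE.
have /imsetP[h Hh ->] := cin ord0; move: Hh; rewrite HE => /imsetP[a _ ->].
by exists (a :: w); rewrite ev_cons.
Qed.

End WordAction.

Lemma wmodule_sub (aT gT : finGroupType) (rho : aT -> gT) (N L H : {group gT}) :
  wmodule rho N H -> L \subset N -> H \subset 'N(L) -> wmodule rho L H.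
Proof.
move=> [rM HE cNN nNH co] sLN nLH; split=> //; first exact: abelianS cNN.
exact: coprimeSg co.
Qed.

(** * Two modules with equally many elements of each annihilator *)

Section SameAnn.
Variables (aT gT hT : finGroupType) (rho : aT -> gT) (rho' : aT -> hT).
Variables (N H : {group gT}) (N' H' : {group hT}).
Hypotheses (modN : wmodule rho N H) (modN' : wmodule rho' N' H').
Hypothesis cntE : forall I, cnt rho N I = cnt rho' N' I.

Lemma cnt_cardE : #|N| = #|N'|.
Proof.
have := cntE [::]; rewrite /cnt /killed /= => e.
by rewrite -(eq_card (_ : [set x in N | true] =i N)) ?e => [|x]; [apply: eq_card => x|]; rewrite inE andbT.
Qed.

Definition cntD (gT0 : finGroupType) (r : aT -> gT0) (N0 : {group gT0}) I J :=
  #|[set x in N0 | killed r I x && all (fun w => ev r w x != 1) J]|.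

(** The words of [J] are treated one at a time: elements not killed by [w] are what remains after
    removing those killed by [w :: I], and both other counts are known to agree. *)
Lemma cntD_eq I J : cntD rho N I J = cntD rho' N' I J.
Proof.
have split0 (gT0 : finGroupType) (r : aT -> gT0) (N0 : {group gT0}) K w L :
    cntD r N0 K L = (cntD r N0 (w :: K) L + cntD r N0 K (w :: L))%N.
  rewrite /cntD -(cardsID [set x | ev r w x == 1]); congr (_ + _)%N; apply: eq_card => x;
    rewrite !inE /=; case: (ev r w x == 1); rewrite ?andbF ?andbT //=.
elim: J I => [|w J IH] I.
  have := cntE I; rewrite /cnt /cntD => e.
  rewrite -[LHS](eq_card (A := [set x in N | killed rho I x])) ?e.
    by apply: eq_card => x; rewrite !inE andbT.
  by move=> x; rewrite !inE andbT.
have := IH I; rewrite (split0 _ _ _ _ w) (split0 _ rho' _ _ w) IH.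
by move/addnI.
Qed.

(** If no [x'] had the annihilator of [x], each [x'] would have a word telling it from [x]. These
    are finitely many words, and [cntD_eq] gives an [x'] that treats all of them as [x] does, its
    own separating word included. *)
Lemma same_ann x : x \in N ->
  exists2 x', x' \in N' & forall w, (ev rho w x == 1) = (ev rho' w x' == 1).
Proof.
move=> Nx; apply: NNPP => no.
have sep x' : exists w, x' \in N' -> (ev rho w x == 1) <> (ev rho' w x' == 1).
  apply: NNPP => now; apply: no; exists x'.
    by apply/negPn/negP => nx'; apply: now; exists [::] => inx; rewrite inx in nx'.
  by move=> w; apply: NNPP => ne; apply: now; exists w.
have [w wP] := fin_all_exists sep.
pose I := [seq w x' | x' <- enum hT & ev rho (w x') x == 1].
pose J := [seq w x' | x' <- enum hT & ev rho (w x') x != 1].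
have : 0 < cntD rho N I J.
  apply/card_gt0P; exists x; rewrite inE Nx /=; apply/andP; split.
    by apply/allP => v /mapP[x']; rewrite mem_filter => /andP[? _] ->.
  by apply/allP => v /mapP[x']; rewrite mem_filter => /andP[? _] ->.
rewrite cntD_eq => /card_gt0P[x']; rewrite inE => /and3P[Nx' /allP kI /allP kJ].
apply: (wP x' Nx'); case E : (ev rho (w x') x == 1).
  by apply/esym/kI/map_f; rewrite mem_filter E mem_enum.
by apply/esym/negbTE/kJ/map_f; rewrite mem_filter E mem_enum.
Qed.

Section Transfer.
Variables (x : gT) (x' : hT).
Hypotheses (Nx : x \in N) (Nx' : x' \in N').
Hypothesis ann : forall w, (ev rho w x == 1) = (ev rho' w x' == 1).

Lemma ann_eq w v : (ev rho w x == ev rho v x) = (ev rho' w x' == ev rho' v x').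
Proof.
rewrite [LHS]eq_mulVg1 [RHS]eq_mulVg1.
rewrite -(ev_inv modN) // -(ev_inv modN') // -cnt_cardE.
by rewrite -!ev_cat ann.
Qed.

Lemma ann_expg k w : (ev rho w x ^+ k == 1) = (ev rho' w x' ^+ k == 1).
Proof. by rewrite -!ev_rep ann. Qed.

Lemma ann_order : #[x] = #[x'].
Proof.
apply/eqP; rewrite eqn_dvd !order_dvdn.
have E k : (x ^+ k == 1) = (x' ^+ k == 1).
  by have := ann_expg k [:: 1]; rewrite (ev_id modN) (ev_id modN').
by rewrite (E #[x']) -(E #[x]) !expg_order !eqxx.
Qed.

(** The map takes the value of a word at [x] to its value at [x']. It is well defined and injective
    because, inverses being words, equality of two values is a question about annihilators. *)
Lemma ann_isom : exists f : gT -> hT,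
  [/\ {in <<x ^: H>> &, {morph f : y z / y * z}},
      {in <<x ^: H>> &, injective f},
      f @: <<x ^: H>> = <<x' ^: H'>>
    & forall y a, y \in <<x ^: H>> -> f (y ^ rho a) = f y ^ rho' a].
Proof.
have wd y : exists w, y \in <<x ^: H>> -> y = ev rho w x.
  case: (boolP (y \in <<x ^: H>>)) => [/(class_genP modN)[w ->]|_]; first by exists w.
  by exists [::].
have [w wP] := fin_all_exists wd.
pose f y := ev rho' (w y) x'.
have fE v : f (ev rho v x) = ev rho' v x'.
  apply/eqP; rewrite -ann_eq; apply/eqP/esym/wP.
  by apply/(class_genP modN); exists v.
exists f; split.
- move=> y z /(class_genP modN)[v ->] /(class_genP modN)[u ->].
  by rewrite -ev_cat !fE ev_cat.
- move=> y z /(class_genP modN)[v ->] /(class_genP modN)[u ->].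
  by rewrite !fE => /eqP; rewrite -ann_eq => /eqP.
- apply/setP => y'; apply/imsetP/(class_genP modN') => [[y]|[v ->]].
    by case/(class_genP modN) => v -> ->; exists v.
  by exists (ev rho v x); rewrite ?fE //; apply/(class_genP modN); exists v.
move=> y a /(class_genP modN)[v ->].
by rewrite -(ev_act modN) !fE (ev_act modN').
Qed.

End Transfer.
End SameAnn.

(** A word acts additively and preserves both summands, so it kills a product exactly when it kills
    both factors. *)
Lemma cnt_dprod (aT gT : finGroupType) (rho : aT -> gT) (N M L H : {group gT}) I :
  wmodule rho N H -> H \subset 'N(M) -> H \subset 'N(L) ->
  M \subset N -> L \subset N -> M :&: L = 1 -> M * L = N ->
  cnt rho N I = (cnt rho M I * cnt rho L I)%N.
Proof.
move=> modN nMH nLH sMN sLN tiML MLN.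
have modM := wmodule_sub modN sMN nMH; have modL := wmodule_sub modN sLN nLH.
rewrite /cnt -cardsX -(card_in_imset (f := fun z : gT * gT => z.1 * z.2)).
  apply: eq_card => x; rewrite inE; apply/andP/imsetP => [[]|[[m l]]].
    rewrite -MLN => /mulsgP[m l Mm Ll ->] kx; exists (m, l) => //.
    suff kE w : (ev rho w (m * l) == 1) = (ev rho w m == 1) && (ev rho w l == 1).
      rewrite !inE /= Mm Ll /= /killed; apply/andP; split; apply/allP => w Iw;
        by have := allP kx w Iw; rewrite /= kE => /andP[].
    rewrite (evM modN w (subsetP sMN m Mm) (subsetP sLN l Ll)).
    apply/eqP/andP => [e|[/eqP-> /eqP->]]; last by rewrite mulg1.
    have em := ev_in modM w Mm; have el := ev_in modL w Ll.
    suff m1 : ev rho w m = 1 by rewrite m1 eqxx; move: e; rewrite m1 mul1g => ->.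
    apply/set1P; rewrite -[[set 1]]tiML inE em /=.
    have -> : ev rho w m = (ev rho w l)^-1.
      by apply/eqP; rewrite eq_mulgV1 invgK; apply/eqP.
    by rewrite groupV.
  case/setXP; rewrite !inE /= => /andP[Mm km] /andP[Ll kl] ->.
  rewrite -MLN mem_mulg //; split=> //; apply/allP => w Iw /=.
  rewrite (evM modN w (subsetP sMN m Mm) (subsetP sLN l Ll)).
  by rewrite (eqP (allP km w Iw)) (eqP (allP kl w Iw)) mulg1.
move=> [m l] [m1 l1]; rewrite !inE /= => /andP[/andP[Mm _] /andP[Ll _]].
move=> /andP[/andP[Mm1 _] /andP[Ll1 _]] e.
have e2 : m1^-1 * m = l1 * l^-1 by rewrite -(mulgK l m) e !mulgA mulVg mul1g.
have : m1^-1 * m \in M :&: L.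
  by rewrite inE groupM ?groupV //= e2 groupM ?groupV.
rewrite tiML => /set1P e3; rewrite e3 in e2.
have -> : m = m1 by apply/eqP; rewrite eq_sym eq_mulVg1 e3.
by congr (_, _); apply/esym/eqP; rewrite eq_mulgV1 -e2.
Qed.

Lemma module_iso (aT gT hT : finGroupType) (rho : aT -> gT) (rho' : aT -> hT)
    (N H : {group gT}) (N' H' : {group hT}) :
  wmodule rho N H -> wmodule rho' N' H' ->
  (forall I, cnt rho N I = cnt rho' N' I) ->
  exists f : {morphism N >-> hT}, [/\ 'injm f, f @* N = N' &
    forall x a, x \in N -> f (x ^ rho a) = f x ^ rho' a].
Proof.
have [n] := ubnP #|N|; elim: n N N' => // n IH N N' /ltnSE leN modN modN' cE.
have cNN : abelian N by case: modN.
have nNH : H \subset 'N(N) by case: modN.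
have coNH : coprime #|N| #|H| by case: modN.
have cNN' : abelian N' by case: modN'.
have nNH' : H' \subset 'N(N') by case: modN'.
have coNH' : coprime #|N'| #|H'| by case: modN'.
have cN := cnt_cardE cE.
have [N1|ntN] := eqVneq (N : {set gT}) 1.
  have N1' : N' = 1 :> {set hT} by apply/eqP; rewrite trivg_card1 -cN N1 cards1.
  exists [morphism of @trivm _ hT N]; split.
  - by apply/injmP => x y; rewrite N1 => /set1P-> /set1P->.
  - by rewrite N1' morphim_trivm.
  - by move=> x a; rewrite N1 => /set1P->; rewrite conj1g /= /trivm conj1g.
have [p [e [x [p_pr Nx px nx1 [expN hx]]]]] := exists_homocyclic_gen cNN nNH coNH ntN.
have [x' Nx' ann] := same_ann cE Nx.
have cE' I : cnt rho' N' I = cnt rho N I by rewrite cE.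
have expN' y : y \in N' -> p.-elt y -> y ^+ (p ^ e.+1) = 1.
  move=> Ny py; have [z Nz annz] := same_ann cE' Ny.
  have oz : #[z] = #[y] by rewrite (ann_order modN' modN annz).
  apply/eqP; rewrite -order_dvdn -oz order_dvdn expN //.
  by rewrite /p_elt oz.
have px' : p.-elt x' by rewrite /p_elt -(ann_order modN modN' ann).
set M := <<x ^: H>>%G; set M' := <<x' ^: H'>>%G.
have sMN : M \subset N by apply: class_gen_sub.
have sMN' : M' \subset N' by apply: class_gen_sub.
have nMH : H \subset 'N(M) by apply: class_gen_norm.
have nMH' : H' \subset 'N(M') by apply: class_gen_norm.
have pM : p.-group M by apply: class_gen_pgroup cNN nNH Nx px.
have pM' : p.-group M' by apply: class_gen_pgroup cNN' nNH' Nx' px'.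
have [f [fM f_inj fim fact]] := ann_isom modN modN' cE Nx Nx' ann.
(* Being homocyclic can be phrased by equations between words at [x], so it passes to [x']. *)
have hx' : homocyclic_gen p e H' x'.
  move=> z /(class_genP modN')[w ->] wE.
  have Mw : ev rho w x \in M by apply/(class_genP modN); exists w.
  have := hx (ev rho w x) Mw; case.
    by apply/eqP; rewrite (ann_expg ann); apply/eqP.
  move=> z1 /(class_genP modN)[v ->]; rewrite -ev_rep => /eqP.
  rewrite (ann_eq modN modN' cE Nx Nx' ann) ev_rep => /eqP ->.
  by exists (ev rho' v x') => //; apply/(class_genP modN'); exists v.
have spN := homocyclic_splits p_pr cNN sMN pM expN hx.
have spN' := homocyclic_splits p_pr cNN' sMN' pM' expN' hx'.
have [L [tiML MLN nLH]] := invariant_complement cNN sMN nNH nMH coNH spN.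
have [L' [tiML' MLN' nLH']] := invariant_complement cNN' sMN' nNH' nMH' coNH' spN'.
have sLN : L \subset N by rewrite -MLN mulG_subr.
have sLN' : L' \subset N' by rewrite -MLN' mulG_subr.
pose fm := Morphism fM.
have injf : 'injm fm by apply/injmP.
have imf : fm @* M = M' by rewrite /= morphimEdom /= fim.
have cM I : cnt rho M I = cnt rho' M' I.
  have modM := wmodule_sub modN sMN nMH.
  have fev w y : y \in M -> f (ev rho w y) = ev rho' w (f y).
    move=> My; elim: w => [|a w IHw]; first by rewrite /ev !big_nil; apply: (morph1 fm).
    rewrite !ev_cons fM ?fact ?IHw //; first exact: (act_in modM).
    exact: (ev_in modM).
  rewrite /cnt -(card_in_imset (f := f)) => [|y z]; last first.
    by rewrite !inE => /andP[My _] /andP[Mz _]; apply: f_inj.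
  apply: eq_card => y'; rewrite inE.
  have kE y : y \in M -> killed rho I y = killed rho' I (f y).
    move=> My; apply: eq_all => w; rewrite -fev //.
    by rewrite (morph_injm_eq1 injf) //; apply: (ev_in modM).
  apply/imsetP/andP => [[y]|[]].
    rewrite inE => /andP[My ky] ->; rewrite -kE // ky; split=> //.
    by rewrite /M' /= -fim imset_f.
  rewrite {1}/M' /= -fim => /imsetP[y My ->].
  by rewrite -kE // => ky; exists y; rewrite // inE My.
(* Counts are multiplicative over direct sums, and the factor of [M] is nonzero because 1 is always
   killed; it cancels and the induction can continue with [L] and [L']. *)
have cL I : cnt rho L I = cnt rho' L' I.
  have := cE I; rewrite (cnt_dprod I modN nMH nLH sMN sLN tiML MLN).
  rewrite (cnt_dprod I modN' nMH' nLH' sMN' sLN' tiML' MLN') cM => /eqP.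
  rewrite eqn_pmul2l => [/eqP //|]; apply/card_gt0P; exists 1; rewrite inE group1.
  by apply/allP => w _; rewrite /= ev1.
have ltL : #|L| < n.
  apply: leq_trans leN; rewrite -MLN TI_cardMg // ltn_Pmull ?cardG_gt0 // cardG_gt1.
  by apply/trivgPn; exists x => //; rewrite mem_gen ?class_refl.
have [g [injg img gact]] := IH L L' ltL (wmodule_sub modN sLN nLH)
   (wmodule_sub modN' sLN' nLH') cL.
have defN : M \x L = N.
  rewrite dprodE //; apply: sub_abelian_cent2 cNN sLN sMN.
have cfg : g @* L \subset 'C(fm @* M).
  by rewrite img imf; apply: sub_abelian_cent2 cNN' sLN' sMN'.
exists [morphism of dprodm defN cfg]; split.
- by rewrite injm_dprodm injf injg img imf tiML' eqxx.
- by rewrite im_dprodm img imf MLN'.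
move=> y a Ny; have /mulsgP[m l Mm Ll ->] : y \in M * L by rewrite MLN.
rewrite /=.
have ra := rho_in modN a.
have Mma : m ^ rho a \in M by rewrite memJ_norm // (subsetP nMH).
have Lla : l ^ rho a \in L by rewrite memJ_norm // (subsetP nLH).
by rewrite conjMg !dprodmE // conjMg gact //= fact.
Qed.

Definition tup2 (T : Type) d (h : d.-tuple T) (x y : T) : d.+2.-tuple T :=
  [tuple of x :: y :: h].

Lemma tnth_tup2 (T : Type) d (h : d.-tuple T) (x y : T) i :
  tnth (tup2 h x y) (lift ord0 (lift ord0 i)) = tnth h i.
Proof. by rewrite !(tnth_nth x). Qed.

Lemma marked_isogP k (gT hT : finGroupType) (t : k.-tuple gT) (u : k.-tuple hT) :
  reflect (exists f : {morphism <<[set x in t]>> >-> hT},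
             [/\ 'injm f, f @* <<[set x in t]>> = <<[set x in u]>> &
                 forall i, f (tnth t i) = tnth u i])
          (marked_isog t u).
Proof.
apply: (iffP existsP) => [[f /andP[/misomP[fM /isomP[injf imf]] /forallP ft]]|].
  exists (morphm_morphism fM); split=> // i.
  by apply/eqP; apply: ft.
case=> f [injf imf ft]; exists (finfun f); apply/andP; split; last first.
  by apply/forallP => i; rewrite ffunE ft.
apply/misomP.
have fM : morphic (tuple_gen t) (finfun f).
  apply/morphicP => x y Tx Ty; rewrite !ffunE morphM //.
exists fM; apply/isomP; split.
  apply/injmP => x y Tx Ty /=; rewrite /morphm !ffunE; exact: (injmP injf).
transitivity (f @* <<[set x in t]>>); last exact: imf.
rewrite !morphimEdom; apply: eq_imset => x.
by rewrite /= /morphm ffunE.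
Qed.

(** * The isomorphism criterion *)

Section Core.
Variables (d : nat) (gT hT : finGroupType) (N H : {group gT}).
Variables (h : d.-tuple gT) (h' : d.-tuple hT) (Phi : gT * gT -> hT * hT).
Hypotheses (defG : N ><| H = [set: gT]) (cNN : abelian N).
Hypotheses (coHN : coprime #|H| #|N|) (genH : <<[set x in h]>> = H).
Hypothesis Phi_bij : bijective Phi.
Hypothesis PhiE : forall z,
  marked_isog (tup2 h z.1 z.2) (tup2 h' (Phi z).1 (Phi z).2).

Lemma core_isog : [set: gT] \isog [set: hT].
Proof.
have [nsNG sHG NHG nNH tiNH] := sdprod_context defG.
have cardG : (#|N| * #|H| = #|gT|)%N by rewrite (sdprod_card defG) cardsT.
have memT (T : finGroupType) (k : d.-tuple T) x y :
    [/\ x \in <<[set u in tup2 k x y]>>, y \in <<[set u in tup2 k x y]>>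
      & <<[set u in k]>> \subset <<[set u in tup2 k x y]>>].
  split; try by rewrite mem_gen // !inE eqxx ?orbT.
  by apply: genS; apply/subsetP => u; rewrite !inE => ->; rewrite !orbT.
have isoz z : exists f : {morphism <<[set x in tup2 h z.1 z.2]>> >-> hT},
    [/\ 'injm f, f z.1 = (Phi z).1, f z.2 = (Phi z).2
      & forall i, f (tnth h i) = tnth h' i].
  have /marked_isogP[f [injf _ ft]] := PhiE z; exists f; split=> //.
  - by have := ft ord0; rewrite !(tnth_nth 1).
  - by have := ft (lift ord0 ord0); rewrite !(tnth_nth 1).
  move=> i; have := ft (lift ord0 (lift ord0 i)).
  by rewrite !tnth_tup2.
have [f0 [injf0 f01 f02 f0h]] := isoz (1, 1).
have sH0 : H \subset <<[set x in tup2 h 1 1]>> by rewrite -genH; case: (memT _ h 1 1).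
pose alpha := [morphism of restrm sH0 f0].
have injal : 'injm alpha by apply: injm_restrm.
have alh i : alpha (tnth h i) = tnth h' i by apply: f0h.
pose H' := (alpha @* H)%G.
have cardH' : #|H'| = #|H| by apply: card_injm.
(* Every isomorphism [f] obtained from a pair [z] sends [h] to [h'], hence agrees on [H] with the
   one chosen for the pair (1, 1). So all of them induce the same action. *)
have fal z (f : {morphism <<[set x in tup2 h z.1 z.2]>> >-> hT}) :
    (forall i, f (tnth h i) = tnth h' i) -> {in H, f =1 alpha}.
  move=> fh; have sHz : H \subset <<[set x in tup2 h z.1 z.2]>>.
    by rewrite -genH; case: (memT _ h z.1 z.2).
  move=> x Hx; have : x \in <<[set x in h]>> by rewrite genH.
  case/gen_prodgP => m [c ch xE].
  have cH i : c i \in H by rewrite -genH mem_gen.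
  rewrite xE (morph_prod f); last by move=> i _; apply: (subsetP sHz).
  rewrite (morph_prod alpha); last by move=> i _.
  apply: eq_bigr => i _; have := ch i; rewrite inE => /tnthP[j ->].
  by rewrite fh -alh.
set n := #|N|.
(* By coprimality an element whose order divides [n] has trivial image in the quotient by [N], a
   group of order [#|H|]. *)
have memN x : (x \in N) = (x ^+ n == 1).
  apply/idP/eqP => [Nx|xn]; first by rewrite expg_cardG.
  have nNx : x \in 'N(N) by rewrite (subsetP (normal_norm nsNG)) ?inE.
  have cn : #[coset N x] %| n by rewrite order_dvdn -morphX // xn morph1.
  rewrite coset_idr //; apply/eqP; rewrite -order_eq1 -dvdn1 -(eqP coHN) dvdn_gcd.
  rewrite cn andbT.
  have -> : #|H| = #|[set: gT] / N|.
    rewrite card_quotient ?(normal_norm nsNG) // -divgS ?(normal_sub nsNG) //.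
    by rewrite cardsT -cardG mulKn // cardG_gt0.
  by rewrite order_dvdG // mem_quotient ?inE.
have eq1 z (f : {morphism <<[set x in tup2 h z.1 z.2]>> >-> hT}) y : 'injm f ->
    y \in <<[set x in tup2 h z.1 z.2]>> -> (y == 1) = (f y == 1).
  by move=> injf Dy; rewrite morph_injm_eq1.
have ordz z : ((z.1 ^+ n == 1) = ((Phi z).1 ^+ n == 1)) *
              ((z.2 ^+ n == 1) = ((Phi z).2 ^+ n == 1)).
  have [f [injf f1 f2 fh]] := isoz z; have [m1 m2 _] := memT _ h z.1 z.2.
  have E1 : f (z.1 ^+ n) = (Phi z).1 ^+ n by rewrite morphX // f1.
  have E2 : f (z.2 ^+ n) = (Phi z).2 ^+ n by rewrite morphX // f2.
  by split; rewrite -?E1 -?E2; apply: eq1 => //; apply: groupX.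
have [Psi PhiK PsiK] := Phi_bij.
pose N's := [set x' : hT | x' ^+ n == 1].
(* Both free entries are used at once: two elements of [N's] come from a pair in [N], and pairs in
   [N] commute. Only this makes [N's] closed under products. *)
have comN' : {in N's &, forall x' y', commute x' y'}.
  move=> x' y'; rewrite !inE => x'n y'n; set z := Psi (x', y').
  have Pz : Phi z = (x', y') by rewrite PsiK.
  have [f [injf f1 f2 fh]] := isoz z; have [m1 m2 _] := memT _ h z.1 z.2.
  have Nz1 : z.1 \in N by rewrite memN ordz Pz.
  have Nz2 : z.2 \in N by rewrite memN ordz Pz.
  have c12 : commute z.1 z.2 by apply: (centsP cNN).
  have -> : x' = f z.1 by rewrite f1 Pz.
  have -> : y' = f z.2 by rewrite f2 Pz.
  by rewrite /commute -!morphM // c12.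
have gN' : group_set N's.
  apply/group_setP; split=> [|x' y' Nx Ny]; first by rewrite inE expg1n.
  move: (Nx) (Ny); rewrite !inE => /eqP xn /eqP yn.
  by rewrite expgMn ?xn ?yn ?mulg1 //; apply: comN'.
pose N' := Group gN'.
have cNN' : abelian N' by apply/centsP => x' Nx y' Ny; apply: comN'.
(* [Phi] is a bijection between squares and need not be a product map, so the sizes of two sets are
   compared through their squares. *)
have sqr_inj (a b : nat) : (a * a = b * b -> a = b)%N.
  by rewrite !mulnn => /eqP; rewrite eqn_exp2r // => /eqP.
have Phi_card (S : {set gT}) (S' : {set hT}) :
    (forall z, (z.1 \in S = ((Phi z).1 \in S')) * (z.2 \in S = ((Phi z).2 \in S'))) ->
    #|S| = #|S'|.
  move=> SS; apply: sqr_inj; rewrite -!cardsX -(card_imset _ (bij_inj Phi_bij)).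
  apply: eq_card => z'; apply/imsetP/idP => [[z zS ->]|z'S].
    by move: zS; rewrite !inE !SS.
  by exists (Psi z'); rewrite ?PsiK //; move: z'S; rewrite !inE !SS PsiK.
have cardN' : #|N'| = n.
  by apply/esym/Phi_card => z; rewrite !memN !inE -!ordz.
have cardT : #|gT| = #|hT|.
  by have := Phi_card setT setT; rewrite !cardsT; apply=> z; rewrite !inE.
have nN'H' : H' \subset 'N(N').
  apply/subsetP => g _; rewrite inE; apply/subsetP => _ /imsetP[x' Nx' ->].
  by move: Nx'; rewrite !inE -conjXg => /eqP ->; rewrite conj1g.
have tiN'H' : N' :&: H' = 1.
  by apply: coprime_TIg; rewrite cardN' cardH' coprime_sym.
have defK : N' ><| H' = [set: hT].
  rewrite sdprodE //; apply/eqP; rewrite eqEcard subsetT cardsT /=.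
  have -> : #|N' * H'| = #|gT|; last by rewrite cardT.
  by rewrite TI_cardMg // cardH' -cardG; congr (_ * _)%N.
(* [H] itself is the common operator group; through [alpha] the same letters act on [N']. *)
pose rho (a : [subg H]) := sgval a; pose rho' (a : [subg H]) := alpha (sgval a).
have HE : H = rho @: setT :> {set gT}.
  apply/setP => x; apply/idP/imsetP => [Hx|[a _ ->]]; last exact: subgP.
  by exists (subg H x); rewrite ?inE // /rho subgK.
have modN : wmodule rho N H.
  by split=> //; rewrite coprime_sym.
have modN' : wmodule rho' N' H'.
  split=> //; last by rewrite cardN' cardH' coprime_sym.
    by move=> a b; rewrite /rho' -morphM ?subgP.
  apply/setP => y; rewrite /H' /= morphimEdom.
  apply/imsetP/imsetP => [[x Hx ->]|[a _ ->]]; last by exists (sgval a); rewrite ?subgP.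
  by exists (subg H x); rewrite ?inE // /rho' subgK.
have evz z (f : {morphism <<[set x in tup2 h z.1 z.2]>> >-> hT}) w y :
    (forall i, f (tnth h i) = tnth h' i) -> y \in <<[set x in tup2 h z.1 z.2]>> ->
    ev rho w y \in <<[set x in tup2 h z.1 z.2]>> /\ f (ev rho w y) = ev rho' w (f y).
  move=> fh Dy; have sHz : H \subset <<[set x in tup2 h z.1 z.2]>>.
    by rewrite -genH; case: (memT _ h z.1 z.2).
  elim: w => [|a w [IH1 IH2]]; first by rewrite /ev !big_nil group1 morph1.
  have Da : rho a \in <<[set x in tup2 h z.1 z.2]>> by rewrite (subsetP sHz) ?subgP.
  rewrite !ev_cons groupM ?groupJ // morphM ?groupJ // morphJ // IH2; split=> //.
  by rewrite (fal z f fh (rho a) (subgP a)).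
have cntE I : cnt rho N I = cnt rho' N' I.
  have kz z : (killed rho I z.1 = killed rho' I (Phi z).1) *
              (killed rho I z.2 = killed rho' I (Phi z).2).
    have [f [injf f1 f2 fh]] := isoz z; have [m1 m2 _] := memT _ h z.1 z.2.
    split; apply: eq_all => w.
      have [Dw fw] := evz z f w _ fh m1.
      by rewrite -f1 -fw (eq1 z f).
    have [Dw fw] := evz z f w _ fh m2.
    by rewrite -f2 -fw (eq1 z f).
  by apply: Phi_card => z; rewrite !inE !memN -!ordz -!kz.
have [g [injg img gact]] := module_iso modN modN' cntE.
have actf : {in N & H, morph_act 'J 'J g alpha}.
  move=> x a Nx Ha /=; have := gact x (subg H a) Nx.
  by rewrite /rho /rho' subgK.
apply/isogP; exists [morphism of @sdprodm _ _ _ _ [set: gT]%G _ _ defG actf].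
  by rewrite injm_sdprodm injg injal img tiN'H' eqxx.
by rewrite im_sdprodm img; case/sdprodP: defK.
Qed.

End Core.

End CoprimeModules.
Import CoprimeModules.

(** * Weisfeiler--Leman refinement *)

(** A point is sent to the point of the same rank in the fibre of its colour. This is injective,
    hence bijective by equality of the cardinals, so nothing has to be assumed about colours that
    occur in [Y] only. *)
Lemma colour_bij (X Y : finType) (C : eqType) (f : X -> C) (g : Y -> C) :
  #|X| = #|Y| ->
  (forall x, #|[pred x' | f x' == f x]| = #|[pred y | g y == f x]|) ->
  exists phi : X -> Y, bijective phi /\ forall x, g (phi x) = f x.
Proof.
move=> cXY fib.
have [x0|noX] := pickP (fun _ : X => true); last first.
  have X0 : #|X| = 0 by apply: eq_card0 => x; have := noX x.
  have Y0 : #|Y| = 0 by rewrite -cXY.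
  have phi (x : X) : Y by have := noX x.
  exists phi; split=> [|x]; last by have := noX x.
  by exists (fun y : Y => False_rect X (fintype0 y Y0)) => x;
     [have := noX x | have := fintype0 x Y0].
have ix x : index x (enum [pred x' | f x' == f x]) < #|[pred y | g y == f x]|.
  by rewrite -fib cardE index_mem mem_enum inE.
have [y0 _] : exists y : Y, true.
  have : 0 < #|[pred y | g y == f x0]| by apply: leq_ltn_trans (ix x0).
  by case/card_gt0P => y; exists y.
pose phi x := nth y0 (enum [pred y | g y == f x]) (index x (enum [pred x' | f x' == f x])).
have phiE x : g (phi x) = f x.
  have : phi x \in enum [pred y | g y == f x] by rewrite mem_nth // -cardE ix.
  by rewrite mem_enum inE => /eqP.
exists phi; split=> //; apply: inj_card_bij; last by rewrite cXY.
move=> x x' e; have fe : f x = f x' by rewrite -!phiE e.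
move/eqP: e; rewrite /phi fe nth_uniq ?enum_uniq //; last 2 first.
- by rewrite -cardE -fe ix.
- by rewrite -cardE ix.
move/eqP => ie.
have mx : x \in enum [pred x0 | f x0 == f x'] by rewrite mem_enum inE fe.
have mx' : x' \in enum [pred x0 | f x0 == f x'] by rewrite mem_enum inE.
by rewrite -[LHS](nth_index x mx) ie nth_index.
Qed.

Lemma perm_map_bij (X Y : finType) (C : eqType) (f : X -> C) (g : Y -> C) :
  perm_eq [seq f x | x <- enum X] [seq g y | y <- enum Y] ->
  exists phi : X -> Y, bijective phi /\ forall x, g (phi x) = f x.
Proof.
move=> pe; apply: colour_bij; first by rewrite !cardE; have := perm_size pe; rewrite !size_map.
move=> x; have /seq.permP /(_ (pred1 (f x))) := pe; rewrite !count_map => h.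
rewrite !cardE /enum_mem !size_filter.
by rewrite (eq_count (a2 := preim f (pred1 (f x)))) ?h; [apply: eq_count|] => y; rewrite inE.
Qed.

Section Colors.
Variable k : nat.

Lemma marked_isog_refl (gT : finGroupType) (t : k.-tuple gT) : marked_isog t t.
Proof.
apply/marked_isogP; exists [morphism of idm <<[set x in t]>>%g]; split=> //.
- exact: injm_idm.
- exact: morphim_idm.
Qed.

(** A refinement records whole tuples of colours, so one bijection serves all positions [i]. *)
Lemma wl_color_step (gT hT : finGroupType) (C0 : choiceType)
    (c : k.-tuple gT -> C0) (c' : k.-tuple hT -> C0) r t u :
  wl_color c r.+1 t = wl_color c' r.+1 u ->
  wl_color c r t = wl_color c' r u /\
  exists phi : gT -> hT, bijective phi /\ forall x i,
    wl_color c r (subst_tuple t i x) = wl_color c' r (subst_tuple u i (phi x)).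
Proof.
move=> [-> /eq_seq_msetP /perm_map_bij[phi [bphi phiE]]]; split=> //.
exists phi; split=> // x i; have /(congr1 (fun s => tnth s i)) := phiE x.
by rewrite !tnth_mktuple.
Qed.

Lemma wl2_init_isog (gT hT : finGroupType) (t : k.-tuple gT) (u : k.-tuple hT) :
  wl2_init gT hT t = wl2_init gT hT u -> marked_isog t u.
Proof.
case=> _ /setP /(_ u); rewrite !inE => ->; exact: marked_isog_refl.
Qed.

End Colors.

Lemma subst_tup2_0 (T : Type) d (h : d.-tuple T) x y z :
  subst_tuple (tup2 h x y) ord0 z = tup2 h z y.
Proof.
apply: eq_from_tnth => i; rewrite tnth_mktuple; case: (unliftP ord0 i) => [j ->|->].
  by rewrite !(tnth_nth x).
by rewrite !(tnth_nth x).
Qed.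

Lemma subst_tup2_1 (T : Type) d (h : d.-tuple T) x y z :
  subst_tuple (tup2 h x y) (lift ord0 ord0) z = tup2 h x z.
Proof.
apply: eq_from_tnth => i; rewrite tnth_mktuple; case: (unliftP ord0 i) => [j ->|->].
  rewrite (inj_eq lift_inj); case: (unliftP ord0 j) => [l ->|->] /=; last by rewrite !(tnth_nth x).
  by rewrite !tnth_tup2.
by rewrite !(tnth_nth x).
Qed.

Lemma grank_tuple d (gT : finGroupType) (H : {group gT}) : ('m(H) <= d)%g ->
  exists h : d.-tuple gT, <<[set x in h]>>%g = H.
Proof.
move=> le_d; have [B genB cB] := grank_witness H.
exists [tuple nth 1%g (enum B) i | i < d]; apply/eqP; rewrite eqEsubset.
have sz : size (enum B) <= d by rewrite -cardE cB.
apply/andP; split.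
  rewrite gen_subG; apply/subsetP => x; rewrite inE => /mapP[i _ ->].
  have [lt_i|ge_i] := ltnP i (size (enum B)).
    by rewrite -genB mem_gen // -mem_enum mem_nth.
  by rewrite nth_default ?group1.
rewrite -genB gen_subG; apply/subsetP => x Bx; rewrite mem_gen // inE.
have ltx : index x (enum B) < d.
  by apply: leq_trans sz; rewrite index_mem mem_enum.
apply/mapP; exists (Ordinal ltx); rewrite ?mem_enum //=.
by rewrite nth_index // mem_enum.
Qed.

(** Of the three rounds one is the initial coloring and one refinement is spent on each free entry.
    The bijection for the second entry may depend on the first entry; the criterion asks only that
    the combined map on pairs be bijective. *)
Lemma wl2_identifies_sdprod d (gT : finGroupType) :
  coprime_abelian_sdprod d gT -> wl2_identifies d.+2 3 gT.
Proof.
move=> [N [H [defG cNN le_d coHN]]] hT niso eqh; case/negP: niso; move: eqh.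
have [h genH] := grank_tuple le_d.
move/eq_seq_msetP/perm_map_bij => [phi [_ phiE]].
have /esym/wl_color_step[eq1 [phi1 [bphi1 phi1E]]] := phiE (tup2 h 1%g 1%g).
have [eq0 _] := wl_color_step eq1.
set u := phi _ in phi1E eq1 eq0.
(* [u] is marked-isomorphic to a tuple whose first two entries are 1, so its own are 1 as well. *)
have [h' uE] : exists h' : d.-tuple hT, u = tup2 h' 1%g 1%g.
  have /marked_isogP[f [_ _ fu]] := wl2_init_isog eq0.
  exists [tuple tnth u (lift ord0 (lift ord0 i)) | i < d].
  apply: eq_from_tnth => i; case: (unliftP ord0 i) => [j ->|->].
    case: (unliftP ord0 j) => [l ->|->]; first by rewrite tnth_tup2 tnth_mktuple.
    by rewrite -fu !(tnth_nth 1%g) /= morph1.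
  by rewrite -fu !(tnth_nth 1%g) /= morph1.
rewrite uE in phi1E.
have ex2 x : exists phi2 : gT -> hT, bijective phi2 /\ forall y,
    marked_isog (tup2 h x y) (tup2 h' (phi1 x) (phi2 y)).
  have := phi1E x ord0; rewrite !subst_tup2_0 => /wl_color_step[_ [phi2 [b2 phi2E]]].
  exists phi2; split=> // y; apply: wl2_init_isog.
  by have := phi2E y (lift ord0 ord0); rewrite !subst_tup2_1.
have [phi2 phi2E] := fin_all_exists ex2.
have b12 : bijective (fun z : gT * gT => (phi1 z.1, phi2 z.1 z.2)).
  apply: inj_card_bij; last by rewrite !card_prod (bij_eq_card bphi1).
  move=> [x y] [x' y'] /= [/(bij_inj bphi1) <-].
  by move/(bij_inj (phi2E x).1) => <-.
apply: (core_isog defG cNN coHN genH b12) => -[x y] /=.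
exact: (phi2E x).2.
Qed.

(** * Spectral gaps and universal words *)

Module UniversalWords.
Import Order.TTheory GRing.Theory Num.Theory.
Local Open Scope ring_scope.

Section Averages.
Variable I : finType.
Implicit Types F G : I -> rat.

Definition avg F : rat := (\sum_i F i) / #|I|%:R.

Lemma eq_avg F G : F =1 G -> avg F = avg G.
Proof. by move=> FG; rewrite /avg (eq_bigr G). Qed.

Lemma avgD F G : avg (fun i => F i + G i) = avg F + avg G.
Proof. by rewrite /avg big_split mulrDl. Qed.

Lemma avgZ c F : avg (fun i => c * F i) = c * avg F.
Proof. by rewrite /avg -mulr_sumr mulrA. Qed.

Lemma le_avg F G : (forall i, F i <= G i) -> avg F <= avg G.
Proof.
by move=> le_FG; rewrite ler_wpM2r ?invr_ge0 ?ler0n //; apply: ler_sum => i _.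
Qed.

Hypothesis I_gt0 : (0 < #|I|)%N.

Let cI : (#|I|%:R : rat) != 0. Proof. by rewrite pnatr_eq0 -lt0n. Qed.

Lemma avg_const c : avg (fun=> c) = c.
Proof. by rewrite /avg sumr_const -[c *+ _]mulr_natr mulfK. Qed.

Lemma avg_sum F : \sum_i F i = #|I|%:R * avg F.
Proof. by rewrite /avg mulrC divfK. Qed.

Lemma avg_sqr F : avg F ^+ 2 <= avg (fun i => F i ^+ 2).
Proof.
have: 0 <= avg (fun i => (F i - avg F) ^+ 2).
  rewrite -(avg_const 0); apply: le_avg => i; exact: sqr_ge0.
rewrite (@eq_avg _ (fun i => F i ^+ 2 + (- (2 * avg F) * F i + avg F ^+ 2))).
  by rewrite !avgD avgZ avg_const; lra.
by move=> i; ring.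
Qed.

End Averages.

Lemma avg_sum_exchange (I V : finType) (F : I -> V -> rat) :
  \sum_v avg (fun i => F i v) = avg (fun i => \sum_v F i v).
Proof. by rewrite /avg exchange_big /= mulr_suml. Qed.

Lemma avg_exchange (I J : finType) (F : I -> J -> rat) :
  avg (fun i => avg (fun j => F i j)) = avg (fun j => avg (fun i => F i j)).
Proof.
by rewrite /avg -!mulr_suml exchange_big /= mulrAC.
Qed.

Lemma avg_bij (I J : finType) (h : I -> J) (F : J -> rat) :
  bijective h -> avg (fun i => F (h i)) = avg F.
Proof.
move=> bh; rewrite /avg (bij_eq_card bh); congr (_ / _).
by rewrite [RHS](reindex h) //; apply: onW_bij.
Qed.

Lemma avg_prod (I J : finType) (F : I * J -> rat) :
  avg F = avg (fun i => avg (fun j => F (i, j))).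
Proof.
rewrite /avg card_prod natrM invfM -mulr_suml pair_bigA /= mulrA mulrAC.
by congr (_ / _ / _); apply: eq_bigr => -[].
Qed.

Lemma avg_tupleS (D : finType) m (F : m.+1.-tuple D -> rat) :
  avg F = avg (fun e => avg (fun t : m.-tuple D => F [tuple of e :: t])).
Proof.
rewrite -(avg_prod (fun p : D * m.-tuple D => F [tuple of p.1 :: p.2])).
rewrite (@avg_bij _ _ (fun p : D * m.-tuple D => [tuple of p.1 :: p.2]) F) //.
exists (fun t : m.+1.-tuple D => (thead t, [tuple of behead t])).
  by case=> e t; rewrite /= theadE; congr (_, _); apply: val_inj.
by move=> t; apply: val_inj => /=; rewrite [in RHS](tuple_eta t).
Qed.

Section Norm.
Variable V : finType.
Implicit Types f g : V -> rat.

(** The square of the Euclidean norm, so that all quantities remain rational. *)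
Definition nrm f : rat := \sum_v f v ^+ 2.
Definition inn f g : rat := \sum_v f v * g v.

Lemma eq_nrm f g : f =1 g -> nrm f = nrm g.
Proof. by move=> fg; apply: eq_bigr => v _; rewrite fg. Qed.

Lemma nrm_ge0 f : 0 <= nrm f.
Proof. by apply: sumr_ge0 => v _; apply: sqr_ge0. Qed.

Lemma nrm_inn f : nrm f = inn f f.
Proof. by apply: eq_bigr => v _; rewrite expr2. Qed.

(** Stands in for the triangle inequality, which would need square roots. *)
Lemma nrm_convex t f g : 0 <= t <= 1 ->
  nrm (fun v => (1 - t) * f v + t * g v) <= (1 - t) * nrm f + t * nrm g.
Proof.
move=> /andP[t0 t1]; rewrite /nrm !mulr_sumr -big_split /=.
apply: ler_sum => v _; set a := f v; set b := g v.
rewrite -subr_ge0 (_ : _ - _ = (1 - t) * t * (a - b) ^+ 2); last by ring.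
by rewrite mulr_ge0 ?sqr_ge0 // mulr_ge0 ?subr_ge0.
Qed.

Lemma nrm_avg (I : finType) (F : I -> V -> rat) : (0 < #|I|)%N ->
  nrm (fun v => avg (fun i => F i v)) <= avg (fun i => nrm (F i)).
Proof.
move=> I0; rewrite -avg_sum_exchange.
by apply: ler_sum => v _; apply: avg_sqr.
Qed.

Lemma cauchy f g : inn f g ^+ 2 <= nrm f * nrm g.
Proof.
have [g0|g0] := eqVneq (nrm g) 0.
  have gv v : g v = 0.
    have /eqP := g0; rewrite psumr_eq0 => [/allP /(_ v)|u _]; last exact: sqr_ge0.
    by rewrite mem_index_enum sqrf_eq0 => /(_ isT) /eqP.
  rewrite /inn big1 ?expr0n ?mulr_ge0 ?nrm_ge0 // => v _.
  by rewrite gv mulr0.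
have gp : 0 < nrm g by rewrite lt_def g0 nrm_ge0.
have E G c : nrm (fun v => G * f v - c * g v) =
    G ^+ 2 * nrm f - 2 * (G * c) * inn f g + c ^+ 2 * nrm g.
  rewrite /nrm /inn !mulr_sumr -sumrB -big_split /=.
  by apply: eq_bigr => v _; ring.
have := nrm_ge0 (fun v => nrm g * f v - inn f g * g v).
rewrite E (_ : _ + _ = nrm g * (nrm f * nrm g - inn f g ^+ 2)); last by ring.
by rewrite pmulr_rge0 // subr_ge0.
Qed.

End Norm.

Lemma nrm_bij (U V : finType) (h : U -> V) (f : V -> rat) :
  bijective h -> nrm (fun u => f (h u)) = nrm f.
Proof. by move=> bh; rewrite /nrm [RHS](reindex h) //; apply: onW_bij. Qed.

Lemma sum_bij (U V : finType) (h : U -> V) (f : V -> rat) :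
  bijective h -> \sum_u f (h u) = \sum_v f v.
Proof. by move=> bh; rewrite [RHS](reindex h) //; apply: onW_bij. Qed.

(** * Averaging operators of labelled permutations *)

Section Labelled.
Variables (Q V : finType) (step : Q -> V -> V).

Definition op (f : V -> rat) (v : V) : rat := avg (fun l => f (step l v)).

Lemma iter_op_foldl k f z : iter k op f z =
  avg (fun t : k.-tuple Q => f (foldl (fun z l => step l z) z t)).
Proof.
elim: k z => [|k IH] z.
  rewrite (@eq_avg _ _ (fun=> f z)) ?avg_const ?card_tuple //.
  by move=> t; rewrite (tuple0 t).
rewrite avg_tupleS iterS /op; apply: eq_avg => e.
by rewrite IH; apply: eq_avg.
Qed.

Hypothesis Q_gt0 : (0 < #|Q|)%N.
Hypothesis step_bij : forall l, bijective (step l).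

(** Since the operator need not be symmetric, [c] bounds the square of its second singular value,
    not an eigenvalue. *)
Definition gapd (c : rat) :=
  forall f : V -> rat, \sum_v f v = 0 -> nrm (op f) <= c * nrm f.

Lemma op_contract f : nrm (op f) <= nrm f.
Proof.
apply: le_trans (nrm_avg _ Q_gt0) _.
rewrite -[leRHS](avg_const Q_gt0); apply: le_avg => l.
by rewrite nrm_bij.
Qed.

Lemma op_sum f : \sum_v op f v = \sum_v f v.
Proof.
rewrite /op avg_sum_exchange -[RHS](avg_const Q_gt0).
by apply: eq_avg => l; rewrite sum_bij.
Qed.

Lemma gapd_mono c c' : c <= c' -> gapd c -> gapd c'.
Proof.
by move=> le_c gc f f0; apply: le_trans (gc f f0) _; rewrite ler_wpM2r ?nrm_ge0.
Qed.

End Labelled.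

(** * One level of the recursion: labels driven by an expander walk *)

Section OneLevel.
Variables (D Q V : finType) (m : nat) (lab : Q -> m.-tuple D).
Variables (H : D -> Q -> Q) (step : Q -> V -> V) (a ell : rat).
Hypotheses (D_gt0 : (0 < #|D|)%N) (Q_gt0 : (0 < #|Q|)%N).
Hypothesis lab_bij : bijective lab.
Hypothesis H_bij : forall e, bijective (H e).
Hypothesis step_bij : forall l, bijective (step l).
Hypothesis a01 : 0 < a <= 1.
Hypothesis H_gap : gapd H (a ^+ 2).
Hypothesis ell01 : 0 <= ell <= 1.
Hypothesis step_gap : gapd step ell.

(** A state carries a label. The label first moves along the expander, and the new label drives a
    step. A label of the lifted graph is read through [lab] as a word of [m] directions, so the set
    of labels stays [Q] at every level. *)
Definition micro (e : D) (z : Q * V) : Q * V :=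
  (H e z.1, step (H e z.1) z.2).

Definition lift_step (l : Q) (z : Q * V) : Q * V :=
  foldl (fun z e => micro e z) z (lab l).

Lemma micro_bij e : bijective (micro e).
Proof.
have [Hi HK HiK] := H_bij e.
apply: injF_bij => -[q v] [q' v'] /= [/(can_inj HK) <-].
by move/(bij_inj (step_bij _)) => ->.
Qed.

Lemma lift_bij l : bijective (lift_step l).
Proof.
rewrite /lift_step; elim/last_ind: (tval _) => [|s e IH]; first by exists id.
apply: (@eq_bij _ _ (micro e \o fun z => foldl (fun z e => micro e z) z s)).
  exact: bij_comp (micro_bij e) IH.
by move=> z /=; rewrite foldl_rcons.
Qed.

Definition Tm (f : Q * V -> rat) (z : Q * V) : rat := avg (fun e => f (micro e z)).

Lemma op_lift f z : op lift_step f z = iter m Tm f z.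
Proof.
by rewrite (iter_op_foldl micro) -(avg_bij _ lab_bij).
Qed.

Lemma eq_iterT k f g : f =1 g -> iter k Tm f =1 iter k Tm g.
Proof.
by move=> fg; elim: k => //= k IH z; apply: eq_avg => e.
Qed.

Lemma Tm_contract f : nrm (Tm f) <= nrm f.
Proof. by apply: (@op_contract D _ micro) => // e; apply: micro_bij. Qed.

Lemma Tm_lin t f g k z :
  iter k Tm (fun z => (1 - t) * f z + t * g z) z =
  (1 - t) * iter k Tm f z + t * iter k Tm g z.
Proof.
elim: k z => //= k IH z; rewrite {1 2 3}/Tm -!avgZ -avgD.
by apply: eq_avg => e; rewrite IH.
Qed.

Lemma iterT_contract k f : nrm (iter k Tm f) <= nrm f.
Proof. by elim: k => //= k IH; apply: le_trans (Tm_contract _) IH. Qed.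

Definition At (f : Q * V -> rat) (z : Q * V) := f (z.1, step z.1 z.2).
Definition Bt (f : Q * V -> rat) (z : Q * V) := avg (fun e => f (H e z.1, z.2)).
Definition Jt (f : Q * V -> rat) (v : V) := avg (fun q => f (q, v)).
Definition up (h : V -> rat) (z : Q * V) := h z.2.
(** Solves [Bt = (1 - a) J + a Ct] with [J] the full average over labels: a step on the expander is
    a fresh uniform label with weight [1 - a], and otherwise an operator that does not increase the
    norm. *)
Definition Ct (f : Q * V -> rat) (z : Q * V) :=
  a^-1 * (Bt f z - (1 - a) * Jt f z.2).

Lemma nrm_pair (f : Q * V -> rat) :
  nrm f = \sum_v nrm (fun q => f (q, v)).
Proof.
by rewrite /nrm exchange_big pair_bigA; apply: eq_bigr => -[].
Qed.

Lemma At_bij : bijective (fun z : Q * V => (z.1, step z.1 z.2)).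
Proof.
apply: injF_bij => -[q v] [q' v'] /= [<-] /(bij_inj (step_bij q)) -> //.
Qed.

Lemma nrm_At f : nrm (At f) = nrm f.
Proof. exact: (nrm_bij f At_bij). Qed.

Lemma sum_Jt f : \sum_v Jt f v = (\sum_z f z) / #|Q|%:R.
Proof.
rewrite /Jt avg_sum_exchange /avg pair_bigA; congr (_ / _).
by apply: eq_bigr => -[].
Qed.

Lemma nrm_up h : nrm (up h) = #|Q|%:R * nrm h.
Proof.
rewrite nrm_pair mulr_sumr; apply: eq_bigr => v _.
by rewrite /nrm /up /= sumr_const mulr_natl.
Qed.

(** On the labels above a fixed vertex, [f] splits orthogonally into its mean, which [Ct] preserves,
    and a part of sum zero, on which [Ct] is the expander operator divided by [a]; the gap [a ^+ 2]
    compensates the division. *)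
Lemma Ct_contract f : nrm (Ct f) <= nrm f.
Proof.
have [a0 a1] := andP a01.
rewrite !nrm_pair; apply: ler_sum => v _.
pose g q := f (q, v); pose c := avg g; pose g0 q := g q - c.
have sg0 : \sum_q g0 q = 0.
  by rewrite avg_sum // /g0 avgD avg_const // subrr mulr0.
have CE q : Ct f (q, v) = c + a^-1 * op H g0 q.
  rewrite /Ct /Bt /Jt /= -/(avg g) -/c.
  have -> : op H g0 q = avg (fun e => f (H e q, v)) - c.
    by rewrite /op avgD avg_const.
  by field; rewrite gt_eqF.
have split_nrm (h : Q -> rat) : \sum_q h q = 0 ->
    nrm (fun q => c + h q) = #|Q|%:R * c ^+ 2 + nrm h.
  move=> h0; rewrite /nrm.
  rewrite (eq_bigr (fun q => c ^+ 2 + (2 * c * h q + h q ^+ 2))); last by move=> q _; ring.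
  rewrite !big_split /= (_ : \sum_q 2 * c * h q = 0) ?add0r.
    by rewrite sumr_const mulr_natl.
  by rewrite -mulr_sumr h0 mulr0.
rewrite (eq_nrm CE) split_nrm; last first.
  by rewrite -mulr_sumr op_sum // sg0 mulr0.
rewrite (@eq_nrm _ (fun q => f (q, v)) (fun q => c + g0 q)); last first.
  by move=> q; rewrite /g0 addrC subrK.
rewrite split_nrm // lerD2l.
have -> : nrm (fun q => a^-1 * op H g0 q) = a^-1 ^+ 2 * nrm (op H g0).
  by rewrite /nrm mulr_sumr; apply: eq_bigr => q _; rewrite exprMn.
apply: le_trans (ler_wpM2l (sqr_ge0 _) (H_gap sg0)) _.
by rewrite mulrA -exprMn mulVf ?gt_eqF // expr1n mul1r.
Qed.

Lemma TmE f z : Tm f z = (1 - a) * up (Jt (At f)) z + a * Ct (At f) z.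
Proof.
have [a0 _] := andP a01.
by rewrite /Ct mulVKf ?gt_eqF // addrC subrK.
Qed.

Lemma nrm_upJt f : nrm (up (Jt f)) <= nrm f.
Proof.
rewrite nrm_up nrm_pair [leRHS](_ : _ = #|Q|%:R * avg (fun q => nrm (fun v => f (q, v)))).
  by rewrite ler_wpM2l ?ler0n // nrm_avg.
by rewrite -avg_sum // /nrm exchange_big.
Qed.

(** With weight [1 - a] a micro-step draws a fresh label, and a function of the vertex alone turns
    into its image under [op step], losing a factor [ell]; the other part is merely not expanded.
    Fresh labels at all [k] steps have weight [(1 - a) ^+ k], whence the shape of the bound. *)
Lemma iterT_up k h : \sum_v h v = 0 ->
  nrm (iter k Tm (up h)) <=
  (((1 - a) * ell) ^+ k + 1 - (1 - a) ^+ k) * nrm (up h).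
Proof.
have [a0 a1] := andP a01; have [l0 l1] := andP ell01.
elim: k h => [|k IH] h h0; first by rewrite !expr0 addrK mul1r.
rewrite iterSr.
rewrite (@eq_nrm _ _ (fun z => (1 - a) * iter k Tm (up (op step h)) z
   + a * iter k Tm (Ct (At (up h))) z)); last first.
  by move=> z; rewrite -Tm_lin; apply: eq_iterT => z'; rewrite TmE.
apply: le_trans (nrm_convex _ _ _) _; first by rewrite ltW.
have sop : \sum_v op step h v = 0 by rewrite op_sum.
have h1 := IH _ sop.
have h2 : nrm (iter k Tm (Ct (At (up h)))) <= nrm (up h).
  by apply: le_trans (iterT_contract _ _) _; apply: le_trans (Ct_contract _) _; rewrite nrm_At.
have h3 : nrm (up (op step h)) <= ell * nrm (up h).
  by rewrite !nrm_up mulrCA ler_wpM2l ?ler0n // step_gap.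
set N := nrm (up h) in h2 h3 *; have N0 : 0 <= N by apply: nrm_ge0.
set b := (1 - a); have b0 : 0 <= b by rewrite subr_ge0.
have b1 : b <= 1 by rewrite /b; lra.
set P := (b * ell) ^+ k + 1 - b ^+ k in h1.
have bk1 : b ^+ k <= 1 by rewrite exprn_ile1.
have P0 : 0 <= P by rewrite /P -addrA addr_ge0 ?subr_ge0 ?exprn_ge0 ?mulr_ge0.
have h4 : b * nrm (iter k Tm (up (op step h))) <= b * (P * (ell * N)).
  by rewrite ler_wpM2l // (le_trans h1) // ler_wpM2l.
have h5 : a * nrm (iter k Tm (Ct (At (up h)))) <= a * N by rewrite ler_wpM2l // ltW.
apply: le_trans (lerD h4 h5) _.
rewrite [leLHS](_ : _ = (b * P * ell + a) * N); last by ring.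
rewrite ler_wpM2r // !exprS /P.
have : b * (1 - b ^+ k) * ell <= b * (1 - b ^+ k).
  by rewrite ler_piMr // mulr_ge0 // subr_ge0.
have -> : a = 1 - b by rewrite /b; ring.
set X := b ^+ k; set Y := (b * ell) ^+ k.
by move=> hh; lra.
Qed.

(** The first fresh label only removes the dependence on the label; the remaining [m.-1] micro-steps
    contract. *)
Lemma lift_gap : (0 < m)%N -> gapd lift_step
  (1 - (1 - a) ^+ m * (1 - ell ^+ m.-1)).
Proof.
case: (m) op_lift => // k opE _ f f0.
have [a0 a1] := andP a01; have [l0 l1] := andP ell01.
rewrite (eq_nrm (opE f)) iterSr.
rewrite (@eq_nrm _ _ (fun z => (1 - a) * iter k Tm (up (Jt (At f))) z
   + a * iter k Tm (Ct (At f)) z)); last first.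
  by move=> z; rewrite -Tm_lin; apply: eq_iterT => z'; rewrite TmE.
apply: le_trans (nrm_convex _ _ _) _; first by rewrite ltW.
have sJ : \sum_v Jt (At f) v = 0.
  by rewrite sum_Jt (sum_bij f At_bij) f0 mul0r.
have h1 := iterT_up k sJ.
have h2 : nrm (iter k Tm (Ct (At f))) <= nrm f.
  by apply: le_trans (iterT_contract _ _) _; apply: le_trans (Ct_contract _) _; rewrite nrm_At.
have h3 : nrm (up (Jt (At f))) <= nrm f by rewrite -(nrm_At f) nrm_upJt.
set N := nrm f in h2 h3 *; have N0 : 0 <= N by apply: nrm_ge0.
set b := (1 - a); have b0 : 0 <= b by rewrite subr_ge0.
have b1 : b <= 1 by rewrite /b; lra.
rewrite -/b in h1; set P := (b * ell) ^+ k + 1 - b ^+ k in h1.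
have bk1 : b ^+ k <= 1 by rewrite exprn_ile1.
have P0 : 0 <= P by rewrite /P -addrA addr_ge0 ?subr_ge0 ?exprn_ge0 ?mulr_ge0.
have h4 : b * nrm (iter k Tm (up (Jt (At f)))) <= b * (P * N).
  by rewrite ler_wpM2l // (le_trans h1) // ler_wpM2l.
have h5 : a * nrm (iter k Tm (Ct (At f))) <= a * N by rewrite ler_wpM2l // ltW.
apply: le_trans (lerD h4 h5) _.
rewrite [leLHS](_ : _ = (b * P + a) * N); last by ring.
rewrite ler_wpM2r // /P exprS exprMn /=.
have -> : a = 1 - b by rewrite /b; ring.
by rewrite le_eqVlt; apply/orP; left; apply/eqP; ring.
Qed.

End OneLevel.

Lemma bernoulli (x : rat) n : 0 <= x <= 1 -> 1 - n%:R * x <= (1 - x) ^+ n.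
Proof.
move=> /andP[x0 x1]; elim: n => [|n IH]; first by rewrite mul0r subr0 expr0.
rewrite exprSr; have : (1 - n%:R * x) * (1 - x) <= (1 - x) ^+ n * (1 - x).
  by rewrite ler_wpM2r ?subr_ge0.
apply: le_trans; rewrite -natr1.
rewrite -subr_ge0 (_ : _ - _ = n%:R * x ^+ 2); last by ring.
by rewrite mulr_ge0 ?ler0n ?sqr_ge0.
Qed.

(** * A constant-size expander from the moment curve *)

Section Expander.
Variables (p M : nat).
Hypothesis p_pr : prime p.
Notation K := 'F_p.
Notation Q := 'rV[K]_M.

(* The Cayley graph of [K^M] generated by the multiples of the points
   [(1, x, x^2, ...)] of the moment curve, any [M] of which are independent. *)
Definition pvec (x : K) : Q := \row_i x ^+ i.
Definition hop (e : K * K) (q : Q) : Q := q + e.2 *: pvec e.1.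

Lemma hop_bij e : bijective (hop e).
Proof. by exists (fun q => q - e.2 *: pvec e.1) => q; rewrite /hop ?addrK ?subrK. Qed.

Implicit Types (g h : Q -> rat) (x : K) (xs : seq K).

(** The orthogonal projection onto the functions invariant under translation along [pvec x]; the
    operator of [hop] is the average of these projections. *)
Definition proj x g (q : Q) : rat := avg (fun y : K => g (q + y *: pvec x)).
Definition projs xs g : Q -> rat := foldr proj g xs.

Let K_gt0 : (0 < #|K|)%N. Proof. by rewrite card_Fp // prime_gt0. Qed.

Lemma op_hop g : op hop g =1 fun q => avg (fun x => proj x g q).
Proof. by move=> q; rewrite /op avg_prod. Qed.

Lemma add_bij (v : Q) : bijective (fun q => q + v).
Proof. by exists (fun q => q - v) => q; rewrite ?addrK ?subrK. Qed.

Lemma proj_contract x g : nrm (proj x g) <= nrm g.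
Proof.
apply: le_trans (nrm_avg _ K_gt0) _.
rewrite -[leRHS](avg_const K_gt0); apply: le_avg => y.
by rewrite (nrm_bij g (add_bij _)).
Qed.

Lemma proj_sum x g : \sum_q proj x g q = \sum_q g q.
Proof.
rewrite /proj avg_sum_exchange -[RHS](avg_const K_gt0).
by apply: eq_avg => y; rewrite (sum_bij g (add_bij _)).
Qed.

Lemma projs_contract xs g : nrm (projs xs g) <= nrm g.
Proof. by elim: xs => //= x xs IH; apply: le_trans (proj_contract _ _) IH. Qed.

Lemma projs_sum xs g : \sum_q projs xs g q = \sum_q g q.
Proof. by elim: xs => //= x xs IH; rewrite proj_sum. Qed.

Lemma proj_inv x c g q : proj x g (q + c *: pvec x) = proj x g q.
Proof.
have bc : bijective (fun y : K => y + c).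
  by exists (fun y => y - c) => y; rewrite ?addrK ?subrK.
rewrite /proj -[RHS](avg_bij _ bc); apply: eq_avg => y /=.
by rewrite scalerDl addrA addrAC.
Qed.

Lemma proj_pres x g v : (forall q, g (q + v) = g q) ->
  forall q, proj x g (q + v) = proj x g q.
Proof. by move=> gv q; apply: eq_avg => y; rewrite addrAC gv. Qed.

Lemma projs_inv xs g x c q : x \in xs ->
  projs xs g (q + c *: pvec x) = projs xs g q.
Proof.
elim: xs q => //= x' xs IH q; rewrite inE => /predU1P[->|xs_x]; first exact: proj_inv.
by apply: proj_pres => q'; apply: IH.
Qed.

(** By the Vandermonde determinant [M] distinct points of the curve form a basis, so the composite
    is invariant under all translations: it is constant, and its sum is zero. *)
Lemma projs_uniq xs g : size xs = M -> uniq xs -> \sum_q g q = 0 ->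
  projs xs g =1 fun=> 0.
Proof.
move=> sM Uxs g0.
pose a : 'rV[K]_M := \row_i nth 0 xs i.
pose V := (Vandermonde M a)^T.
have Vu : V \in unitmx.
  rewrite unitmx_tr unitmxE det_Vandermonde unitfE prodf_seq_neq0.
  apply/allP => i _ /=; rewrite prodf_seq_neq0; apply/allP => j _.
  apply/implyP => lt_ij; rewrite !mxE subr_eq0 nth_uniq ?sM ?ltn_ord //.
  by rewrite neq_ltn lt_ij orbT.
have inv w q : projs xs g (q + w) = projs xs g q.
  have -> : w = \sum_i (w *m invmx V) 0 i *: row i V.
    by rewrite -mulmx_sum_row mulmxKV.
  elim/big_ind: (\sum_i _) q => [q|u v hu hv q|i _ q]; rewrite ?addr0 //.
    by rewrite addrA hv hu.
  rewrite (_ : row i V = pvec (nth 0 xs i)).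
    by apply: projs_inv; rewrite mem_nth // sM.
  by apply/rowP => j; rewrite !mxE.
have cst q : projs xs g q = projs xs g 0 by rewrite -(add0r q) inv.
move=> q; have := projs_sum xs g; rewrite g0 (eq_bigr _ (fun q _ => cst q)).
rewrite sumr_const => /eqP; rewrite mulrn_eq0 => /orP[|/eqP]; last by rewrite cst.
by rewrite card_mx expn_eq0 => /andP[/eqP e _]; have := K_gt0; rewrite e.
Qed.

Lemma iter_op k g q :
  iter k (op hop) g q = avg (fun xs : k.-tuple K => projs xs g q).
Proof.
elim: k q => [|k IH] q.
  rewrite (@eq_avg _ _ (fun=> g q)) ?avg_const ?card_tuple //.
  by move=> t; rewrite (tuple0 t).
rewrite iterS op_hop avg_tupleS; apply: eq_avg => x /=.
by rewrite /proj avg_exchange; apply: eq_avg => y; rewrite IH.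
Qed.

(** When the [M]-th power is expanded into composites of projections, only words with a repeated
    point survive. By Bernoulli they are at most a fraction [M ^ 2 / p] of all words. *)
Lemma iter_op_nrm g : \sum_q g q = 0 ->
  nrm (iter M (op hop) g) <= (M ^ 2)%:R / p%:R * nrm g.
Proof.
move=> g0; have p0 : 0 < p%:R :> rat by rewrite ltr0n prime_gt0.
have cM : #|{: M.-tuple K}| = (p ^ M)%N by rewrite card_tuple card_Fp.
rewrite (eq_nrm (iter_op M g)); apply: le_trans (nrm_avg _ _) _.
  by rewrite cM expn_gt0 prime_gt0.
have N0 := nrm_ge0 g.
have cU : #|[set t : M.-tuple K | uniq t]| = (p ^_ M)%N.
  rewrite -[p in RHS](card_Fp p_pr) -(card_uniq_tuples M (@predT K)).
  by apply: eq_card => t; rewrite !inE all_predT.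
rewrite /avg (bigID (fun t : M.-tuple K => uniq t)) /= big1 => [|t Ut]; last first.
  rewrite (eq_nrm (projs_uniq _ Ut g0)) ?size_tuple //.
  by rewrite /nrm big1 // => q _; rewrite expr0n.
rewrite add0r cM.
apply: (@le_trans _ _ ((p ^ M - p ^_ M)%:R * nrm g / (p ^ M)%:R)).
  rewrite ler_wpM2r ?invr_ge0 ?ler0n //.
  apply: (@le_trans _ _ (\sum_(t : M.-tuple K | ~~ uniq t) nrm g)).
    by apply: ler_sum => t _; apply: projs_contract.
  rewrite sumr_const -[leLHS]mulr_natl ler_wpM2r // ler_nat.
  have := cardsC [set t : M.-tuple K | uniq t]; rewrite cU cM => <-; rewrite addKn.
  by apply: eq_leq; apply: eq_card => t; rewrite !inE.
have lef : ((p - M) ^ M <= p ^_ M)%N.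
  have : forall k, (k <= M)%N -> ((p - M) ^ k <= p ^_ k)%N.
    elim=> // k IH lek; rewrite expnSr ffactnSr leq_mul ?IH ?leq_sub2l //; exact: ltnW.
  exact.
rewrite mulrAC ler_wpM2r // ler_pdivrMr ?ltr0n ?expn_gt0 ?prime_gt0 //.
have [leM|ltM] := leqP p M.
  apply: (@le_trans _ _ (p ^ M)%:R); first by rewrite ler_nat leq_subr.
  rewrite ler_peMl ?ler0n // ler_pdivlMr // mul1r ler_nat.
  by rewrite (leq_trans leM) // -mulnn leq_pmulr // (leq_trans (prime_gt0 p_pr)).
pose x : rat := M%:R / p%:R.
have x01 : 0 <= x <= 1.
  by rewrite divr_ge0 ?ler0n //= ler_pdivrMr // mul1r ler_nat ltnW.
have bx := bernoulli M x01.
apply: (@le_trans _ _ ((p ^ M)%:R - ((p - M) ^ M)%:R)).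
  rewrite -natrB ?ler_nat ?leq_sub2l //.
  by case: (posnP M) => [->//|M0]; rewrite leq_exp2r // leq_subr.
have -> : ((p - M) ^ M)%:R = (1 - x) ^+ M * (p ^ M)%:R :> rat.
  rewrite !natrX natrB 1?ltnW // -exprMn; congr (_ ^+ _).
  by rewrite /x mulrBl mul1r divfK // gt_eqF.
rewrite -[X in X - _]mul1r -mulrBl ler_wpM2r ?ler0n //.
have -> : (M ^ 2)%:R / p%:R = M%:R * x by rewrite natrX /x expr2 mulrA.
by move: bx; rewrite lerBlDr lerBlDl addrC.
Qed.

Lemma proj_adj x f g : inn (proj x f) g = inn f (proj x g).
Proof.
have NB : bijective (fun y : K => - y) by exists (fun y => - y) => y; rewrite opprK.
have -> : inn (proj x f) g = avg (fun y => \sum_q f (q + y *: pvec x) * g q).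
  rewrite -avg_sum_exchange; apply: eq_bigr => q _.
  by rewrite mulrC -avgZ; apply: eq_avg => y; rewrite mulrC.
have -> : inn f (proj x g) = avg (fun y => \sum_q f q * g (q + y *: pvec x)).
  by rewrite -avg_sum_exchange; apply: eq_bigr => q _; rewrite -avgZ.
rewrite -[RHS](avg_bij _ NB); apply: eq_avg => y /=.
rewrite -[RHS](sum_bij _ (add_bij (y *: pvec x))); apply: eq_bigr => q _ /=.
by rewrite scaleNr addrK.
Qed.

Lemma op_adj f g : inn (op hop f) g = inn f (op hop g).
Proof.
have -> : inn (op hop f) g = avg (fun x => inn (proj x f) g).
  rewrite -avg_sum_exchange; apply: eq_bigr => q _.
  by rewrite op_hop mulrC -avgZ; apply: eq_avg => y; rewrite mulrC.
have -> : inn f (op hop g) = avg (fun x => inn f (proj x g)).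
  rewrite -avg_sum_exchange; apply: eq_bigr => q _.
  by rewrite op_hop -avgZ.
by apply: eq_avg => x; apply: proj_adj.
Qed.

Lemma iter_adj k f g : inn (iter k (op hop) f) g = inn f (iter k (op hop) g).
Proof. by elim: k f g => //= k IH f g; rewrite op_adj IH -iterSr. Qed.

(** Self-adjointness and Cauchy-Schwarz replace diagonalisation: a bound on a high power of the
    operator can be pulled back to a single step by repeated halving. *)
Lemma nrm_doubling k g :
  nrm (iter k (op hop) g) ^+ 2 <= nrm (iter k.*2 (op hop) g) * nrm g.
Proof.
rewrite [X in X ^+ 2]nrm_inn iter_adj -iterD addnn.
have -> : inn g (iter k.*2 (op hop) g) = inn (iter k.*2 (op hop) g) g.
  by apply: eq_bigr => q _; rewrite mulrC.
exact: cauchy.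
Qed.

(** [M] is a power of two so that doubling, started from one step, arrives at [M] exactly. *)
Lemma hop_gap t c : M = (2 ^ t)%N -> 0 <= c -> (M ^ 2)%:R / p%:R <= c ^+ M ->
  gapd hop c.
Proof.
move=> Mt c0 leM f f0; pose a k := nrm (iter k (op hop) f).
have a_ge0 k : 0 <= a k by apply: nrm_ge0.
have key u : a 1%N ^+ (2 ^ u) <= a (2 ^ u)%N * a 0%N ^+ (2 ^ u).-1.
  elim: u => [|u IH]; first by rewrite expr1 mulr1.
  have E : (2 ^ u.+1 = (2 ^ u).*2)%N by rewrite expnS mul2n.
  have pu : (0 < 2 ^ u)%N by rewrite expn_gt0.
  rewrite {1}E -muln2 exprM.
  apply: (@le_trans _ _ ((a (2 ^ u)%N * a 0%N ^+ (2 ^ u).-1) ^+ 2)).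
    by rewrite ler_pXn2r ?nnegrE ?mulr_ge0 ?exprn_ge0.
  rewrite exprMn -exprM E.
  apply: (@le_trans _ _ (a (2 ^ u).*2%N * a 0%N * a 0%N ^+ ((2 ^ u).-1 * 2))).
    by rewrite ler_wpM2r ?exprn_ge0 // nrm_doubling.
  rewrite -mulrA -exprS (_ : ((2 ^ u).-1 * 2).+1 = (2 ^ u).*2.-1) //; lia.
have M0 : (0 < M)%N by rewrite Mt expn_gt0.
have := key t; rewrite -Mt => keyM.
rewrite -(ler_pXn2r M0) ?nnegrE ?mulr_ge0 ?(a_ge0 0%N) ?(a_ge0 1%N) //.
have E : nrm f ^+ M = nrm f * nrm f ^+ M.-1 by rewrite -exprS prednK.
apply: le_trans keyM _; rewrite exprMn E mulrA.
rewrite ler_wpM2r ?exprn_ge0 //; apply: le_trans (iter_op_nrm f0) _.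
by rewrite ler_wpM2r ?(a_ge0 0%N).
Qed.

End Expander.

(** The dimension [2 ^ t.+1] makes the number of labels, [p ^ (2 ^ t.+1)], equal to the number of
    words of length [2 ^ t] over the [p ^ 2] directions. A large prime [p] then makes [a] as small
    as desired and provides more than [r] labels. *)
Lemma expander_exists (t r : nat) (a : rat) : 0 < a ->
  exists (D Q : finType) (lab : Q -> (2 ^ t).-tuple D) (H : D -> Q -> Q),
    [/\ (0 < #|D|)%N, (r < #|Q|)%N, bijective lab,
        forall e, bijective (H e) & gapd H (a ^+ 2)].
Proof.
move=> a0; pose M := (2 ^ t.+1)%N.
pose B : rat := (M ^ 2)%:R / (a ^+ 2) ^+ M.
have B0 : 0 <= B by rewrite divr_ge0 ?ler0n // !exprn_ge0 // ltW.
have [p lt_p p_pr] := prime_above (Num.Def.archi_bound B + r).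
exists ('F_p * 'F_p)%type, 'rV['F_p]_M.
have cQ : #|{: 'rV['F_p]_M}| = #|{: (2 ^ t).-tuple ('F_p * 'F_p)%type}|.
  by rewrite card_mx card_tuple card_prod card_Fp // mul1n mulnn -expnM /M expnS.
exists (fun q => enum_val (cast_ord cQ (enum_rank q))), (@hop p M); split.
- by rewrite card_prod card_Fp // muln_gt0 prime_gt0.
- rewrite card_mx card_Fp // mul1n.
  apply: (@leq_trans p); first by rewrite (leq_ltn_trans _ lt_p) // leq_addl.
  have M0 : (0 < M)%N by rewrite /M expn_gt0.
  by rewrite -[leqLHS]expn1; apply: leq_pexp2l => //; apply: prime_gt0.
- exists (fun l => enum_val (cast_ord (esym cQ) (enum_rank l))) => q.
    by rewrite enum_valK cast_ordK enum_rankK.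
  by rewrite enum_valK cast_ordKV enum_rankK.
- exact: hop_bij.
apply: (@hop_gap p M p_pr t.+1) => //; first exact: sqr_ge0.
have aM : 0 < (a ^+ 2) ^+ M by rewrite !exprn_gt0.
have p0 : 0 < p%:R :> rat by rewrite ltr0n prime_gt0.
rewrite ler_pdivrMr // mulrC -ler_pdivrMr // -/B.
apply: le_trans (ltW (archi_boundP B0)) _; rewrite ler_nat.
by apply: ltnW; apply: leq_ltn_trans lt_p; rewrite leq_addr.
Qed.

Lemma avg_var (I : finType) (F : I -> rat) : (0 < #|I|)%N ->
  avg (fun i => avg (fun j => (F i - F j) ^+ 2)) =
  2 * (avg (fun i => F i ^+ 2) - avg F ^+ 2).
Proof.
move=> I0; rewrite (@eq_avg _ _ (fun i => F i ^+ 2 + (- (2 * avg F) * F i +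
      avg (fun j => F j ^+ 2)))).
  by rewrite !avgD avgZ avg_const //; ring.
move=> i; rewrite (@eq_avg _ _ (fun j => F i ^+ 2 + (- (2 * F i) * F j + F j ^+ 2))).
  by rewrite !avgD (avgZ (- (2 * F i))) avg_const //; ring.
by move=> j; ring.
Qed.

(** * The initial gap of a Cayley graph *)

Section CayleyGap.
Variables (gT : finGroupType) (r : nat) (s : 'I_r.+1 -> gT).
Hypothesis s0 : s ord0 = 1%g.
Hypothesis s_gen : <<[set s i | i : 'I_r.+1]>>%g = [set: gT].
Variables (Q : finType) (base : Q -> 'I_r.+1).
Hypothesis Q_gt0 : (0 < #|Q|)%N.
Hypothesis base_fib : forall i, (#|Q| <= 2 * r.+1 * #|[set l | base l == i]|)%N.

Definition cstep (l : Q) (v : gT) : gT := (v * s (base l))%g.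

Lemma mulg_bij (g : gT) : bijective (fun v : gT => (v * g)%g).
Proof. by exists (fun v => v * g^-1)%g => v; rewrite ?mulgK ?mulgKV. Qed.

Lemma cstep_bij l : bijective (cstep l).
Proof. exact: mulg_bij. Qed.

Definition Delta (f : gT -> rat) (g : gT) : rat :=
  \sum_v (f v - f (v * g)%g) ^+ 2.

Lemma Delta_ge0 f g : 0 <= Delta f g.
Proof. by apply: sumr_ge0 => v _; apply: sqr_ge0. Qed.

(** The triangle inequality for the distance whose square is [Delta]. The weights [1 + 1/k] and
    [1 + k] are those that turn [k ^ 2] into [k.+1 ^ 2] without taking roots. *)
Lemma Delta_mul f g h k d : (0 < k)%N ->
  Delta f g <= k%:R ^+ 2 * d -> Delta f h <= d ->
  Delta f (g * h)%g <= k.+1%:R ^+ 2 * d.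
Proof.
move=> k0 hg hh; pose K : rat := k%:R.
have K0 : 0 < K by rewrite ltr0n.
have : Delta f (g * h)%g <= (1 + K^-1) * Delta f g + (1 + K) * Delta f h.
  have -> : Delta f h = \sum_v (f (v * g)%g - f (v * g * h)%g) ^+ 2.
    exact/esym/(sum_bij (fun v => (f v - f (v * h)%g) ^+ 2) (mulg_bij g)).
  rewrite /Delta !mulr_sumr -big_split /=; apply: ler_sum => v _.
  rewrite mulgA; set x := f v; set y := f (v * g)%g; set z := f _.
  rewrite -subr_ge0 (_ : _ - _ = K^-1 * ((x - y) - K * (y - z)) ^+ 2).
    by rewrite mulr_ge0 ?sqr_ge0 // invr_ge0 ltW.
  by field; rewrite gt_eqF.
move/le_trans; apply.
have h1 : (1 + K^-1) * Delta f g <= (1 + K^-1) * (K ^+ 2 * d).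
  by rewrite ler_wpM2l // addr_ge0 ?invr_ge0 // ltW.
have h2 : (1 + K) * Delta f h <= (1 + K) * d.
  by rewrite ler_wpM2l // addr_ge0 // ltW.
apply: le_trans (lerD h1 h2) _; rewrite -natr1 -/K le_eqVlt; apply/orP; left.
by apply/eqP; field; rewrite gt_eqF.
Qed.

(** The elements that move [f] by at most [k ^ 2 * d] increase with [k]. Where this chain stops
    growing it is closed under the generators, so it is the whole group by stage [#|gT|]. *)
Lemma Delta_bound f d : (forall i, Delta f (s i) <= d) ->
  forall g, Delta f g <= #|gT|%:R ^+ 2 * d.
Proof.
move=> hs; have d0 : 0 <= d by apply: le_trans (hs ord0); apply: Delta_ge0.
pose X k := [set g | Delta f g <= k%:R ^+ 2 * d].
have D1 : Delta f 1 = 0.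
  by apply: big1 => v _; rewrite mulg1 subrr expr0n.
have X1 k : 1%g \in X k by rewrite inE D1 mulr_ge0 ?sqr_ge0.
have Xsub k : X k \subset X k.+1.
  apply/subsetP => g; rewrite !inE => /le_trans; apply.
  by rewrite ler_wpM2r // ler_pXn2r ?nnegrE ?ler0n // ler_nat.
have Xmul k g i : (0 < k)%N -> g \in X k -> (g * s i)%g \in X k.+1.
  by move=> k0; rewrite !inE => hg; apply: Delta_mul.
have closed k : (0 < k)%N -> X k = X k.+1 -> X k = setT.
  move=> k0 eX; apply/setP => g; rewrite [in RHS]inE.
  have : g \in <<[set s i | i : 'I_r.+1]>>%g by rewrite s_gen inE.
  case/gen_prodgP => n [c cs ->].
  elim: n c cs => [|n IH] c cs; first by rewrite big_ord0 X1.
  rewrite big_ord_recr /=.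
  have [i _ ->] := imsetP (cs ord_max).
  by rewrite eX; apply: Xmul => //; apply: IH => j; apply: cs.
have grow k : (0 < k)%N -> X k = setT \/ (k <= #|X k|)%N.
  elim: k => // k IH _; case: (posnP k) => [->|k0].
    by right; apply/card_gt0P; exists 1%g.
  case: (IH k0) => [XT|le_k].
    by left; apply/eqP; rewrite eqEsubset subsetT -XT Xsub.
  case: (eqVneq (X k) (X k.+1)) => [eX|neX].
    by left; rewrite -eX; apply: closed.
  right; apply: leq_ltn_trans le_k _; apply: proper_card.
  by rewrite properEneq neX Xsub.
have n0 : (0 < #|gT|)%N by apply/card_gt0P; exists 1%g.
move=> g; suff : g \in X #|gT| by rewrite inE.
case: (grow _ n0) => [->|hc]; first by rewrite inE.
have /eqP -> : X #|gT| == setT; last by rewrite inE.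
by rewrite eqEcard subsetT cardsT.
Qed.

Lemma Delta_sum f : \sum_v f v = 0 ->
  \sum_g Delta f g = 2 * #|gT|%:R * nrm f.
Proof.
move=> f0; rewrite /Delta exchange_big /=.
rewrite (eq_bigr (fun v => #|gT|%:R * f v ^+ 2 + nrm f)).
  by rewrite big_split /= -mulr_sumr sumr_const -[_ *+ _]mulr_natl /nrm; ring.
move=> v _.
have bv : bijective (fun g : gT => (v * g)%g).
  by exists (fun g => v^-1 * g)%g => g; rewrite ?mulKg ?mulKVg.
rewrite (sum_bij (fun u => (f v - f u) ^+ 2) bv).
rewrite (eq_bigr (fun u => f v ^+ 2 + (- (2 * f v) * f u + f u ^+ 2))); last by move=> u _; ring.
rewrite !big_split /= (_ : \sum_u - (2 * f v) * f u = 0) ?add0r.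
  by rewrite sumr_const mulr_natl.
by rewrite -mulr_sumr f0 mulr0.
Qed.

(** Let [R = r.+1] and [n = #|gT|]. Averaging loses half the mean of the squared distance between
    the translates of [f] by two random labels. Some generator [s i] moves [f] by at least
    [2 nrm f / n ^ 2], and the pairs of labels emitting 1 and [s i] have weight at least
    [1 / (4 R ^ 2)]. Having 1 among the generators is what lets such pairs compare [f] itself with a
    translate. *)
Lemma cayley_gap :
  gapd cstep (1 - (4 * (r.+1 ^ 2 * #|gT| ^ 2)%:R)^-1).
Proof.
move=> f f0; pose n : rat := #|gT|%:R; pose R : rat := r.+1%:R.
have n0 : 0 < n by rewrite ltr0n; apply/card_gt0P; exists 1%g.
have R0 : 0 < R by rewrite ltr0n.
case: (@arg_maxP _ _ 'I_r.+1 ord0 xpredT (fun i => Delta f (s i)) isT) => i _ hmax.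
set d := Delta f (s i) in hmax.
have d_big : 2 * nrm f <= n ^+ 2 * d.
  have : 2 * n * nrm f <= n * (n ^+ 2 * d).
    rewrite -Delta_sum // /n mulr_natl -sumr_const; apply: ler_sum => g _.
    by apply: Delta_bound => j; apply: hmax.
  by rewrite mulrAC mulrC ler_pM2l.
have fibs j : R^-1 / 2 <= #|[set l | base l == j]|%:R / #|Q|%:R :> rat.
  rewrite ler_pdivlMr ?ltr0n // -invfM mulrC ler_pdivrMr ?mulr_gt0 ?ltr0n //.
  have := base_fib j; rewrite -(@ler_nat rat) !natrM => h.
  by apply: le_trans h _; rewrite -/R; lra.
pose DD l l' := \sum_v (f (cstep l v) - f (cstep l' v)) ^+ 2.
have DD0 l l' : 0 <= DD l l' by apply: sumr_ge0 => v _; apply: sqr_ge0.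
have var : avg (fun l => avg (fun l' => DD l l')) = 2 * (nrm f - nrm (op cstep f)).
  have -> : avg (fun l => avg (fun l' => DD l l')) =
    \sum_v avg (fun l => avg (fun l' => (f (cstep l v) - f (cstep l' v)) ^+ 2)).
    rewrite avg_sum_exchange; apply: eq_avg => l; by rewrite avg_sum_exchange.
  have -> : nrm f = \sum_v avg (fun l => f (cstep l v) ^+ 2).
    rewrite avg_sum_exchange -[LHS](avg_const Q_gt0); apply: eq_avg => l.
    by rewrite (sum_bij (fun v => f v ^+ 2) (cstep_bij l)).
  rewrite {1}/nrm -sumrB mulr_sumr; apply: eq_bigr => v _.
  exact: (avg_var (fun l => f (cstep l v)) Q_gt0).
have low : (R^-1 / 2) ^+ 2 * d <= avg (fun l => avg (fun l' => DD l l')).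
  apply: (@le_trans _ _ (avg (fun l => (base l == ord0)%:R *
      avg (fun l' => (base l' == i)%:R * d)))); last first.
    apply: le_avg => l; rewrite -avgZ; apply: le_avg => l'.
    case: eqP => [b0|_]; last by rewrite mul0r.
    case: eqP => [bi|_]; last by rewrite mul0r mulr0.
    rewrite !mul1r /DD /d /Delta le_eqVlt; apply/orP; left; apply/eqP.
    by apply: eq_bigr => v _; rewrite /cstep b0 bi s0 mulg1.
  have sm j : avg (fun l => (base l == j)%:R) = #|[set l | base l == j]|%:R / #|Q|%:R :> rat.
    rewrite /avg; congr (_ / _); rewrite -natr_sum -sum1_card; congr _%:R.
    by rewrite big_mkcond [RHS]big_mkcond; apply: eq_bigr => l _; rewrite inE; case: eqP.
  have -> : avg (fun l => (base l == ord0)%:R * avg (fun l' => (base l' == i)%:R * d)) =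
      (avg (fun l => (base l == ord0)%:R) * avg (fun l => (base l == i)%:R)) * d.
    rewrite (@eq_avg _ (fun l' => (base l' == i)%:R * d) (fun l' => d * (base l' == i)%:R)); last first.
      by move=> l; rewrite mulrC.
    rewrite avgZ.
    rewrite (@eq_avg _ _ (fun l => (d * avg (fun l => (base l == i)%:R)) * (base l == ord0)%:R)).
      by rewrite avgZ; ring.
    by move=> l; rewrite mulrC.
  rewrite ler_wpM2r ?Delta_ge0 // expr2 !sm ler_pM //.
    by rewrite divr_ge0 ?invr_ge0 // ltW.
  by rewrite divr_ge0 ?invr_ge0 // ltW.
rewrite var in low.
have -> : (4 * (r.+1 ^ 2 * #|gT| ^ 2)%:R)^-1 = (4 * (R ^+ 2 * n ^+ 2))^-1 :> rat.
  by rewrite natrM !natrX.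
rewrite mulrBl mul1r lerBrDr -lerBrDl.
have h1 : (R^-1 / 2) ^+ 2 * (2 * nrm f / n ^+ 2) <= (R^-1 / 2) ^+ 2 * d.
  by rewrite ler_wpM2l ?sqr_ge0 // ler_pdivrMr ?exprn_gt0 // (mulrC d).
have := le_trans h1 low.
have E (y z N : rat) : 0 < y -> 0 < z ->
    (y^-1 / 2) ^+ 2 * (2 * N / z ^+ 2) = 2 * ((4 * (y ^+ 2 * z ^+ 2))^-1 * N).
  by move=> y0 z0; field; rewrite !gt_eqF.
rewrite E //.
by rewrite ler_pM2l.
Qed.

End CayleyGap.

(** * The recursive walk and its gap *)

Section Walk.
Variables (D Q : finType) (V : Type) (m : nat) (lab : Q -> m.-tuple D) (H : D -> Q -> Q).
Variables (step : Q -> V -> V) (q0 : Q).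

(* The walk [lstep] below, on a stack of labels, outermost level first. *)
Fixpoint walk (k : nat) (l : Q) (z : seq Q * V) : seq Q * V :=
  if k is k'.+1 then
    foldl (fun z e =>
      let q := H e (head q0 z.1) in
      let z' := walk k' q (behead z.1, z.2) in (q :: z'.1, z'.2)) z (lab l)
  else (z.1, step l z.2).

End Walk.

Section Levels.
Variables (D Q V : finType) (m : nat) (lab : Q -> m.-tuple D) (H : D -> Q -> Q).
Variables (step : Q -> V -> V) (q0 : Q).

(** The states with the depth of the stack fixed by the type, hence a finite set over which to
    average; [walk] is the same walk on sequences, which is what a machine stores. *)
Fixpoint lvl (k : nat) : finType :=
  if k is k'.+1 then (Q * lvl k')%type else V.

Fixpoint lstep (k : nat) : Q -> lvl k -> lvl k :=
  match k with
  | 0 => step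
  | k'.+1 => lift_step lab H (@lstep k')
  end.

Fixpoint stack (k : nat) : lvl k -> seq Q :=
  match k with
  | 0 => fun=> [::]
  | k'.+1 => fun z => z.1 :: stack z.2
  end.

Fixpoint vtx (k : nat) : lvl k -> V :=
  match k with
  | 0 => id
  | k'.+1 => fun z => vtx z.2
  end.

Lemma walk_lstep k l (z : lvl k) :
  walk lab H step q0 k l (stack z, vtx z) = (stack (lstep l z), vtx (lstep l z)).
Proof.
elim: k l z => [|k IH] l z //=; rewrite /lift_step.
elim: (tval (lab l)) z => [|e t IHt] z //=.
by rewrite IH -IHt.
Qed.

Lemma size_stack k (z : lvl k) : size (stack z) = k.
Proof. by elim: k z => //= k IH z; rewrite IH. Qed.

Lemma sum_vtx k (F : V -> rat) :
  \sum_(z : lvl k) F (vtx z) = #|Q|%:R ^+ k * \sum_v F v.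
Proof.
elim: k => [|k IH] /=; first by rewrite mul1r.
rewrite exprS -mulrA -IH mulr_natl -sumr_const pair_bigA.
by apply: eq_bigr => -[].
Qed.

End Levels.

(** An elementary substitute for bounding [(1 - b) ^+ k] by an exponential. *)
Lemma one_add_pow (b : rat) k : 0 <= b <= 1 ->
  (1 - b) ^+ k * (1 + k%:R * b) <= 1.
Proof.
move=> /andP[b0 b1].
have h : 1 + k%:R * b <= (1 + b) ^+ k.
  elim: k => [|k IH]; first by rewrite mul0r addr0 expr0.
  rewrite exprS; apply: le_trans (ler_wpM2l _ IH); last by rewrite addr_ge0.
  rewrite -natr1 -subr_ge0 (_ : _ - _ = k%:R * b ^+ 2); last by ring.
  by rewrite mulr_ge0 ?sqr_ge0 ?ler0n.
apply: le_trans (ler_wpM2l _ h) _; first by rewrite exprn_ge0 // subr_ge0.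
rewrite -exprMn exprn_ile1 ?mulr_ge0 ?subr_ge0 ?addr_ge0 //.
rewrite (_ : (1 - b) * (1 + b) = 1 - b ^+ 2); last by ring.
by rewrite lerBlDr lerDl sqr_ge0.
Qed.

(** Let [y = k b], so that [1 - (1 - b) ^+ k >= y / (1 + y)]. For [y >= 14] this is at least
    [14/15], and [15/16] of it is [7/8]; for smaller [y] it is at least [y / 15], and [15/16] of it
    is [y / 16 >= kap * b]. *)
Lemma amplify (c e A b kap : rat) k : 16 * c = 15 -> 8 * e = 7 -> c <= A ->
  0 <= b <= 1 -> 16 * kap <= k%:R ->
  Num.min e (kap * b) <= A * (1 - (1 - b) ^+ k).
Proof.
move=> cE eE cA b01 kapk; have [b_ge0 b1] := andP b01.
have := one_add_pow k b01; set y := k%:R * b; set P := (1 - b) ^+ k => pow.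
have P0 : 0 <= P by apply: exprn_ge0; rewrite subr_ge0.
have P1 : P <= 1 by apply: exprn_ile1; [rewrite subr_ge0 | rewrite lerBlDr lerDl].
have k1 : 16 * kap * b <= y by apply: ler_wpM2r.
have main : c * (1 - P) <= A * (1 - P) by apply: ler_wpM2r; rewrite ?subr_ge0.
apply: le_trans main; rewrite ge_min; apply/orP.
have [y14|y14] := leP 14 y.
  left; have : P * 15 <= P * (1 + y) by apply: ler_wpM2l => //; move: y14; clear; lra.
  by move: pow cE eE; clear; move=> *; nra.
right; have : (1 - P) * (1 + y) <= (1 - P) * 15.
  by apply: ler_wpM2l; [rewrite subr_ge0 | move: y14; clear; lra].
by move: pow cE k1; clear; move=> *; nra.
Qed.

Lemma seven_eighths (e : rat) : 8 * e = 7 -> [/\ 0 <= e, e <= 1 & 1 - e <= 8^-1].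
Proof. by move=> eE; split; lra. Qed.

Section Cover.
Variables (D Q V : finType) (m : nat) (lab : Q -> m.-tuple D) (H : D -> Q -> Q).
Variables (step : Q -> V -> V) (q0 : Q) (a b0 kap c e : rat).
Hypotheses (D_gt0 : (0 < #|D|)%N) (Q_gt0 : (0 < #|Q|)%N).
Hypothesis lab_bij : bijective lab.
Hypothesis H_bij : forall e, bijective (H e).
Hypothesis step_bij : forall l, bijective (step l).
Hypothesis a01 : 0 < a <= 1.
Hypothesis H_gap : gapd H (a ^+ 2).
Hypotheses (cE : 16 * c = 15) (eE : 8 * e = 7).
Hypothesis a_m : c <= (1 - a) ^+ m.
Hypothesis m_gt0 : (0 < m)%N.
Hypothesis kap_m : 16 * kap <= m.-1%:R.
Hypothesis kap_ge : 1 <= kap.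
Hypothesis b01 : 0 <= b0 <= 1.
Hypothesis step_gap : gapd step (1 - b0).

Notation lst k := (@lstep D Q V m lab H step k).

Lemma lstep_bij k l : bijective (lst k l).
Proof. by elim: k l => [|k IH] l; [apply: step_bij | apply: lift_bij]. Qed.

Lemma lvl_gap k : gapd (lst k) (1 - Num.min e (kap ^+ k * b0)).
Proof.
have [b_ge0 b_le1] := andP b01.
have k0 : 0 <= kap by apply: le_trans kap_ge.
have [e0 e1 _] := seven_eighths eE.
elim: k => [|k IH].
  apply: gapd_mono step_gap; rewrite expr0 mul1r lerD2l lerN2 ge_min lexx.
  by rewrite orbT.
set b := Num.min _ _ in IH.
have b_0 : 0 <= b by rewrite le_min e0 mulr_ge0 ?exprn_ge0.
have b_1 : b <= e by rewrite ge_min lexx.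
have b_2 : b <= 1 by apply: le_trans b_1 e1.
have l01 : 0 <= 1 - b <= 1 by rewrite subr_ge0 b_2 lerBlDr lerDl.
have G := lift_gap D_gt0 Q_gt0 lab_bij H_bij (@lstep_bij k) a01 H_gap l01 IH m_gt0.
apply: gapd_mono G; rewrite lerD2l lerN2.
have bb : 0 <= b <= 1 by rewrite b_0 b_2.
apply: le_trans (amplify cE eE a_m bb kap_m).
rewrite le_min; apply/andP; split; first by rewrite ge_min lexx.
have [h|h] := leP e (kap ^+ k * b0).
  rewrite /b (min_l h) ge_min; apply/orP; left.
  exact: ler_peMl.
by rewrite /b (min_r (ltW h)) ge_min exprS mulrA lexx orbT.
Qed.

(** Let [f] be the indicator of [v1] minus its mean [1/n], lifted to level [W]. If no stack above
    [v0] led to [v1], the [W]-fold average of [f] would be [-1/n] at all [#|Q| ^ W] states above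
    [v0], giving squared norm at least [#|Q| ^ W / n ^ 2]. The gap [7/8] bounds it by
    [#|Q| ^ W / 8 ^ W], which is smaller since [n ^ 2 <= 4 ^ W]. *)
Lemma cover W (v0 v1 : V) : (#|V| <= 2 ^ W)%N -> (0 < W)%N -> 1 <= kap ^+ W * b0 ->
  exists (qs ls : seq Q), [/\ size qs = W, size ls = W &
    (foldl (fun z l => walk lab H step q0 W l z) (qs, v0) ls).2 = v1].
Proof.
move=> Vle W0 gapW; set n : rat := #|V|%:R.
have n0 : 0 < n by rewrite ltr0n; apply/card_gt0P; exists v0.
have G : gapd (lst W) (8%:R^-1).
  apply: gapd_mono (@lvl_gap W).
  have [_ e1 e8] := seven_eighths eE.
  by rewrite min_l // (le_trans e1).
pose F (u : V) : rat := (u == v1)%:R - n^-1.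
pose f (z : lvl Q V W) := F (vtx z).
have sumI : \sum_(u : V) ((u == v1)%:R : rat) = 1.
  by rewrite (bigD1 v1) //= eqxx big1 ?addr0 // => u /negbTE ->.
have F0 : \sum_u F u = 0.
  by rewrite sumrB sumI sumr_const -[_ *+ _]mulr_natl mulfV ?subrr ?gt_eqF.
have f0 : \sum_z f z = 0 by rewrite /f sum_vtx F0 mulr0.
have iterG k : \sum_z iter k (op (lst W)) f z = 0 /\
    nrm (iter k (op (lst W)) f) <= 8%:R^-1 ^+ k * nrm f.
  elim: k => [|k [s1 h1]]; first by rewrite mul1r.
  rewrite iterS; split; first by rewrite op_sum //; apply: lstep_bij.
  by apply: le_trans (G _ s1) _; rewrite exprS -mulrA ler_wpM2l.
have nf : nrm f <= #|Q|%:R ^+ W.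
  rewrite /nrm (sum_vtx Q W (fun u => F u ^+ 2)).
  rewrite -[leRHS]mulr1 ler_wpM2l ?exprn_ge0 ?ler0n //.
  rewrite (eq_bigr (fun u => (1 - 2 * n^-1) * (u == v1)%:R + n^-1 ^+ 2)); last first.
    by move=> u _; rewrite /F; case: eqP => _ /=; ring.
  rewrite big_split /= -mulr_sumr sumI mulr1 sumr_const.
  rewrite (_ : n^-1 ^+ 2 *+ _ = n * n^-1 ^+ 2); last by rewrite -[LHS]mulr_natl.
  have E (y : rat) : 0 < y -> 1 - 2 * y^-1 + y * y^-1 ^+ 2 = 1 - y^-1.
    by move=> y0; field; rewrite gt_eqF.
  rewrite E //.
  by rewrite lerBlDr lerDl invr_ge0 ltW.
case: (altP (@existsP _ (fun zt : lvl Q V W * W.-tuple Q =>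
   (vtx zt.1 == v0) && (vtx (foldl (fun z l => lst W l z) zt.1 zt.2) == v1)))).
  case=> -[z t] /= /andP[/eqP zv /eqP tv].
  exists (stack z), t; rewrite size_stack size_tuple; split=> //.
  rewrite -zv -tv; elim: (tval t) z {zv tv} => //= l ls IH z.
  by rewrite walk_lstep IH.
move=> /existsPn noz; exfalso.
have val z : vtx z == v0 ->
    iter W (op (lst W)) f z = - n^-1.
  move=> zv; rewrite iter_op_foldl (@eq_avg _ _ (fun=> - n^-1)).
    by rewrite avg_const // card_tuple expn_gt0 Q_gt0.
  move=> t; rewrite /f /F; have := noz (z, t); rewrite /= zv /=.
  by move/negbTE ->; rewrite sub0r.
have [_ hi] := iterG W.
have lo : #|Q|%:R ^+ W * n^-1 ^+ 2 <= nrm (iter W (op (lst W)) f).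
  have -> : #|Q|%:R ^+ W * n^-1 ^+ 2 =
      \sum_(z : lvl Q V W) (vtx z == v0)%:R * n^-1 ^+ 2 :> rat.
    rewrite (sum_vtx Q W (fun u => (u == v0)%:R * n^-1 ^+ 2)); congr (_ * _).
    by rewrite (bigD1 v0) //= eqxx mul1r big1 ?addr0 // => u /negbTE ->; rewrite mul0r.
  apply: ler_sum => z _; case: (boolP (vtx z == v0)) => [/val ->|_].
    by rewrite mul1r sqrrN.
  by rewrite mul0r sqr_ge0.
have q0' : 0 < #|Q|%:R ^+ W :> rat by rewrite exprn_gt0 // ltr0n.
have e0 : 0 <= 8%:R^-1 ^+ W :> rat by rewrite exprn_ge0.
have := le_trans lo (le_trans hi (ler_wpM2l e0 nf)).
rewrite mulrC ler_pM2r // !exprVn.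
rewrite lef_pV2 ?posrE ?exprn_gt0 //.
apply/negP; rewrite -ltNge.
apply: (@le_lt_trans _ _ ((2 ^ W)%:R ^+ 2)).
  by rewrite ler_pXn2r ?nnegrE ?ler0n // ler_nat.
rewrite natrX -exprM mulnC exprM ltr_pXn2r ?nnegrE //; lra.
Qed.

End Cover.

Lemma fifteen_sixteenths : exists c : rat, 16 * c = 15 /\ c <= 1 - 16^-1.
Proof. by exists (1 - 16^-1); split; lra. Qed.

Lemma seven_eighths_ex : exists e : rat, 8 * e = 7.
Proof. by exists (7 / 8); lra. Qed.

Lemma inv16_le1 (x : rat) : 1 <= x ->
  0 < (16 * x)^-1 <= 1 /\ 1 - x * (16 * x)^-1 = 1 - 16^-1.
Proof.
move=> x1; have x0 : 0 < x by lra.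
have x16 : 1 <= 16 * x by lra.
split; last by field; rewrite gt_eqF.
by rewrite invr_gt0 invf_le1 ?(lt_le_trans _ x16) // x16 (lt_le_trans _ x16).
Qed.

Lemma inv4_le1 (x : rat) : 1 <= x -> 0 <= (4 * x)^-1 <= 1.
Proof.
move=> x1; have x4 : 1 <= 4 * x by lra.
by rewrite invr_ge0 invf_le1 ?(lt_le_trans _ x4) // x4 (le_trans _ x4).
Qed.

(** Labels are dealt out cyclically. Rounding down loses less than half of the exact share, since
    every generator receives at least one label. *)
Lemma balanced_labels (Q : finType) r : (r < #|Q|)%N ->
  exists base : Q -> 'I_r.+1,
    forall i, (#|Q| <= 2 * r.+1 * #|[set l | base l == i]|)%N.
Proof.
move=> Qbig; pose base (q : Q) : 'I_r.+1 := inord (enum_rank q %% r.+1).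
exists base => i.
have := divn_eq #|Q| r.+1; set k := (#|Q| %/ r.+1)%N => QE.
have k0 : (0 < k)%N by rewrite divn_gt0.
suff : (k <= #|[set l | base l == i]|)%N.
  have := ltn_pmod #|Q| (ltn0Sn r); move: QE k0; clear.
  set c := #|[set _ | _]|; set rr := (_ %% _)%N => -> k0 lt_r le_k.
  apply: (@leq_trans (2 * r.+1 * k)); last by rewrite leq_mul2l le_k orbT.
  by nia.
have lt_k (j : 'I_k) : (j * r.+1 + i < #|Q|)%N.
  have := ltn_ord i; have := ltn_ord j; rewrite QE; clear.
  by move: (#|Q| %% r.+1)%N => rr; nia.
rewrite -[k]card_ord -(card_imset predT (f := fun j : 'I_k => enum_val (Ordinal (lt_k j)))).
  apply: subset_leq_card; apply/subsetP => _ /imsetP[j _ ->].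
  rewrite inE /base enum_valK /= modnMDl modn_small //.
  by apply/eqP/val_inj; rewrite /= inordK.
move=> j j' /enum_val_inj /(congr1 val) /= /addIn /eqP.
by rewrite eqn_pmul2r // => /eqP /val_inj.
Qed.

(** The order of the quantifiers matters: alphabet, expander and labelling depend on [r] alone, so a
    machine can have them built in, and only [W] grows with the group. *)
Theorem universal_words (r : nat) :
  exists (m : nat) (D Q : finType) (lab : Q -> m.-tuple D) (H : D -> Q -> Q)
         (q0 : Q) (base : Q -> 'I_r.+1),
    (0 < m)%N /\
    forall (gT : finGroupType) (s : 'I_r.+1 -> gT) (W : nat) (v : gT),
      s ord0 = 1%g -> <<[set s i | i : 'I_r.+1]>>%g = [set: gT] ->
      (0 < W)%N -> (#|gT| <= 2 ^ W)%N ->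
      exists qs ls : seq Q, [/\ size qs = W, size ls = W &
        (foldl (fun z l => walk lab H (cstep s base) q0 W l z) (qs, 1%g) ls).2 = v].
Proof.
have [R RE] : exists R, R = r.+1 by exists r.+1.
(* The factor per level is to be [16 * R ^ 2], and [amplify] asks for at least 16 times that many
   contracting micro-steps, one of the [2 ^ t] being lost. *)
have [t m_gt] : exists t, ((16 * (16 * R ^ 2)).+1 < 2 ^ t)%N.
  by exists (16 * (16 * R ^ 2)).+1; rewrite ltn_expl.
have m0 : (0 < 2 ^ t)%N by rewrite expn_gt0.
have : exists m, m = (2 ^ t)%N by exists (2 ^ t)%N.
case=> m mE; rewrite -mE in m_gt m0.
have m1 : 1 <= m%:R :> rat by rewrite ler1n.
(* This value of [a] makes [(1 - a) ^+ m >= 15/16] by Bernoulli. *)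
have [a01 aE] := inv16_le1 m1; set a := (16 * m%:R)^-1 in a01 aE.
have [a0 a1] := andP a01.
have [D [Q [lab [H [D0 Qbig lab_bij H_bij Hgap]]]]] := expander_exists t r a0.
move: lab lab_bij; rewrite -mE => lab lab_bij.
have Q0 : (0 < #|Q|)%N by apply: leq_ltn_trans Qbig.
have [q0 _] := card_gt0P Q0.
have [base base_fib] := balanced_labels Qbig.
exists m, D, Q, lab, H, q0, base; split; first exact: m0.
move=> gT s W v s0 s_gen W0 gTle.
have [c [cE c16]] := fifteen_sixteenths; have [e eE] := seven_eighths_ex.
pose n := #|gT|; have n0 : (0 < n)%N by apply/card_gt0P; exists 1%g.
pose b0 : rat := (4 * (R ^ 2 * n ^ 2)%:R)^-1.
have RnP : (0 < R ^ 2 * n ^ 2)%N by rewrite muln_gt0 !expn_gt0 n0 RE.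
have b0P : 0 <= b0 <= 1.
  by apply: inv4_le1; rewrite ler1n.
have ca : c <= (1 - a) ^+ m.
  apply: le_trans c16 _; rewrite -aE; apply: bernoulli; by rewrite ltW.
have km : 16 * (16 * R ^ 2)%:R <= m.-1%:R :> rat.
  by rewrite -natrM ler_nat; move: m_gt; clear; lia.
have k1 : 1 <= (16 * R ^ 2)%:R :> rat by rewrite ler1n muln_gt0 expn_gt0 RE.
have gap0 : gapd (cstep s base) (1 - b0) by rewrite /b0 RE; exact: cayley_gap.
apply: (cover q0 D0 Q0 lab_bij H_bij (cstep_bij s base) a01 Hgap cE eE ca m0 km
          k1 b0P gap0 _ _ gTle W0).
(* It remains to see that [(16 R^2)^W >= 4 R^2 4^W >= 4 R^2 n^2]; the first inequality uses
   [W > 0]. *)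
have b4 : 0 < 4 * (R ^ 2 * n ^ 2)%:R :> rat.
  by apply: mulr_gt0; [apply: ltr0Sn | rewrite ltr0n].
rewrite /b0 (ler_pdivlMr _ _ b4) mul1r -natrX -natrM ler_nat.
have R1 : (0 < R ^ 2)%N by rewrite expn_gt0 RE.
rewrite -/n in gTle; move: gTle W0 R1; clear.
move: n => k le_k; case: W le_k => // w le_k _ R1.
have h : (k ^ 2 <= 4 ^ w.+1)%N.
  by rewrite (_ : 4 = 2 ^ 2)%N // -expnM mulnC expnM leq_exp2r.
apply: (@leq_trans (4 * (R ^ 2 * 4 ^ w.+1))%N); first by rewrite !leq_mul2l h !orbT.
rewrite (_ : 16 * R ^ 2 = (4 * R ^ 2) * 4)%N; last by ring.
rewrite expnMn mulnA leq_mul2r; apply/orP; right.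
by rewrite [leqRHS]expnS leq_pmulr // expn_gt0 muln_gt0 R1.
Qed.

End UniversalWords.
Import UniversalWords.

(** * Sweep machines in logarithmic space *)

Section Scans.
Variables (S T : Type).
Implicit Types (f : S -> T -> S * T) (s : S) (u : seq T).

Fixpoint scanf f s u : S * seq T :=
  if u is a :: u' then
    ((scanf f (f s a).1 u').1, (f s a).2 :: (scanf f (f s a).1 u').2)
  else (s, [::]).

Fixpoint scanb f s u : S * seq T :=
  if u is a :: u' then
    ((f (scanb f s u').1 a).1, (f (scanb f s u').1 a).2 :: (scanb f s u').2)
  else (s, [::]).

Lemma size_scanf f s u : size (scanf f s u).2 = size u.
Proof. by elim: u s => //= a u IH s; rewrite IH. Qed.

Lemma size_scanb f s u : size (scanb f s u).2 = size u.
Proof. by elim: u => //= a u ->. Qed.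

Lemma scanf_keep (g : S -> T -> T) s u :
  scanf (fun s a => (s, g s a)) s u = (s, map (g s) u).
Proof. by elim: u => //= a u ->. Qed.

Lemma scanb_keep (g : S -> T -> T) s u :
  scanb (fun s a => (s, g s a)) s u = (s, map (g s) u).
Proof. by elim: u => //= a u ->. Qed.

End Scans.

Section SweepMachines.
Variable A : finType.

(** In one round the finite control sweeps forward over all cells with [sm_fw], back with [sm_bw],
    and then [sm_ct] reads one input letter, moves the input head and chooses the next state, [None]
    meaning that the machine has halted. *)
Record smach (T : finType) := SMach {
  sm_st : finType;
  sm_start : sm_st;
  sm_fw : sm_st -> T -> sm_st * T;
  sm_bw : sm_st -> T -> sm_st * T;
  sm_ct : sm_st -> input_symbol A -> option sm_st * move
}.

Definition sm_conf T (M : smach T) := (option (sm_st M) * seq T * nat)%type.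

Definition sm_step T (M : smach T) (x : seq A) (c : sm_conf M) : sm_conf M :=
  if c.1.1 is Some s then
    let r1 := scanf (@sm_fw _ M) s c.1.2 in
    let r2 := scanb (@sm_bw _ M) r1.1 r1.2 in
    let k := sm_ct r2.1 (input_at x c.2) in
    (k.1, r2.2, minn (shift_head k.2 c.2) (size x).+1)
  else c.

Definition sm_reach T (M : smach T) x (c c' : sm_conf M) :=
  exists n, iter n (sm_step x) c = c'.

Lemma sm_reach_trans T (M : smach T) x (c2 c1 c3 : sm_conf M) :
  sm_reach x c1 c2 -> sm_reach x c2 c3 -> sm_reach x c1 c3.
Proof. by move=> [n <-] [m <-]; exists (m + n); rewrite iterD. Qed.

Lemma sm_reach1 T (M : smach T) x (c c' : sm_conf M) :
  sm_step x c = c' -> sm_reach x c c'.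
Proof. by move=> <-; exists 1. Qed.

Lemma sm_reach_size T (M : smach T) x (c c' : sm_conf M) :
  sm_reach x c c' -> size c'.1.2 = size c.1.2.
Proof.
move=> [n <-]; elim: n => //= n <-; case: (iter _ _ _) => [[[s|] u] p] //=.
by rewrite /sm_step /= size_scanb size_scanf.
Qed.

Section Embed.
Variables (T T' R : finType) (M : smach T) (M' : smach T').
Variables (i : sm_st M' -> sm_st M) (ex : option (sm_st M)).
Variables (get : T -> T') (rest : T -> R).
Hypothesis fwE : forall s t,
  [/\ (sm_fw (i s) t).1 = i (sm_fw s (get t)).1,
      get (sm_fw (i s) t).2 = (sm_fw s (get t)).2
    & rest (sm_fw (i s) t).2 = rest t].
Hypothesis bwE : forall s t,
  [/\ (sm_bw (i s) t).1 = i (sm_bw s (get t)).1,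
      get (sm_bw (i s) t).2 = (sm_bw s (get t)).2
    & rest (sm_bw (i s) t).2 = rest t].
Hypothesis ctE : forall s a,
  sm_ct (i s) a = (if (sm_ct s a).1 is Some s' then Some (i s') else ex,
                   (sm_ct s a).2).

Lemma embed_scanf s w :
  [/\ (scanf (@sm_fw _ M) (i s) w).1 = i (scanf (@sm_fw _ M') s (map get w)).1,
      map get (scanf (@sm_fw _ M) (i s) w).2
        = (scanf (@sm_fw _ M') s (map get w)).2
    & map rest (scanf (@sm_fw _ M) (i s) w).2 = map rest w].
Proof.
elim: w s => [|t w IH] s //=; have [-> -> ->] := fwE s t.
by have [-> -> ->] := IH (sm_fw s (get t)).1.
Qed.

Lemma embed_scanb s w :
  [/\ (scanb (@sm_bw _ M) (i s) w).1 = i (scanb (@sm_bw _ M') s (map get w)).1,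
      map get (scanb (@sm_bw _ M) (i s) w).2
        = (scanb (@sm_bw _ M') s (map get w)).2
    & map rest (scanb (@sm_bw _ M) (i s) w).2 = map rest w].
Proof.
elim: w => [|t w IH] //=; have [-> -> ->] := IH.
by have [-> -> ->] := bwE (scanb (@sm_bw _ M') s (map get w)).1 t.
Qed.

(** The common simulation argument for running [M'] as a subroutine of [M]: it works on the part
    [get] of each cell, leaves the part [rest] alone, and returns control in [ex]. *)
Lemma sm_embed x s w p u' p' :
  sm_reach x (Some s, map get w, p) (None, u', p') ->
  exists w', [/\ sm_reach x (Some (i s), w, p) (ex, w', p'),
                 map get w' = u' & map rest w' = map rest w].
Proof.
case=> n; elim: n s w p => // n IH s w p; rewrite iterSr {2}/sm_step /=.
have [f1 f2 f3] := embed_scanf s w.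
set w1 := (scanf (@sm_fw _ M) (i s) w).2 in f2 f3.
set s1 := (scanf (@sm_fw _ M') s (map get w)).1 in f1.
have [b1 b2 b3] := embed_scanb s1 w1.
set k' := sm_ct (i (scanb (@sm_bw _ M') s1 (map get w1)).1) (input_at x p).
have step1 : sm_step x (Some (i s), w, p) =
  (k'.1, (scanb (@sm_bw _ M) (i s1) w1).2, minn (shift_head k'.2 p) (size x).+1).
  by rewrite /sm_step /= f1 b1.
rewrite -f2 -b2; move: step1; rewrite {}/k' ctE /=.
case: (sm_ct _ _) => [[s'|] m] /= step1 run.
  have [w' [r1 r2 r3]] := IH _ _ _ run.
  exists w'; split=> //; last by rewrite r3 b3 f3.
  by apply: sm_reach_trans r1; apply: sm_reach1.
have hN : forall k (c : sm_conf M'), c.1.1 = None -> iter k (sm_step x) c = c.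
  by move=> k c cN; elim: k => //= k ->; rewrite /sm_step cN.
move: run; rewrite hN // => -[<- <-].
by exists (scanb (@sm_bw _ M) (i s1) w1).2; split; [apply: sm_reach1|..]; rewrite ?b3.
Qed.

End Embed.

(** The number of cells, which is the length of [size x] in binary. *)
Definition W (x : seq A) := (trunc_log 2 (size x)).+1.

Arguments W : simpl never.

(* [hf] asserts that the computation leaves the input head where it was. *)
Definition LI (hf : bool) (T : finType) (F : seq A -> seq T -> seq T) : Prop :=
  exists (E : finType) (e0 : E) (M : smach (T * E)%type),
    forall x w p, size w = W x -> p <= (size x).+1 ->
    exists w' p',
      [/\ sm_reach x (Some (sm_start M), w, p) (None, w', p'),
          unzip1 w' = F x (unzip1 w), p' <= (size x).+1 & hf -> p' = p].

Lemma LI_size hf T F x u : @LI hf T F -> size u = W x -> size (F x u) = W x.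
Proof.
move=> [E [e0 [M H]]] su.
have [|w' [p' [r e _ _]]] := H x [seq (a, e0) | a <- u] 0 _ isT.
  by rewrite size_map.
have := sm_reach_size r; rewrite /= size_map su => <-.
rewrite -[u in F x u](_ : unzip1 [seq (a, e0) | a <- u] = u) -?e ?size_map //.
by rewrite /unzip1 -map_comp map_id.
Qed.

Lemma LI_ext hf (T : finType) (F G : seq A -> seq T -> seq T) :
  (forall x u, size u = W x -> F x u = G x u) -> LI hf F -> LI hf G.
Proof.
move=> FG [E [e0 [M H]]]; exists E, e0, M => x w p sw lep.
have [w' [p' [r1 r2 r3]]] := H x w p sw lep; exists w', p'; split=> //.
by rewrite r2 FG // size_map.
Qed.

Lemma LI_weak (T : finType) (F : seq A -> seq T -> seq T) hf :
  LI true F -> LI hf F.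
Proof.
move=> [E [e0 [M H]]]; exists E, e0, M => x w p sw lep.
have [w' [p' [r1 r2 r3 r4]]] := H x w p sw lep; exists w', p'; split=> // _.
exact: r4.
Qed.

Section LIscan.
Variables (T S : finType) (f g : S -> T -> S * T) (s : S).

Definition roundtrip (u : seq T) : seq T :=
  (scanb g (scanf f s u).1 (scanf f s u).2).2.

Definition scan_mach : smach (T * unit)%type :=
  @SMach _ S s (fun s a => ((f s a.1).1, ((f s a.1).2, tt)))
    (fun s a => ((g s a.1).1, ((g s a.1).2, tt))) (fun _ _ => (None, Stay)).

Lemma LI_scan : LI true (fun _ u => roundtrip u).
Proof.
exists unit, tt, scan_mach => x w p _ lep.
exists (scanb (@sm_bw _ scan_mach) (scanf (@sm_fw _ scan_mach) s w).1
              (scanf (@sm_fw _ scan_mach) s w).2).2, p.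
split=> //; first by apply: sm_reach1; rewrite /sm_step /= (minn_idPl lep).
have Ef t w1 : (scanf (@sm_fw _ scan_mach) t w1).1 = (scanf f t (unzip1 w1)).1 /\
    unzip1 (scanf (@sm_fw _ scan_mach) t w1).2 = (scanf f t (unzip1 w1)).2.
  by elim: w1 t => //= a w1 IH t; have [-> ->] := IH (f t a.1).1.
have Eb t w1 : (scanb (@sm_bw _ scan_mach) t w1).1 = (scanb g t (unzip1 w1)).1 /\
    unzip1 (scanb (@sm_bw _ scan_mach) t w1).2 = (scanb g t (unzip1 w1)).2.
  by elim: w1 => //= a w1 [-> ->].
by rewrite (Eb _ _).2 (Ef _ _).1 (Ef _ _).2.
Qed.

End LIscan.

Lemma LI_scanf (T S : finType) (f : S -> T -> S * T) s :
  LI true (fun _ u => (scanf f s u).2).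
Proof.
apply: LI_ext (LI_scan f (fun s a => (s, a)) s) => x u _.
by rewrite /roundtrip (scanb_keep (fun _ a => a)) map_id.
Qed.

Lemma LI_scanb (T S : finType) (f : S -> T -> S * T) s :
  LI true (fun _ u => (scanb f s u).2).
Proof.
apply: LI_ext (LI_scan (fun s a => (s, a)) f s) => x u _.
by rewrite /roundtrip (scanf_keep (fun _ a => a)) map_id.
Qed.

Section LIcomp.
Variables (T E1 E2 : finType) (M1 : smach (T * E1)%type) (M2 : smach (T * E2)%type).
Let TT := (T * (E1 * E2))%type.
Let get1 (t : TT) := (t.1, t.2.1).
Let get2 (t : TT) := (t.1, t.2.2).
Let put1 (t : TT) (a : T * E1) : TT := (a.1, (a.2, t.2.2)).
Let put2 (t : TT) (a : T * E2) : TT := (a.1, (t.2.1, a.2)).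

Definition comp_mach : smach TT :=
  @SMach _ (sm_st M1 + sm_st M2)%type (inl (sm_start M1))
    (fun s t => match s with
      | inl s => (inl (sm_fw s (get1 t)).1, put1 t (sm_fw s (get1 t)).2)
      | inr s => (inr (sm_fw s (get2 t)).1, put2 t (sm_fw s (get2 t)).2) end)
    (fun s t => match s with
      | inl s => (inl (sm_bw s (get1 t)).1, put1 t (sm_bw s (get1 t)).2)
      | inr s => (inr (sm_bw s (get2 t)).1, put2 t (sm_bw s (get2 t)).2) end)
    (fun s a => match s with
      | inl s => (if (sm_ct s a).1 is Some s' then Some (inl s')
                  else Some (inr (sm_start M2)), (sm_ct s a).2)
      | inr s => (if (sm_ct s a).1 is Some s' then Some (inr s')
                  else None, (sm_ct s a).2) end).

Lemma comp_reach x w p u1 p1 :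
  sm_reach x (Some (sm_start M1), map get1 w, p) (None, u1, p1) ->
  exists w1, sm_reach (M := comp_mach) x (Some (inl (sm_start M1)), w, p)
      (Some (inr (sm_start M2)), w1, p1) /\ map get1 w1 = u1.
Proof.
move=> r.
have [|||w1 [? ? _]] := @sm_embed TT _ E2 comp_mach M1 inl
  (Some (inr (sm_start M2))) get1 (fun t => t.2.2) _ _ _ x _ w p u1 p1 r.
- by move=> s [a [e1 e2]]; split=> //=; rewrite /get1 /=; case: (sm_fw _ _).2.
- by move=> s [a [e1 e2]]; split=> //=; rewrite /get1 /=; case: (sm_bw _ _).2.
- by move=> s a.
- by exists w1.
Qed.

Lemma comp_reach2 x w p u1 p1 :
  sm_reach x (Some (sm_start M2), map get2 w, p) (None, u1, p1) ->
  exists w1, sm_reach (M := comp_mach) x (Some (inr (sm_start M2)), w, p)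
      (None, w1, p1) /\ map get2 w1 = u1.
Proof.
move=> r.
have [|||w1 [? ? _]] := @sm_embed TT _ E1 comp_mach M2 inr
  None get2 (fun t => t.2.1) _ _ _ x _ w p u1 p1 r.
- by move=> s [a [e1 e2]]; split=> //=; rewrite /get2 /=; case: (sm_fw _ _).2.
- by move=> s [a [e1 e2]]; split=> //=; rewrite /get2 /=; case: (sm_bw _ _).2.
- by move=> s a.
- by exists w1.
Qed.

End LIcomp.

Lemma unzip1_map (X Y Z : Type) (f : X -> Y * Z) s :
  unzip1 (map f s) = map (fun a => (f a).1) s.
Proof. by rewrite /unzip1 -map_comp. Qed.

Lemma LI_comp hf (T : finType) (F G : seq A -> seq T -> seq T) :
  LI hf F -> LI hf G -> LI hf (fun x u => G x (F x u)).
Proof.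
move=> [E1 [e1 [M1 H1]]] [E2 [e2 [M2 H2]]].
exists (E1 * E2)%type, (e1, e2), (comp_mach M1 M2) => x w p sw lep.
have [|u1 [p1 [r1 q1 l1 h1]]] := H1 x [seq (t.1, t.2.1) | t <- w] p _ lep.
  by rewrite size_map.
have [w1 [R1 g1]] := comp_reach M2 r1.
have sw1 : size w1 = W x by rewrite (sm_reach_size R1).
have [|u2 [p2 [r2 q2 l2 h2]]] := H2 x [seq (t.1, t.2.2) | t <- w1] p1 _ l1.
  by rewrite size_map.
have [w2 [R2 g2]] := comp_reach2 M1 r2.
exists w2, p2; split=> //; first exact: sm_reach_trans R1 R2; last first.
  by move=> hh; rewrite h2 // h1.
move: q2; rewrite -g2 !unzip1_map /= /unzip1 => ->; congr (G x _).
by move: q1; rewrite -g1 !unzip1_map.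
Qed.

Section LIcall.
Variables (T T' E : finType) (get : T -> T') (put : T -> T' -> T).
Variable M : smach (T' * E)%type.
Let TT := (T * (T' * E))%type.

Definition call_mach : smach TT :=
  @SMach _ (bool + sm_st M)%type (inl false)
    (fun s t => match s with
      | inl b => (inl b, if b then (put t.1 t.2.1, t.2)
                         else (t.1, (get t.1, t.2.2)))
      | inr s => (inr (sm_fw s t.2).1, (t.1, (sm_fw s t.2).2)) end)
    (fun s t => match s with
      | inl b => (inl b, t)
      | inr s => (inr (sm_bw s t.2).1, (t.1, (sm_bw s t.2).2)) end)
    (fun s a => match s with
      | inl b => (if b then None else Some (inr (sm_start M)), Stay)
      | inr s => (if (sm_ct s a).1 is Some s' then Some (inr s')
                  else Some (inl true), (sm_ct s a).2) end).

Lemma call_inl x b w p : p <= (size x).+1 ->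
  sm_step (M := call_mach) x (Some (inl b), w, p) =
  (if b then None else Some (inr (sm_start M)),
   [seq if b then (put t.1 t.2.1, t.2) else (t.1, (get t.1, t.2.2)) | t <- w], p).
Proof.
move=> lep; rewrite /sm_step /=.
have -> v : scanf (@sm_fw _ call_mach) (inl b) v = (inl b,
  [seq if b then (put t.1 t.2.1, t.2) else (t.1, (get t.1, t.2.2)) | t <- v]).
  by elim: v => //= a v ->.
have -> v : scanb (@sm_bw _ call_mach) (inl b) v = (inl b, v).
  by elim: v => //= a v ->.
by rewrite /= (minn_idPl lep).
Qed.

Lemma call_reach x w p u1 p1 :
  sm_reach x (Some (sm_start M), unzip2 w, p) (None, u1, p1) ->
  exists w1, [/\ sm_reach (M := call_mach) x (Some (inr (sm_start M)), w, p)
      (Some (inl true), w1, p1), unzip2 w1 = u1 & unzip1 w1 = unzip1 w].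
Proof.
by move=> r; apply: (@sm_embed TT _ T call_mach M inr _ snd fst _ _ _ x).
Qed.

End LIcall.

(** Procedure calls: each cell gets a local variable, loaded by [get] and written back by [put]. *)
Lemma LI_call hf (T T' : finType) (get : T -> T') (put : T -> T' -> T) F :
  LI hf F ->
  LI hf (fun x u => [seq put a.1 a.2 | a <- zip u (F x (map get u))]).
Proof.
move=> HF; have sF := LI_size HF; case: HF => [E [e0 [M H]]].
(* The initial value of the local variable is made from an element of [T]. If there is none, there
   is no tape either, because the number of cells is positive. *)
have [e|noT] := pickP T; last first.
  exists unit, tt, (@SMach _ unit tt (fun _ t => (tt, t)) (fun _ t => (tt, t))
    (fun _ _ => (None, Stay))) => x [|[a w] //] p //.
  by move/(_ a): noT.
exists (T' * E)%type, (get e, e0), (call_mach get put M) => x w p sw lep.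
set w0 := [seq (t.1, (get t.1, t.2.2)) | t <- w].
have [|u1 [p1 [r1 q1 l1 h1]]] := H x (unzip2 w0) p _ lep.
  by rewrite !size_map.
have [w1 [R1 g1 g2]] := call_reach get put r1.
exists [seq (put t.1 t.2.1, t.2) | t <- w1], p1; split=> //.
  apply: (@sm_reach_trans _ (call_mach get put M) x
           (Some (inr (sm_start M)), w0, p)).
    by apply: sm_reach1; rewrite call_inl.
  by apply: sm_reach_trans R1 _; apply: sm_reach1; rewrite call_inl.
rewrite unzip1_map /=.
have -> : unzip1 w = unzip1 w1.
  by rewrite g2 unzip1_map.
have -> : [seq get i | i <- unzip1 w1] = unzip1 (unzip2 w0).
  by rewrite g2 /w0 /unzip2 !unzip1_map -!map_comp.
rewrite -q1 -g1; elim: (w1) => //= [[a [b c]] v] IH /=; by rewrite IH.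
Qed.

End SweepMachines.

Arguments W : simpl never.

(** * Digit strings as counters *)

Section Digits.
Variable b : nat.

(** The least significant digit comes first, so that the carry of an increment travels with the
    forward sweep. *)
Fixpoint digs (n k : nat) : seq 'I_b.+1 :=
  if n is n'.+1 then inord (k %% b.+1) :: digs n' (k %/ b.+1) else [::].

Definition incf (c : bool) (a : 'I_b.+1) : bool * 'I_b.+1 :=
  (c && (a == ord_max),
   if c then if a == ord_max then ord0 else inord a.+1 else a).

Lemma size_digs n k : size (digs n k) = n.
Proof. by elim: n k => //= n IH k; rewrite IH. Qed.

Lemma scanf_inc0 u : scanf incf false u = (false, u).
Proof. by elim: u => //= a u ->. Qed.

Lemma scanf_inc n k :
  scanf incf true (digs n k) = (k.+1 %% b.+1 ^ n == 0, digs n k.+1).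
Proof.
elim: n k => [|n IH] k /=; first by rewrite modn1.
have lt_b : k %% b.+1 < b.+1 by rewrite ltn_mod.
rewrite -(inj_eq val_inj) /= inordK //.
have [kb|kb] := eqVneq (k %% b.+1) b.
  have kE : k.+1 = (k %/ b.+1).+1 * b.+1 by rewrite {1}(divn_eq k b.+1) kb mulSn; lia.
  rewrite IH /= kE modnMl mulnK // expnSr -muln_modl muln_eq0 orbF.
  by congr (_, _ :: _); apply/val_inj; rewrite /= inordK.
rewrite scanf_inc0 /=.
have lt2 : (k %% b.+1).+1 < b.+1 by lia.
have kE : k.+1 = k %/ b.+1 * b.+1 + (k %% b.+1).+1.
  by rewrite {1}(divn_eq k b.+1) addnS.
have -> : k.+1 %% b.+1 = (k %% b.+1).+1 by rewrite kE modnMDl modn_small.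
have -> : k.+1 %/ b.+1 = k %/ b.+1.
  by rewrite kE divnMDl // (divn_small lt2) addn0.
congr (_, _); apply/esym/negbTE/negP => /eqP k0.
have : b.+1 %| k.+1.
  apply: (@dvdn_trans (b.+1 ^ n.+1)); first by rewrite expnS dvdn_mulr.
  exact/eqP.
by rewrite kE /dvdn modnMDl modn_small.
Qed.

Lemma digs_inj n k l : k < b.+1 ^ n -> l < b.+1 ^ n ->
  digs n k = digs n l -> k = l.
Proof.
elim: n k l => [|n IH] k l /=; first by rewrite expn0; lia.
rewrite !expnS => lk ll [] /(congr1 val) /=.
rewrite !inordK ?ltn_mod // => e1 /IH e2.
by rewrite (divn_eq k b.+1) (divn_eq l b.+1) e1 e2 // ltn_divLR // mulnC.
Qed.

Lemma digs_surj n (u : seq 'I_b.+1) : size u = n ->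
  exists2 k, k < b.+1 ^ n & u = digs n k.
Proof.
elim: n u => [|n IH] [|a u] //=; first by exists 0; rewrite ?expn0.
case=> /IH[k lk ->]; exists (k * b.+1 + a).
  by have := ltn_ord a; rewrite expnS; nia.
rewrite modnMDl modn_small // divnMDl // divn_small // addn0.
by congr (_ :: _); apply/val_inj; rewrite /= inordK.
Qed.

Lemma digs0 n : digs n 0 = nseq n ord0.
Proof.
elim: n => //= n IH; rewrite div0n mod0n IH; congr (_ :: _).
by apply/val_inj; rewrite /= inordK.
Qed.

End Digits.

Arguments digs : simpl never.

(** * Loops over all strings and over the input *)

Section LIfold.
Variable A : finType.

Section FoldStr.
Variables (b : nat) (T E : finType).
Notation G := 'I_b.+1.
Variable M : smach A ((T * G) * E)%type.
Let TT := (T * (G * E * G))%type.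
Let get (t : TT) : (T * G) * E := ((t.1, t.2.1.1), t.2.1.2).
Let put (t : TT) (a : (T * G) * E) : TT := (a.1.1, ((a.1.2, a.2), t.2.2)).

Definition fs_mach : smach A TT :=
  @SMach _ _ (option bool + sm_st M)%type (inl None)
    (fun s t => match s with
      | inl None => (inl None, (t.1, ((ord0, t.2.1.2), ord0)))
      | inl (Some c) => (inl (Some (incf c t.2.2).1),
           (t.1, (((incf c t.2.2).2, t.2.1.2), (incf c t.2.2).2)))
      | inr s => (inr (sm_fw s (get t)).1, put t (sm_fw s (get t)).2) end)
    (fun s t => match s with
      | inl o => (inl o, t)
      | inr s => (inr (sm_bw s (get t)).1, put t (sm_bw s (get t)).2) end)
    (fun s a => match s with
      | inl o => (if o == Some true then None else Some (inr (sm_start M)), Stay)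
      | inr s => (if (sm_ct s a).1 is Some s' then Some (inr s')
                  else Some (inl (Some true)), (sm_ct s a).2) end).

Lemma fs_bw o w : scanb (@sm_bw _ _ fs_mach) (inl o) w = (inl o, w).
Proof. by elim: w => //= a w ->. Qed.

Lemma fs_init x w p : p <= (size x).+1 ->
  exists w', [/\ sm_reach (M := fs_mach) x (Some (inl None), w, p)
                  (Some (inr (sm_start M)), w', p),
     unzip1 w' = unzip1 w, [seq t.2.1.1 | t <- w'] = digs b (size w) 0
   & [seq t.2.2 | t <- w'] = digs b (size w) 0].
Proof.
move=> lep; exists [seq (t.1, ((ord0, t.2.1.2), ord0)) | t <- w]; split.
- apply: sm_reach1; rewrite /sm_step /=.
  have -> v : scanf (@sm_fw _ _ fs_mach) (inl None) v
     = (inl None, [seq (t.1, ((ord0, t.2.1.2), ord0)) | t <- v]).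
    by elim: v => //= a v ->.
  by rewrite fs_bw /= (minn_idPl lep).
- by rewrite /unzip1 -map_comp.
- by rewrite -map_comp digs0; elim: w => //= a w ->.
- by rewrite -map_comp digs0; elim: w => //= a w ->.
Qed.

Lemma fs_inc x w p k : p <= (size x).+1 ->
  [seq t.2.2 | t <- w] = digs b (size w) k ->
  exists w', [/\ sm_reach (M := fs_mach) x (Some (inl (Some true)), w, p)
   (if k.+1 %% b.+1 ^ size w == 0 then None else Some (inr (sm_start M)), w', p),
     unzip1 w' = unzip1 w, [seq t.2.1.1 | t <- w'] = digs b (size w) k.+1
   & [seq t.2.2 | t <- w'] = digs b (size w) k.+1].
Proof.
move=> lep wk.
have sf c v : [/\ (scanf (@sm_fw _ _ fs_mach) (inl (Some c)) v).1 =
       inl (Some (scanf (@incf b) c [seq t.2.2 | t <- v]).1),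
    unzip1 (scanf (@sm_fw _ _ fs_mach) (inl (Some c)) v).2 = unzip1 v,
    [seq t.2.1.1 | t <- (scanf (@sm_fw _ _ fs_mach) (inl (Some c)) v).2]
      = (scanf (@incf b) c [seq t.2.2 | t <- v]).2
  & [seq t.2.2 | t <- (scanf (@sm_fw _ _ fs_mach) (inl (Some c)) v).2]
      = (scanf (@incf b) c [seq t.2.2 | t <- v]).2].
  by elim: v c => //= a v IH c; have [-> -> -> ->] := IH (incf c a.2.2).1.
have [f1 f2 f3 f4] := sf true w.
exists (scanf (@sm_fw _ _ fs_mach) (inl (Some true)) w).2.
move: f1 f3 f4; rewrite wk scanf_inc /= => f1 f3 f4; split=> //.
apply: sm_reach1; rewrite /sm_step /= f1 fs_bw /= (minn_idPl lep).
by case: (_ == 0).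
Qed.

Lemma fs_body x w p u1 p1 :
  sm_reach x (Some (sm_start M), map get w, p) (None, u1, p1) ->
  exists w1, [/\ sm_reach (M := fs_mach) x (Some (inr (sm_start M)), w, p)
      (Some (inl (Some true)), w1, p1), map get w1 = u1
     & [seq t.2.2 | t <- w1] = [seq t.2.2 | t <- w]].
Proof.
move=> r; apply: (@sm_embed A TT _ G fs_mach M inr _ get (fun t => t.2.2) _ _ _ x)=> //.
- by move=> s [a [[g e] g']]; split=> //=; rewrite /get /=; case: (sm_fw _ _).2 => [[]].
- by move=> s [a [[g e] g']]; split=> //=; rewrite /get /=; case: (sm_bw _ _).2 => [[]].
Qed.

End FoldStr.

(** The counter is kept twice in every cell: one copy is handed to the body, which may overwrite it,
    and the private one is incremented. A carry out of the last cell ends the loop. *)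
Lemma LI_foldstr hf b (T : finType) (F : seq A -> seq (T * 'I_b.+1) -> _) :
  LI hf F ->
  LI hf (fun x u => foldl (fun v k => unzip1 (F x (zip v (digs b (W x) k)))) u
                          (iota 0 (b.+1 ^ W x))).
Proof.
case=> [E [e0 [M H]]]; exists ('I_b.+1 * E * 'I_b.+1)%type, (ord0, e0, ord0).
exists (fs_mach M) => x w p sw lep.
have loop : forall r k w p, size w = W x -> p <= (size x).+1 ->
  k + r = b.+1 ^ W x -> 0 < r ->
  [seq t.2.1.1 | t <- w] = digs b (W x) k -> [seq t.2.2 | t <- w] = digs b (W x) k ->
  exists w' p', [/\ sm_reach (M := fs_mach M) x (Some (inr (sm_start M)), w, p)
         (None, w', p'),
    unzip1 w' = foldl (fun v k => unzip1 (F x (zip v (digs b (W x) k))))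
                 (unzip1 w) (iota k r), p' <= (size x).+1 & hf -> p' = p].
  elim=> // r IH k {sw lep}w {}p sw lep kr _ v1 v2.
  have [|u1 [p1 [r1 q1 l1 h1]]] :=
    H x [seq ((t.1, t.2.1.1), t.2.1.2) | t <- w] p _ lep; first by rewrite size_map.
  have [w1 [R1 g1 g2]] := fs_body r1.
  have sw1 : size w1 = W x by rewrite (sm_reach_size R1).
  have [|w2 [R2 a1 a2 a3]] := @fs_inc _ _ _ M x w1 p1 k l1; first by rewrite g2 v2 sw1.
  rewrite sw1 in R2 a2 a3.
  have sw2 : size w2 = W x by rewrite (sm_reach_size R2).
  have e1 : unzip1 w2 = unzip1 (F x (zip (unzip1 w) (digs b (W x) k))).
    rewrite a1; move: q1; rewrite -g1 -v1.
    have -> : unzip1 [seq (t.1, t.2.1.1, t.2.1.2) | t <- w] =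
       zip (unzip1 w) [seq t.2.1.1 | t <- w].
      by elim: (w) => //= a v' ->.
    by move=> <-; rewrite /unzip1 -!map_comp.
  case: r => [|r] in IH kr *.
    move: R2; rewrite -(addn1 k) kr modnn eqxx => R2.
    exists w2, p1; split=> //; exact: sm_reach_trans R1 R2.
  have kk : k.+1 %% b.+1 ^ W x == 0 = false.
    by apply/negbTE; rewrite modn_small //; lia.
  rewrite kk in R2.
  have krS : k.+1 + r.+1 = b.+1 ^ W x by lia.
  have [w' [p' [R3 e3 l3 h3]]] := IH k.+1 w2 p1 sw2 l1 krS isT a2 a3.
  exists w', p'; split=> //; last by move=> hh; rewrite h3 // h1.
    exact: sm_reach_trans R1 (sm_reach_trans R2 R3).
  by rewrite e3 e1.
have [w0 [R0 a0 b0 c0]] := fs_init M w lep.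
rewrite sw in b0 c0; have sw0 : size w0 = W x by rewrite (sm_reach_size R0).
have gt0 : 0 < b.+1 ^ W x by rewrite expn_gt0.
have [w' [p' [R1 e1 l1 h1]]] := loop _ 0 w0 p sw0 lep erefl gt0 b0 c0.
exists w', p'; split=> //; last by rewrite e1 a0.
exact: sm_reach_trans R0 R1.
Qed.

Section FoldIn.
Variables (T E : finType) (M : smach A ((T * A) * E)%type).
Let TT := (T * (A * E))%type.
Let get (t : TT) : (T * A) * E := ((t.1, t.2.1), t.2.2).
Let put (a : (T * A) * E) : TT := (a.1.1, (a.1.2, a.2)).

Definition fi_mach : smach A TT :=
  @SMach _ _ (option (option A) + sm_st M)%type (inl None)
    (fun s t => match s with
      | inl (Some (Some a)) => (inl (Some (Some a)), (t.1, (a, t.2.2)))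
      | inl o => (inl o, t)
      | inr s => (inr (sm_fw s (get t)).1, put (sm_fw s (get t)).2) end)
    (fun s t => match s with
      | inl o => (inl o, t)
      | inr s => (inr (sm_bw s (get t)).1, put (sm_bw s (get t)).2) end)
    (fun s a => match s with
      | inl None => if a is LeftEnd then (Some (inl (Some None)), MoveRight)
                    else (Some (inl None), MoveLeft)
      | inl (Some None) => if a is Letter c then
            (Some (inl (Some (Some c))), MoveRight) else (None, Stay)
      | inl (Some (Some _)) => (Some (inr (sm_start M)), Stay)
      | inr s => (if (sm_ct s a).1 is Some s' then Some (inr s')
                  else Some (inl (Some None)), (sm_ct s a).2) end).

Lemma fi_fw (o : option (option A)) w : scanf (@sm_fw _ _ fi_mach) (inl o) w =
  (inl o, if o is Some (Some a) then [seq (t.1, (a, t.2.2)) | t <- w] else w).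
Proof. by elim: w => [|a w]; case: o => [[o|]|] //= ->. Qed.

Lemma fi_bw o w : scanb (@sm_bw _ _ fi_mach) (inl o) w = (inl o, w).
Proof. by elim: w => //= a w ->. Qed.

Lemma fi_rewind x w p : p <= (size x).+1 ->
  sm_reach (M := fi_mach) x (Some (inl None), w, p) (Some (inl (Some None)), w, 1).
Proof.
elim: p => [|p IH] lep.
  by apply: sm_reach1; rewrite /sm_step /= fi_fw fi_bw /= minnSS min0n.
apply: sm_reach_trans (IH (ltnW lep)); apply: sm_reach1.
rewrite /sm_step /= fi_fw fi_bw /=.
have /minn_idPl minE := ltnW lep.
have [ltp|gep] := ltnP p (size x).
  have [a _] : exists a : A, true by case: (x) ltp => // a *; exists a.
  by rewrite /input_at /= (nth_map a) //= minE.
by rewrite /input_at /= nth_default ?size_map //= minE.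
Qed.

Lemma fi_body x w p u1 p1 :
  sm_reach x (Some (sm_start M), map get w, p) (None, u1, p1) ->
  exists w1, sm_reach (M := fi_mach) x (Some (inr (sm_start M)), w, p)
      (Some (inl (Some None)), w1, p1) /\ map get w1 = u1.
Proof.
move=> r.
have [|||w1 [? ? _]] := @sm_embed A TT _ unit fi_mach M inr
  (Some (inl (Some None))) get (fun t => tt) _ _ _ x _ w p u1 p1 r.
- by move=> s [a [e g']]; split=> //=; rewrite /get /=; case: (sm_fw _ _).2 => [[]].
- by move=> s [a [e g']]; split=> //=; rewrite /get /=; case: (sm_bw _ _).2 => [[]].
- by [].
- by exists w1.
Qed.

End FoldIn.

(** The input head is itself the loop variable, so the body has to leave it in place. The loop
    rewinds the head at its start but does not restore it at the end, so it cannot serve as the body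
    of another such loop. *)
Lemma LI_foldin (a0 : A) (T : finType) (F : seq A -> seq (T * A) -> _) :
  LI true F ->
  LI false (fun x u =>
    foldl (fun v a => unzip1 (F x [seq (t, a) | t <- v])) u x).
Proof.
case=> [E [e0 [M H]]]; exists (A * E)%type, (a0, e0), (fi_mach M) => x w p sw lep.
suff loop : forall y z w, size w = W x -> x = z ++ y ->
  exists w' p', [/\ sm_reach (M := fi_mach M) x
         (Some (inl (Some None)), w, (size z).+1) (None, w', p'),
    unzip1 w' = foldl (fun v a => unzip1 (F x [seq (t, a) | t <- v])) (unzip1 w) y
    & p' <= (size x).+1].
  have [w' [p' [R1 e1 l1]]] := loop x [::] w sw erefl.
  exists w', p'; split=> //; exact: sm_reach_trans (fi_rewind M w lep) R1.
elim=> [|a y IH] z {sw}w sw xE.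
  exists w, (size z).+1; split=> //; last by rewrite xE cats0.
  apply: sm_reach1; rewrite /sm_step /= fi_fw fi_bw /= /input_at /=.
  by rewrite nth_default ?size_map xE cats0 //= minnn.
have ltz : size z < size x by rewrite xE size_cat /= -addSnnS leq_addr.
set w0 := [seq (t.1, (a, t.2.2)) | t <- w].
have [||u1 [p1 [r1 q1 l1 /(_ isT) h1]]] :=
  H x [seq ((t.1, t.2.1), t.2.2) | t <- w0] (size z).+2 _ _.
- by rewrite !size_map.
- by [].
have [w1 [R1 g1]] := fi_body r1.
have sw1 : size w1 = W x by rewrite (sm_reach_size R1) size_map.
have [|w' [p' [R2 e2 l2]]] := IH (rcons z a) w1 sw1; first by rewrite cat_rcons.
exists w', p'; split=> //; last first.
  rewrite e2 /=; congr (foldl _ _ y).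
  move: q1; rewrite -g1 -!map_comp /comp /= => q1.
  have -> : unzip1 w1 = unzip1 (unzip1 [seq (t.1, t.2.1, t.2.2) | t <- w1]).
    by rewrite /unzip1 -!map_comp.
  by rewrite q1 /unzip1 -!map_comp.
rewrite size_rcons in R2; rewrite h1 in R1.
apply: sm_reach_trans (sm_reach_trans R1 R2).
apply: (@sm_reach_trans _ _ (fi_mach M) x (Some (inl (Some (Some a))), w, (size z).+2)).
  apply: sm_reach1; rewrite /sm_step /= fi_fw fi_bw /= /input_at /=.
  rewrite (nth_map a) // xE nth_cat ltnn subnn /= -xE.
  by congr (_, _, _); apply/minn_idPl.
apply: sm_reach1; rewrite /sm_step /= fi_fw fi_bw /=.
by congr (_, _, _); apply/minn_idPl.
Qed.

End LIfold.

(** * From sweep machines to Turing machines *)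

Lemma scanb_rcons S T (f : S -> T -> S * T) s u a :
  scanb f s (rcons u a) = ((scanb f (f s a).1 u).1,
                           rcons (scanb f (f s a).1 u).2 (f s a).2).
Proof. by elim: u => //= c u ->. Qed.

Fixpoint binc (u : seq bool) : seq bool :=
  match u with
  | [::] => [:: true]
  | false :: u' => true :: u'
  | true :: u' => false :: binc u'
  end.

(** This is how the Turing machine marks off its cells: counting the input letters in binary leaves
    a numeral of exactly [W x] digits. *)
Lemma size_iter_binc k :
  size (iter k binc [:: false]) = (trunc_log 2 k).+1.
Proof.
pose val := foldr (fun (c : bool) v => c + v.*2) 0.
have val_binc u : val (binc u) = (val u).+1 by elim: u => [|[] u IH] //=; lia.
have ltval u : val u < 2 ^ size u.
  by elim: u => [|[] u IH] //=; rewrite expnS; lia.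
have Hval j : val (iter j binc [:: false]) = j.
  by elim: j => //= j IH; rewrite val_binc IH.
have last_binc u : u = [:: false] \/ (u != [::] /\ 2 ^ (size u).-1 <= val u) ->
    2 ^ (size (binc u)).-1 <= val (binc u).
  case=> [-> //|[]]; elim: u => [//|c [|c' u] IH] _; first by case: c.
  set v := c' :: u in IH *.
  have sv : size v = (size v).-1.+1 by [].
  have -> : (size (c :: v)).-1 = (size v).-1.+1 by [].
  rewrite expnS => h.
  case: c h => [|] h; last by rewrite /= -/(val v) expnS; move: h => /=; lia.
  have -> : binc (true :: v) = false :: binc v by [].
  have -> : (size (false :: binc v)).-1 = (size (binc v)).-1.+1.
    by rewrite /v /=; case: (c').
  by rewrite expnS; have := IH isT; move: h; rewrite /= -/(val v) -/(val (binc v)); lia.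
case: k => [|k]; first by rewrite trunc_log0.
have lo : 2 ^ (size (iter k.+1 binc [:: false])).-1 <= k.+1.
  rewrite -{2}(Hval k.+1) iterS; apply: (last_binc).
  elim: k => [|k IH]; [by left | right]; split; first by rewrite /=; case: (iter k _ _) => [//|[]].
  by rewrite iterS; apply: (last_binc).
have hi := ltval (iter k.+1 binc [:: false]); rewrite Hval in hi.
have nz : 0 < size (iter k.+1 binc [:: false]) by rewrite /=; case: (iter k _ _) => [//|[]].
rewrite -[LHS](prednK nz); congr _.+1; apply/esym/trunc_log_eq => //.
by rewrite lo prednK.
Qed.

Section Compile.
Variables (A T : finType) (M : smach A T) (t0 : T) (acc : T -> bool).

Definition cletter : Type := option (unit + (bool + T)).
HB.instance Definition _ := Finite.on cletter.
Notation Mk := (Some (inl tt) : cletter).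
Notation Bit c := (Some (inr (inl c)) : cletter).
Notation Sym a := (Some (inr (inr a)) : cletter).

(** The flag of a running state is the direction of the sweep, [true] for forward. In [inr None] the
    sweep machine has halted and the verdict is about to be read off the first cell. *)
Definition cstate : Type := ('I_6 + sm_st M * bool + option bool)%type.
HB.instance Definition _ := Finite.on cstate.
Definition ini (n : nat) : cstate := inl (inl (inord n)).
Notation run s d := (inl (inr (s, d)) : cstate).

(* Initial states: 0 and 1 write the left marker and the first cell, 2 walks
   back to the marker and consults the input, 3 increments the letter count in
   binary, 4 turns its digits into letters and 5 walks back to the marker. *)
Definition ctrans (q : cstate) (i : input_symbol A) (l : cletter) :
    cstate * move * (cletter * move) :=
  match q with
  | inl (inl n) =>
    match val n with
    | 0 => (ini 1, Stay, (Mk, MoveRight))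
    | 1 => (ini 2, Stay, (Bit false, MoveLeft))
    | 2 => if l is Some (inl tt) then
             match i with
             | LeftEnd => (ini 2, MoveRight, (l, Stay))
             | Letter _ => (ini 3, MoveRight, (l, MoveRight))
             | RightEnd => (ini 4, Stay, (l, MoveRight))
             end
           else (ini 2, Stay, (l, MoveLeft))
    | 3 => if l is Some (inr (inl true)) then
             (ini 3, Stay, (Bit false, MoveRight))
           else (ini 2, Stay, (Bit true, MoveLeft))
    | 4 => if l is None then (ini 5, Stay, (l, MoveLeft))
           else (ini 4, Stay, (Sym t0, MoveRight))
    | _ => if l is Some (inl tt) then
             (run (sm_start M) true, Stay, (l, MoveRight))
           else (ini 5, Stay, (l, MoveLeft))
    end
  | inl (inr (s, true)) =>
    if l is Some (inr (inr a)) then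
      (run (sm_fw s a).1 true, Stay, (Sym (sm_fw s a).2, MoveRight))
    else (run s false, Stay, (l, MoveLeft))
  | inl (inr (s, false)) =>
    if l is Some (inr (inr a)) then
      (run (sm_bw s a).1 false, Stay, (Sym (sm_bw s a).2, MoveLeft))
    else (if (sm_ct s i).1 is Some s' then run s' true else inr None,
          (sm_ct s i).2, (l, MoveRight))
  | inr _ => (inr (Some (if l is Some (inr (inr a)) then acc a else false)), Stay, (l, Stay))
  end.

Definition compile : turing_machine A :=
  @TuringMachine A cstate cletter 1 None (ini 0)
    (fun q => if q is inr o then o else None)
    (fun q i w => let r := ctrans q i (thead w) in (r.1, [tuple r.2])).

Definition cconf := (cstate * nat * nat * (nat -> cletter))%type.

Definition mkc (c : cconf) : tm_config compile :=
  @TMConfig A compile c.1.1.1 c.1.1.2 (fun=> c.1.2) (fun=> c.2).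

Definition astep (x : seq A) (c : cconf) : cconf :=
  if c.1.1.1 is inr (Some _) then c else
  let r := ctrans c.1.1.1 (input_at x c.1.1.2) (c.2 c.1.2) in
  (r.1.1, minn (shift_head r.1.2 c.1.1.2) (size x).+1, shift_head r.2.2 c.1.2,
   fun p => if p == c.1.2 then r.2.1 else c.2 p).

Arguments ctrans : simpl never.

Lemma mkc_step x c : tm_step x (mkc c) = mkc (astep x c).
Proof.
case: c => [[[q ip] hp] tape]; rewrite /tm_step /astep /=.
have hd : thead [tuple tape hp | _ < 1] = tape hp by rewrite /thead tnth_mktuple.
case: q => [q|[b|]] //=; rewrite hd /mkc /=.
  case: (ctrans _ _ _) => [[q' m] [l' m']] /=.
  by congr TMConfig; apply: functional_extensionality => i; rewrite (ord1 i).
by congr TMConfig; apply: functional_extensionality => i; rewrite (ord1 i).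
Qed.

Section Runs.
Variables (x : seq A) (B : nat).

Definition breach (c c' : cconf) :=
  exists n, iter n (astep x) c = c' /\
    forall t, t <= n -> (iter t (astep x) c).1.2 <= B.

Lemma breach_step c2 c1 c3 :
  c1.1.2 <= B -> astep x c1 = c2 -> breach c2 c3 -> breach c1 c3.
Proof.
move=> h e [n [e1 h1]]; exists n.+1; split; first by rewrite iterSr e.
by case=> [//|t] le_t; rewrite iterSr e; apply: h1.
Qed.

Definition tp (l : seq cletter) (p : nat) : cletter :=
  if p is p'.+1 then nth None l p' else Mk.

Lemma tp_upd l1 a a' l2 h : h = (size l1).+1 ->
  (fun p => if p == h then a' else tp (l1 ++ a :: l2) p) = tp (l1 ++ a' :: l2).
Proof.
move=> ->; apply: functional_extensionality => -[|p] //=; rewrite eqSS !nth_cat.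
case: ltngtP => [||->] //=; last by rewrite subnn.
by rewrite -subn_gt0; case: (p - _).
Qed.

Lemma tp_ext l a h : h = (size l).+1 ->
  (fun p => if p == h then a else tp l p) = tp (rcons l a).
Proof.
move=> ->; apply: functional_extensionality => -[|p] //=; rewrite eqSS nth_rcons.
by case: ltngtP => //= lp; rewrite nth_default // ltnW.
Qed.

Lemma tp_same (tape : nat -> cletter) h a : tape h = a ->
  (fun p => if p == h then a else tape p) = tape.
Proof. by move=> <-; apply: functional_extensionality => p; case: eqP => [->|]. Qed.

Lemma tp_end l h : h = (size l).+1 -> tp l h = None.
Proof. by move=> ->; rewrite /= nth_default. Qed.

Notation Syms := (map (fun a => Sym a)).
Notation Bits := (map (fun c => Bit c)).

Lemma back2 ip h l c : h <= B -> (forall p, tp l p.+1 <> Mk) ->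
  breach (ini 2, ip, 0, tp l) c -> ip <= (size x).+1 ->
  breach (ini 2, ip, h, tp l) c.
Proof.
move=> hB nM hc ip_le; elim: h hB => [//|h IH] hB.
apply: breach_step (IH (ltnW hB)) => //; rewrite /astep /ctrans /= inordK //.
by have := nM h; rewrite /=; case E : (nth None l h) => [[[]|[]]|] // _ /=;
  rewrite tp_same // (minn_idPl ip_le).
Qed.

Lemma back5 ip h l c : h <= B -> (forall p, tp l p.+1 <> Mk) ->
  breach (ini 5, ip, 0, tp l) c -> ip <= (size x).+1 ->
  breach (ini 5, ip, h, tp l) c.
Proof.
move=> hB nM hc ip_le; elim: h hB => [//|h IH] hB.
apply: breach_step (IH (ltnW hB)) => //; rewrite /astep /ctrans /= inordK //.
by have := nM h; rewrite /=; case E : (nth None l h) => [[[]|[]]|] // _ /=;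
  rewrite tp_same // (minn_idPl ip_le).
Qed.

Lemma Bits_nM l p : tp (Bits l) p.+1 <> Mk.
Proof. by rewrite /=; elim: l p => [|a l IH] [|p] //=. Qed.

Lemma Syms_nM l p : tp (Syms l) p.+1 <> Mk.
Proof. by rewrite /=; elim: l p => [|a l IH] [|p] //=. Qed.

Lemma inc_run ip l r c : ip <= (size x).+1 -> size l + size r < B ->
  breach (ini 2, ip, 0, tp (Bits (l ++ binc r))) c ->
  breach (ini 3, ip, (size l).+1, tp (Bits (l ++ r))) c.
Proof.
move=> ip_le; elim: r l => [|a r IH] l sB hc.
  rewrite addn0 in sB.
  have step : breach (ini 2, ip, size l, tp (Bits (l ++ [:: true]))) c.
    by apply: back2 hc ip_le; [exact: ltnW | exact: Bits_nM].
  apply: breach_step step => //; rewrite /astep /ctrans /= inordK // cats0.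
  by rewrite nth_default ?size_map //= tp_ext ?size_map // (minn_idPl ip_le) map_cat cats1.
rewrite map_cat /=; case: a sB hc => sB hc.
  apply: breach_step (IH (rcons l false) _ _).
  - by move: sB => /=; lia.
  - rewrite /astep /ctrans /= inordK // nth_cat size_map ltnn subnn /=.
    rewrite tp_upd ?size_map // (minn_idPl ip_le) size_rcons.
    by rewrite -cats1 !map_cat /= -catA.
  - by move: sB; rewrite size_rcons /=; lia.
  - by rewrite cat_rcons.
have step : breach (ini 2, ip, size l, tp (Bits (l ++ true :: r))) c.
  by apply: back2 hc ip_le; [move: sB => /=; lia | exact: Bits_nM].
apply: breach_step step; first by move: sB => /=; lia.
rewrite /astep /ctrans /= inordK // nth_cat size_map ltnn subnn /=.
by rewrite tp_upd ?size_map // (minn_idPl ip_le) map_cat.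
Qed.

Hypothesis W_B : W x < B.

Lemma count_run k c : k <= size x ->
  breach (ini 2, k.+1, 0, tp (Bits (iter k binc [:: false]))) c ->
  breach (ini 0, 0, 0, fun=> None) c.
Proof.
elim: k c => [|k IH] c lek hc.
  apply: (@breach_step (ini 1, 0, 1, tp [::])) => //.
    rewrite /astep /ctrans /= inordK //=; congr (_, _, _, _).
    by apply: functional_extensionality => -[|p] //=; rewrite nth_nil.
  apply: (@breach_step (ini 2, 0, 0, tp [:: Bit false])); first by move: W_B => /=; lia.
    by rewrite /astep /ctrans /= inordK //= tp_ext.
  apply: breach_step hc => //.
  by rewrite /astep /ctrans /= inordK //= tp_same // minnSS min0n.
apply: IH; first exact: ltnW.
have [a inE] : exists a, input_at x k.+1 = Letter a.
  rewrite /input_at /=; case: (x) lek => // b s lek.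
  by exists (nth b (b :: s) k); rewrite (nth_map b).
apply: (@breach_step (ini 3, k.+2, 1, tp (Bits (iter k binc [:: false])))) => //.
  rewrite /astep /ctrans /= inordK //= inE /= tp_same //.
  by rewrite (minn_idPl _).
have sz : size (iter k binc [:: false]) <= W x.
  by rewrite size_iter_binc /W ltnS leq_trunc_log // ltnW.
by apply: (@inc_run _ [::]) => //; rewrite add0n; exact: leq_ltn_trans W_B.
Qed.

Lemma conv_run ip (l : seq T) (r : seq bool) c : ip <= (size x).+1 -> size l + size r < B ->
  breach (ini 5, ip, 0, tp (Syms (nseq (size l + size r) t0))) c ->
  breach (ini 4, ip, (size l).+1, tp (Syms (nseq (size l) t0) ++ Bits r)) c.
Proof.
move=> ip_le; elim: r l => [|a r IH] l sB hc.
  rewrite addn0 in sB hc.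
  have step : breach (ini 5, ip, size l, tp (Syms (nseq (size l) t0))) c.
    by apply: back5 hc ip_le; [exact: ltnW | exact: Syms_nM].
  apply: breach_step step => //; rewrite cats0 /astep /ctrans /= inordK //.
  rewrite nth_default ?size_map ?size_nseq //= (minn_idPl ip_le) tp_same //.
  by rewrite tp_end // size_map size_nseq.
apply: breach_step (IH (t0 :: l) _ _).
- by move: sB => /=; lia.
- rewrite /astep /ctrans /= inordK // nth_cat size_map size_nseq ltnn subnn /=.
  rewrite tp_upd ?size_map ?size_nseq // (minn_idPl ip_le).
  congr (_, _, _, tp _).
  by rewrite /=; elim: (size l) => //= n ->.
- by move: sB => /=; lia.
- by rewrite [size (t0 :: l)]/= addSnnS.
Qed.

Lemma init_run c :
  breach (run (sm_start M) true, (size x).+1, 1, tp (Syms (nseq (W x) t0))) c ->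
  breach (ini 0, 0, 0, fun=> None) c.
Proof.
move=> hc; apply: (count_run (leqnn _)).
have sz : size (iter (size x) binc [:: false]) = W x by rewrite size_iter_binc.
apply: (@breach_step (ini 4, (size x).+1, 1,
    tp (Bits (iter (size x) binc [:: false])))) => //.
  rewrite /astep /ctrans /= inordK //= /input_at /= nth_default ?size_map //=.
  by rewrite tp_same // minnn.
apply: (@conv_run _ [::]) => //; first by rewrite sz.
rewrite sz; apply: breach_step hc => //.
by rewrite /astep /ctrans /= inordK //= tp_same // minnn.
Qed.

Lemma fwd_run ip s l r c : ip <= (size x).+1 -> size l + size r < B ->
  breach (run (scanf (@sm_fw _ _ M) s r).1 true, ip, (size l + size r).+1,
    tp (Syms (l ++ (scanf (@sm_fw _ _ M) s r).2))) c ->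
  breach (run s true, ip, (size l).+1, tp (Syms (l ++ r))) c.
Proof.
move=> ip_le; elim: r s l => [|a r IH] s l sB /= hc; first by rewrite addn0 in hc.
apply: (breach_step _ _ (IH (sm_fw s a).1 (rcons l (sm_fw s a).2) _ _)).
- by move: sB => /=; lia.
- rewrite /astep /ctrans /= map_cat nth_cat size_map ltnn subnn /=.
  rewrite tp_upd ?size_map // (minn_idPl ip_le) size_rcons.
  by rewrite -cats1 !map_cat /= -catA.
- by rewrite size_rcons; move: sB => /=; lia.
- by rewrite cat_rcons size_rcons; move: hc; rewrite addnS addSn.
Qed.

Lemma bwd_run ip s l r c : ip <= (size x).+1 -> size l < B ->
  breach (run (scanb (@sm_bw _ _ M) s l).1 false, ip, 0,
    tp (Syms ((scanb (@sm_bw _ _ M) s l).2 ++ r))) c ->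
  breach (run s false, ip, size l, tp (Syms (l ++ r))) c.
Proof.
move=> ip_le; elim/last_ind: l s r => [|l a IH] s r sB; first by [].
rewrite scanb_rcons size_rcons in sB * => /= hc.
apply: (breach_step _ _ (IH (sm_bw s a).1 ((sm_bw s a).2 :: r) _ _)).
- by move: sB => /=; lia.
- rewrite /astep /ctrans /= cat_rcons map_cat nth_cat size_map ltnn subnn /=.
  by rewrite tp_upd ?size_map // (minn_idPl ip_le) map_cat.
- exact: ltnW.
- by rewrite -cat_rcons.
Qed.

Lemma round_run s u p c : size u = W x -> p <= (size x).+1 ->
  let c1 := sm_step x (Some s, u, p) in
  breach (if c1.1.1 is Some s' then run s' true else inr None, c1.2, 1,
          tp (Syms c1.1.2)) c ->
  breach (run s true, p, 1, tp (Syms u)) c.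
Proof.
move=> su lep; rewrite /sm_step /=.
set r1 := scanf _ s u; set r2 := scanb _ _ _ => hc.
have s1 : size r1.2 = W x by rewrite size_scanf.
have s2 : size r2.2 = W x by rewrite size_scanb.
apply: (@fwd_run p s [::] u) => //; rewrite add0n ?su //.
have W0 : 0 < W x by [].
apply: (@breach_step (run r1.1 false, p, W x, tp (Syms r1.2))) => //.
  rewrite /astep /ctrans /= -/r1 nth_default ?size_map ?s1 //= (minn_idPl lep) tp_same //.
  by rewrite tp_end // size_map s1.
have hb := @bwd_run p r1.1 r1.2 [::] c lep; rewrite !cats0 s1 in hb.
apply: hb => //; apply: breach_step hc => //.
by rewrite /astep /ctrans /= tp_same //; case: (sm_ct _ _) => [[s'|] m].
Qed.

Lemma sm_run s u p u' p' c : size u = W x -> p <= (size x).+1 ->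
  sm_reach (M := M) x (Some s, u, p) (None, u', p') ->
  breach (inr None, p', 1, tp (Syms u')) c ->
  breach (run s true, p, 1, tp (Syms u)) c.
Proof.
move=> su lep [n]; elim: n s u p su lep => // n IH s u p su lep.
rewrite iterSr => e hc; apply: round_run => //.
have sz := @sm_reach_size _ _ M x (Some s, u, p) _ (sm_reach1 erefl).
have pl : (sm_step x (Some s, u, p)).2 <= (size x).+1 by rewrite /sm_step /= geq_minr.
move: e sz pl; case: (sm_step _ _) => [[[s'|] u1] p1] /= e sz pl.
  by apply: (IH s' u1 p1) => //; rewrite sz.
have hN : forall k (d : sm_conf M), d.1.1 = None -> iter k (sm_step x) d = d.
  by move=> k d dN; elim: k => //= k ->; rewrite /sm_step dN.
by move: e; rewrite hN // => -[-> ->].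
Qed.

End Runs.

End Compile.

Lemma LI_logspace (A : finType) hf (T : finType) (F : seq A -> seq T -> seq T)
    (t0 : T) (acc : T -> bool) :
  LI hf F -> in_logspace (fun x => acc (head t0 (F x (nseq (W x) t0)))).
Proof.
case=> E [e0 [M H]].
(* The work head stays within [W x + 1], which is below [3 * W x]; the factor 2 would fail for
   [W x = 1]. *)
exists (compile M (t0, e0) (fun a => acc a.1)), 3 => x.
(* Counting the letters leaves the input head on the right end marker, so the simulation starts
   there. *)
have [||u' [p' [r1 q1 l1 _]]] := H x (nseq (W x) (t0, e0)) (size x).+1 _ _.
- by rewrite size_nseq.
- by [].
have su' : size u' = W x by rewrite (sm_reach_size r1) size_nseq.
have q2 : unzip1 u' = F x (nseq (W x) t0).
  by rewrite q1; congr (F x _); elim: (W x) => //= n ->.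
set res := acc _.
pose stp := @astep A _ M (t0, e0) (fun a => acc a.1) x.
have [n [e hB]] : @breach A _ M (t0, e0) (fun a => acc a.1) x (W x).+1
   (ini M 0, 0, 0, fun=> None)
   (inr (Some res), p', 1, tp (map (fun a => Some (inr (inr a))) u')).
  apply: init_run; first by rewrite ltnS.
  apply: (sm_run _ _ _ r1); rewrite ?size_nseq //.
  exists 1; split; last by case=> [|[|t]].
  rewrite /= /astep /ctrans /= (minn_idPl l1) tp_same //.
  case: (u') su' q2 => // a v _ q2.
  by rewrite /= /res -q2.
have run_mkc t : tm_run (compile M (t0, e0) (fun a => acc a.1)) x t =
    mkc _ _ (iter t stp (ini M 0, 0, 0, fun=> None)).
  by elim: t => // t IH; rewrite /tm_run iterS -/(tm_run _ x t) IH mkc_step.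
split; first by exists n; rewrite run_mkc e.
move=> t i; rewrite run_mkc /=.
suff : (iter t stp (ini M 0, 0, 0, fun=> None)).1.2 <= (W x).+1.
  by move=> h; apply: leq_ltn_trans h _; rewrite /W; lia.
have [/hB //|lt_n] := leqP t n.
rewrite -(subnK (ltnW lt_n)) iterD e.
set c0 := (_, _, _, _); suff -> : iter (t - n) stp c0 = c0 by [].
by elim: (t - n) => // k IH; rewrite iterS IH.
Qed.

(** * Predicates decided by sweeping *)

Lemma mapz1 (X Y Z : Type) (g : X -> Z) (u : seq X) (w : seq Y) :
  size u = size w -> [seq g a.1 | a <- zip u w] = map g u.
Proof. by elim: u w => [|a u IH] [|c w] //= [/IH ->]. Qed.

Lemma mapz2 (X Y Z : Type) (g : Y -> Z) (u : seq X) (w : seq Y) :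
  size u = size w -> [seq g a.2 | a <- zip u w] = map g w.
Proof. by elim: u w => [|a u IH] [|c w] //= [/IH ->]. Qed.

Lemma foldl_cons (X Y : Type) (f : X -> Y -> X) z y s :
  foldl f z (y :: s) = foldl f (f z y) s.
Proof. by []. Qed.

Section Combinators.
Variable A : finType.
Implicit Types (T : finType).

Definition LF T (F : seq A -> seq T -> seq T) := LI false F.

(* A predicate is decided by broadcasting its truth value to every cell. *)
Definition LP T (P : seq A -> seq T -> bool) : Prop :=
  @LF (T * bool)%type (fun x w => [seq (a.1, P x (unzip1 w)) | a <- w]).

Lemma LP_ext T (P P' : seq A -> seq T -> bool) :
  (forall x u, size u = W x -> P x u = P' x u) -> LP P -> LP P'.
Proof.
move=> PP'; apply: LI_ext => x w sw; apply: eq_map => a.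
by rewrite PP' // size_map.
Qed.

Lemma LP_intro T T' (get : T -> T') (F : seq A -> seq T' -> seq T') (c : T' -> bool) P :
  LF F ->
  (forall x u, size u = W x -> map c (F x (map get u)) = nseq (W x) (P x u)) ->
  LP P.
Proof.
move=> hF cF.
apply: LI_ext (LI_call (fun a : T * bool => get a.1)
  (fun a b => (a.1, c b)) hF) => x w sw.
have su : size (unzip1 w) = W x by rewrite size_map.
have := cF x _ su; rewrite -map_comp.
have := LI_size hF (_ : size (map (fun a : T * bool => get a.1) w) = W x).
rewrite size_map => /(_ sw) sF; move: sF; rewrite /comp.
set v := F x _; move: (P x _) => b; rewrite -sw => sv.
elim: w v sv {sw su} => [|a w IH] [|d v] //= [/IH {}IH] [-> /IH ->].
by [].
Qed.

Lemma LF_test T (P : seq A -> seq T -> bool) (put : T -> bool -> T) :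
  LP P -> LF (fun x u => [seq put a (P x u) | a <- u]).
Proof.
move=> hP; apply: LI_ext (LI_call (fun a : T => (a, false)) (fun a b => put a b.2) hP).
move=> x u su; rewrite unzip1_map map_id.
by move: (P x u) => b; elim: u {su} => //= a u ->.
Qed.

Lemma LP_map T T' (g : T -> T') (P : seq A -> seq T' -> bool) :
  LP P -> LP (fun x u => P x (map g u)).
Proof.
move=> hP; apply: (LP_intro (get := fun a => (g a, false)) (c := snd) hP) => x u su.
rewrite -map_comp unzip1_map -su.
by move: (P x _) => b; elim: u {su} => //= a u ->.
Qed.

Lemma map_nseqE T T' (f : T -> T') (c : T') u : (forall a, f a = c) ->
  map f u = nseq (size u) c.
Proof. by move=> fc; elim: u => //= a u ->; rewrite fc. Qed.

Lemma LP_op T (op : bool -> bool -> bool) (P1 P2 : seq A -> seq T -> bool) :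
  LP P1 -> LP P2 -> LP (fun x u => op (P1 x u) (P2 x u)).
Proof.
move=> h1 h2.
have t1 := LF_test (fun (a : T * (bool * bool)) b => (a.1, (b, a.2.2)))
  (LP_map fst h1).
have t2 := LF_test (fun (a : T * (bool * bool)) b => (a.1, (a.2.1, b)))
  (LP_map fst h2).
apply: (LP_intro (get := fun a => (a, (false, false)))
  (c := fun a => op a.2.1 a.2.2) (LI_comp t1 t2)) => x u su.
set v0 := map _ u; have E0 : map fst v0 = u by rewrite /v0 -map_comp map_id.
set v1 := [seq _ | a <- v0].
have E1 : map fst v1 = u by rewrite /v1 -map_comp -[RHS]E0; apply: eq_map.
rewrite E1 -map_comp /v1 E0 -map_comp /v0 -map_comp (map_nseqE (c := op (P1 x u) (P2 x u))) ?su //.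
Qed.

Lemma LP_not T (P : seq A -> seq T -> bool) : LP P -> LP (fun x u => ~~ P x u).
Proof. by move=> h; apply: (LP_op (fun b _ => ~~ b) h h). Qed.

Lemma LP_and T (P1 P2 : seq A -> seq T -> bool) :
  LP P1 -> LP P2 -> LP (fun x u => P1 x u && P2 x u).
Proof. exact: LP_op. Qed.

Lemma LP_imply T (P1 P2 : seq A -> seq T -> bool) :
  LP P1 -> LP P2 -> LP (fun x u => P1 x u ==> P2 x u).
Proof. exact: LP_op. Qed.

Lemma LP_eqb T (P1 P2 : seq A -> seq T -> bool) :
  LP P1 -> LP P2 -> LP (fun x u => P1 x u == P2 x u).
Proof. exact: LP_op. Qed.

(** The forward sweep runs the automaton, and the backward sweep broadcasts its verdict. *)
Lemma LP_dfa T (S : finType) (d : S -> T -> S) s (acc : S -> bool) :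
  LP (fun _ u => acc (foldl d s u)).
Proof.
apply: LI_weak; apply: LI_ext (LI_scan A (fun s (a : T * bool) => (d s a.1, a))
  (fun s (a : T * bool) => (s, (a.1, acc s))) s) => x w sw.
rewrite /roundtrip.
have -> : scanf (fun s (a : T * bool) => (d s a.1, a)) s w = (foldl d s (unzip1 w), w).
  by elim: w s {sw} => //= a w IH s; rewrite IH.
by rewrite /= (scanb_keep (fun s a => (a.1, acc s))).
Qed.

Lemma LP_all T (c : pred T) : LP (fun _ u => all c u).
Proof.
apply: LP_ext (LP_dfa (fun (b : bool) a => b && c a) true id) => x u _.
rewrite -[RHS]andTb; move: true => b.
by elim: u b => [|a u IH] b /=; rewrite ?andbT // IH andbA.
Qed.

Lemma LP_comp T (F : seq A -> seq T -> seq T) (P : seq A -> seq T -> bool) :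
  LF F -> LP P -> LP (fun x u => P x (F x u)).
Proof.
move=> hF hP.
have h1 := LI_call (fun a : T * bool => a.1) (fun a b => (b, a.2)) hF.
apply: (LP_intro (get := fun a => (a, false)) (c := snd) (LI_comp h1 hP)) => x u su.
have sF := LI_size hF su.
set v0 := map _ u; have E0 : [seq a.1 | a <- v0] = u by rewrite /v0 -map_comp map_id.
set v1 := [seq (a.2, a.1.2) | a <- _]; have sz : size v0 = size (F x u) by rewrite sF size_map.
have E1 : unzip1 v1 = F x u.
  by rewrite /v1 E0 unzip1_map; apply: unzip2_zip; rewrite sz.
rewrite E1 -map_comp (map_nseqE (c := P x (F x u))) //.
by rewrite /v1 E0 size_map size_zip -sz minnn size_map su.
Qed.

(** * Quantifiers over strings of logarithmic length *)

Section Strings.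
Variables (G : finType) (g0 : G).

Let b := #|G|.-1.
Let cG : b.+1 = #|G|.
Proof. by rewrite /b prednK //; apply/card_gt0P; exists g0. Qed.

Definition decG (k : 'I_b.+1) : G := enum_val (cast_ord cG k).

(** A string puts one letter of [G] into each cell, so a loop over [strs] quantifies over objects of
    logarithmic size. Counter values are only a device to list them. *)
Definition strs (n : nat) : seq (seq G) :=
  [seq map decG (digs b n k) | k <- iota 0 (b.+1 ^ n)].

Lemma decG_inj : injective decG.
Proof. by move=> k l /enum_val_inj /cast_ord_inj. Qed.

Lemma mem_strs n w : (w \in strs n) = (size w == n).
Proof.
apply/mapP/eqP => [[k _ ->]|sw]; first by rewrite size_map size_digs.
pose e g : 'I_b.+1 := cast_ord (esym cG) (enum_rank g).
have eK : cancel e decG by move=> g; rewrite /decG cast_ordKV enum_rankK.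
have [|k lk kE] := @digs_surj b n (map e w); first by rewrite size_map.
by exists k; [rewrite mem_iota | rewrite -kE -map_comp map_id_in // => g _; apply: eK].
Qed.

Lemma uniq_strs n : uniq (strs n).
Proof.
rewrite map_inj_in_uniq ?iota_uniq // => k l; rewrite !mem_iota /= => lk ll.
by move/(inj_map decG_inj); apply: digs_inj.
Qed.

Lemma LF_foldall T (F : seq A -> seq (T * G) -> _) : LF F ->
  LF (fun x u => foldl (fun v w => unzip1 (F x (zip v w))) u (strs (W x))).
Proof.
move=> hF.
have h := LI_call (fun a : T * 'I_b.+1 => (a.1, decG a.2))
  (fun a c => (c.1, a.2)) hF.
apply: LI_ext (LI_foldstr h) => x u su; rewrite /strs.
move: (iota _ _) => r; elim: r u su => // k r IH u su.
rewrite map_cons !foldl_cons.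
set u1 := unzip1 _; set u2 := unzip1 _.
have sz : size (zip u (map decG (digs b (W x) k))) = W x.
  by rewrite size_zip su size_map size_digs minnn.
have sF := LI_size hF sz.
have -> : u1 = u2; last by apply: IH; rewrite size_map.
rewrite /u1 /u2 unzip1_map.
have -> : [seq (a.1, decG a.2) | a <- zip u (digs b (W x) k)]
   = zip u (map decG (digs b (W x) k)).
  by elim: (u) (digs _ _ _) => [|a v IHv] [|c s] //=; rewrite IHv.
rewrite (mapz2 fst) //.
by rewrite size_zip su size_digs minnn; apply/esym/sF.
Qed.

Lemma zip_map1 (X Y Z : Type) (f : X -> Y) (u : seq X) (w : seq Z) :
  zip (map f u) w = [seq (f a.1, a.2) | a <- zip u w].
Proof. by elim: u w => [|a u IH] [|c w] //=; rewrite IH. Qed.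

Lemma LP_forall T (P : seq A -> seq (T * G) -> bool) : LP P ->
  LP (fun x u => all (fun w => P x (zip u w)) (strs (W x))).
Proof.
move=> hP.
pose TT := (T * bool)%type.
have t : @LF (TT * G)%type _ :=
  LF_test (fun (a : TT * G) b => ((a.1.1, a.1.2 && b), a.2))
    (LP_map (fun a : TT * G => (a.1.1, a.2)) hP).
apply: (LP_intro (get := fun a => (a, true)) (c := snd) (LF_foldall t)) => x u su.
suff loop : forall s c, all (fun w => size w == size u) s ->
    map snd (foldl (fun v w => unzip1 [seq ((a.1.1, a.1.2 &&
        P x [seq (c.1.1, c.2) | c <- zip v w]), a.2) | a <- zip v w])
       [seq (a, c) | a <- u] s) = nseq (size u) (c && all (fun w => P x (zip u w)) s).
  by rewrite loop su //; apply/allP => w; rewrite mem_strs.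
elim=> [|w s IH] c /=; first by rewrite andbT -map_comp /= (map_nseqE (c := c)).
case/andP => /eqP sw /IH {}IH; rewrite andbA -IH; congr (map _ (foldl _ _ s)).
have -> : [seq (c0.1.1, c0.2) | c0 <- zip [seq (a, c) | a <- u] w] = zip u w.
  by rewrite zip_map1 -map_comp -[RHS]map_id; apply: eq_map => -[].
rewrite unzip1_map zip_map1 -map_comp /comp /=.
by rewrite (mapz1 (fun a => (a, c && P x (zip u w)))).
Qed.

Lemma LP_exists T (P : seq A -> seq (T * G) -> bool) : LP P ->
  LP (fun x u => has (fun w => P x (zip u w)) (strs (W x))).
Proof.
move=> hP; apply: LP_ext (LP_not (LP_forall (LP_not hP))) => x u _.
by rewrite -has_predC; apply: eq_has => w /=; rewrite negbK.
Qed.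

End Strings.

Lemma iter_foldl (X : Type) (F : X -> X) (s : seq nat) u :
  foldl (fun v _ => F v) u s = iter (size s) F u.
Proof. by elim: s u => //= _ s IH u; rewrite IH -iterSr. Qed.

Lemma LF_iter T b (F : seq A -> seq T -> seq T) : LF F ->
  LF (fun x u => iter (b.+1 ^ W x) (F x) u).
Proof.
move=> hF.
have h := LI_call (fun a : T * 'I_b.+1 => a.1) (fun a c => (c, a.2)) hF.
apply: LI_ext (LI_foldstr h) => x u su.
rewrite -[in RHS](size_iota 0 (b.+1 ^ W x)) -iter_foldl.
elim: (iota _ _) u su => // k r IH u su; rewrite !foldl_cons.
have sF := LI_size hF su.
have sd : size u = size (digs b (W x) k) by rewrite size_digs.
rewrite -/(unzip1 (zip u _)) unzip1_zip ?sd // unzip1_map (mapz2 id).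
  by rewrite map_id; apply: IH.
by rewrite size_zip -sd minnn su sF.
Qed.

(** A conditional increment: every cell holds the broadcast flag, and the first cell, reached in
    state [None], injects it as the initial carry. *)
Definition incfl K (s : option bool) (a : bool * 'I_K.+1) :=
  (Some (incf (odflt a.1 s) a.2).1, (a.1, (incf (odflt a.1 s) a.2).2)).

Lemma scanf_incfl K n k (f : bool) :
  (scanf (@incfl K) None [seq (f, c) | c <- digs K n k]).2
  = [seq (f, c) | c <- digs K n (k + f)].
Proof.
have H c u : (scanf (@incfl K) (Some c) [seq (f, c) | c <- u]).2
    = [seq (f, d) | d <- (scanf (@incf K) c u).2].
  by elim: u c => //= a u IH c; rewrite IH.
have -> : (scanf (@incfl K) None [seq (f, c) | c <- digs K n k]).2 =
    [seq (f, d) | d <- (scanf (@incf K) f (digs K n k)).2].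
  by case: (digs K n k) => //= a u; rewrite H.
by case: f {H}; rewrite ?scanf_inc ?addn1 // scanf_inc0 addn0.
Qed.

(** Two counters run along with one loop over all strings. Their base is [#|G| + 1] rather than
    [#|G|], so that a count of all [#|G| ^ W x] strings does not overflow and equal digits mean
    equal counts. *)
Lemma LP_count_eq T (G : finType) (g0 : G) (P1 P2 : seq A -> seq (T * G) -> bool) :
  LP P1 -> LP P2 ->
  LP (fun x u => count (fun w => P1 x (zip u w)) (strs g0 (W x))
              == count (fun w => P2 x (zip u w)) (strs g0 (W x))).
Proof.
move=> h1 h2; pose b := #|G|.-1; pose K := 'I_b.+2.
pose TT := (T * (bool * K * (bool * K)))%type.
have t1 : @LF (TT * G)%type _ :=
  LF_test (fun (a : TT * G) c => ((a.1.1, (c, a.1.2.1.2, a.1.2.2)), a.2))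
    (LP_map (fun a : TT * G => (a.1.1, a.2)) h1).
have t2 : @LF (TT * G)%type _ :=
  LF_test (fun (a : TT * G) c => ((a.1.1, (a.1.2.1, (c, a.1.2.2.2))), a.2))
    (LP_map (fun a : TT * G => (a.1.1, a.2)) h2).
have t3 : @LF (TT * G)%type _ := LI_call (fun a : TT * G => a.1.2.1)
  (fun a c => ((a.1.1, (c, a.1.2.2)), a.2)) (LI_weak false (LI_scanf A (@incfl b.+1) None)).
have t4 : @LF (TT * G)%type _ := LI_call (fun a : TT * G => a.1.2.2)
  (fun a c => ((a.1.1, (a.1.2.1, c)), a.2)) (LI_weak false (LI_scanf A (@incfl b.+1) None)).
have t := LF_foldall g0 (LI_comp t1 (LI_comp t2 (LI_comp t3 t4))).
have e := LP_comp t (LP_all (fun a : TT => a.2.1.2 == a.2.2.2)).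
apply: LP_ext (LP_map (fun a : T => (a, ((false, ord0), (false, ord0))) : TT) e) => x u su.
pose mkst (f1 f2 : bool) k1 k2 : seq TT :=
  [seq (a.1, ((f1, a.2.1), (f2, a.2.2))) | a <- zip u (zip (digs b.+1 (W x) k1) (digs b.+1 (W x) k2))].
set F := foldl _.
have st0 : [seq (a, ((false, ord0), (false, ord0))) : TT | a <- u] = mkst false false 0 0.
  by rewrite /mkst !digs0 -su; elim: (u) => //= a v ->.
rewrite st0.
have loop s f1 f2 k1 k2 : all (fun w => size w == W x) s ->
    exists f1' f2', F (mkst f1 f2 k1 k2) s =
     mkst f1' f2' (k1 + count (fun w => P1 x (zip u w)) s)
                  (k2 + count (fun w => P2 x (zip u w)) s).
  elim: s f1 f2 k1 k2 => [|w s IH] f1 f2 k1 k2 /=; first by exists f1, f2; rewrite !addn0.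
  case/andP => /eqP sw /IH {}IH; rewrite !addnA.
  have [f1' [f2' E]] := IH (P1 x (zip u w)) (P2 x (zip u w))
     (k1 + P1 x (zip u w)) (k2 + P2 x (zip u w)).
  exists f1', f2'; rewrite -E /F /=; congr (foldl _ _ s).
  have pz f f' l1 l2 : [seq (a.1.1, a.2) | a <- zip (mkst f f' l1 l2) w] = zip u w.
    have s1 : size (digs b.+1 (W x) l1) = size u by rewrite size_digs.
    have s2 : size (digs b.+1 (W x) l2) = size u by rewrite size_digs.
    rewrite /mkst; move: s1 s2 (etrans sw (esym su)).
    move: (digs _ _ l1) (digs _ _ l2) => d1 d2.
    by elim: (u) d1 d2 (w) => [|a v IHv] [|c1 d1] [|c2 d2] [|g w'] //= [e1] [e2] [e3]; rewrite IHv.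
  rewrite pz.
  have E1 f f' l1 l2 c : [seq ((a.1.1, (c, a.1.2.1.2, a.1.2.2)), a.2) | a <- zip (mkst f f' l1 l2) w]
     = zip (mkst c f' l1 l2) w.
    by rewrite /mkst !zip_map1 -!map_comp.
  rewrite E1 pz.
  have E2 f f' l1 l2 c : [seq ((a.1.1, (a.1.2.1, (c, a.1.2.2.2))), a.2) | a <- zip (mkst f f' l1 l2) w]
     = zip (mkst f c l1 l2) w.
    by rewrite /mkst !zip_map1 -!map_comp.
  rewrite E2.
  move: (P1 x _) (P2 x _) => c1 c2.
  have pr f f' l1 l2 : ([seq a.1.2.1 | a <- zip (mkst f f' l1 l2) w] = [seq (f, c) | c <- digs b.+1 (W x) l1])
     * ([seq a.1.2.2 | a <- zip (mkst f f' l1 l2) w] = [seq (f', c) | c <- digs b.+1 (W x) l2]).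
    have s1 : size (digs b.+1 (W x) l1) = size u by rewrite size_digs.
    have s2 : size (digs b.+1 (W x) l2) = size u by rewrite size_digs.
    rewrite /mkst; move: s1 s2 (etrans sw (esym su)).
    move: (digs _ _ l1) (digs _ _ l2) => d1 d2.
    by elim: (u) d1 d2 (w) => [|a v IHv] [|e1 d1] [|e2 d2] [|g w'] //= [h1'] [h2'] [h3']; rewrite !IHv.
  have up1 f f' l1 l2 l : [seq ((a.1.1.1, (a.2, a.1.1.2.2)), a.1.2)
       | a <- zip (zip (mkst f f' l1 l2) w) [seq (f, c) | c <- digs b.+1 (W x) l]]
     = zip (mkst f f' l l2) w.
    have s1 : size (digs b.+1 (W x) l1) = size u by rewrite size_digs.
    have s2 : size (digs b.+1 (W x) l2) = size u by rewrite size_digs.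
    have s3 : size (digs b.+1 (W x) l) = size u by rewrite size_digs.
    rewrite /mkst; move: s1 s2 s3 (etrans sw (esym su)).
    move: (digs _ _ l1) (digs _ _ l2) (digs _ _ l) => d1 d2 d3.
    by elim: (u) d1 d2 d3 (w) => [|a v IHv] [|e1 d1] [|e2 d2] [|e3 d3] [|g w'] //= [h1'] [h2'] [h3'] [h4']; rewrite IHv.
  have up2 f f' l1 l2 l : [seq ((a.1.1.1, (a.1.1.2.1, a.2)), a.1.2)
       | a <- zip (zip (mkst f f' l1 l2) w) [seq (f', c) | c <- digs b.+1 (W x) l]]
     = zip (mkst f f' l1 l) w.
    have s1 : size (digs b.+1 (W x) l1) = size u by rewrite size_digs.
    have s2 : size (digs b.+1 (W x) l2) = size u by rewrite size_digs.
    have s3 : size (digs b.+1 (W x) l) = size u by rewrite size_digs.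
    rewrite /mkst; move: s1 s2 s3 (etrans sw (esym su)).
    move: (digs _ _ l1) (digs _ _ l2) (digs _ _ l) => d1 d2 d3.
    by elim: (u) d1 d2 d3 (w) => [|a v IHv] [|e1 d1] [|e2 d2] [|e3 d3] [|g w'] //= [h1'] [h2'] [h3'] [h4']; rewrite IHv.
  rewrite (pr _ _ _ _).1 scanf_incfl up1 (pr _ _ _ _).2 scanf_incfl up2.
  rewrite unzip1_zip // /mkst size_map !size_zip !size_digs su sw.
  by rewrite !minnn.
have [|f1' [f2' ->]] := loop (strs g0 (W x)) false false 0 0.
  by apply/allP => w; rewrite mem_strs.
rewrite !add0n.
have cle P : count P (strs g0 (W x)) < b.+2 ^ W x.
  apply: leq_ltn_trans (count_size _ _) _; rewrite size_map size_iota.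
  by rewrite ltn_exp2r.
set c1 := count _ _; set c2 := count _ _.
have [-> |ne] := eqVneq c1 c2.
  apply/allP => a /mapP[[t' [d1 d2]] /= tin ->] /=.
  have : (d1, d2) \in unzip2 (zip u (zip (digs b.+1 (W x) c2) (digs b.+1 (W x) c2))).
    exact: (map_f snd tin).
  rewrite unzip2_zip; last by rewrite size_zip !size_digs su minnn.
  move: (digs _ _ _) => d; elim: d => //= c d IHd; rewrite inE => /orP[/eqP[-> ->]//|].
  by move=> h; apply: IHd.
apply/negbTE; apply: contra ne => /allP al; apply/eqP.
apply: (@digs_inj b.+1 (W x) _ _ (cle _) (cle _)).
have gen (v : seq T) d1 d2 : size d1 = size v -> size d2 = size v ->
  {in [seq (a.1, (f1', a.2.1, (f2', a.2.2))) : TT | a <- zip v (zip d1 d2)],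
     forall a : TT, a.2.1.2 == a.2.2.2} -> d1 = d2.
  elim: v d1 d2 => [|a v IHv] [|e1 d1] [|e2 d2] //= [h1'] [h2'] al'.
  have /eqP /= -> := al' _ (mem_head _ _).
  by congr (_ :: _); apply: IHv => // y yin; apply: al'; rewrite inE yin orbT.
by apply: gen al; rewrite size_digs su.
Qed.

End Combinators.

(** * Looking up a table entry *)

Section Positions.

Lemma scanf_rcons S T (f : S -> T -> S * T) s u a :
  scanf f s (rcons u a) = ((f (scanf f s u).1 a).1,
                           rcons (scanf f s u).2 (f (scanf f s u).1 a).2).
Proof. by elim: u s => //= c u IH s; rewrite IH. Qed.

Lemma mkseqS T (f : nat -> T) n : mkseq f n.+1 = rcons (mkseq f n) (f n).
Proof. by rewrite /mkseq -addn1 iotaD map_cat cats1. Qed.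

Lemma scanf_traj S T (f : S -> T -> S * T) (st : nat -> S) (a a' : nat -> T) n :
  (forall t, t < n -> f (st t) (a t) = (st t.+1, a' t)) ->
  scanf f (st 0) (mkseq a n) = (st n, mkseq a' n).
Proof.
elim: n => // n IH h; rewrite !mkseqS scanf_rcons IH => [|t lt_t]; last first.
  by apply: h; apply: leqW.
by rewrite /= h.
Qed.

Definition dg (k t : nat) : 'I_2 := inord ((k %/ 2 ^ t) %% 2).

Lemma digs_dg n k : digs 1 n k = mkseq (dg k) n.
Proof.
elim: n k => [|n IH] k //; rewrite [digs _ _ _]/digs -/(digs 1) IH /mkseq /=.
congr (_ :: _); first by rewrite /dg expn0 divn1.
have -> : iota 1 n = map (addn 1) (iota 0 n) by rewrite -iotaDl.
rewrite -map_comp; apply: eq_map => t /=.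
by rewrite /dg -divnMA add1n expnS.
Qed.

Lemma dg_inc k t :
  incf (k.+1 %% 2 ^ t == 0) (dg k t) = (k.+1 %% 2 ^ t.+1 == 0, dg k.+1 t).
Proof.
have := scanf_inc 1 t.+1 k; rewrite !digs_dg !mkseqS scanf_rcons.
have := scanf_inc 1 t k; rewrite !digs_dg => -> /=.
by case=> e1 /rcons_inj[e2]; rewrite /incf e1 e2.
Qed.

Lemma dg_mod n k t : t < n -> dg (k %% 2 ^ n) t = dg k t.
Proof.
move=> lt_t; rewrite /dg; congr inord.
have -> : 2 ^ n = 2 ^ (n - t) * 2 ^ t by rewrite -expnD subnK // ltnW.
by rewrite -modn_divl modn_dvdm // -{1}(expn1 2) dvdn_exp2l // subn_gt0.
Qed.

Lemma dg_eq n k l : k < 2 ^ n -> l < 2 ^ n ->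
  all (fun t => dg k t == dg l t) (iota 0 n) = (k == l).
Proof.
move=> lk ll; apply/allP/eqP => [h|->]; last by move=> t _; apply: eqxx.
apply: (@digs_inj 1 n) => //; rewrite !digs_dg.
by apply/eq_in_map => t /h /eqP.
Qed.

Lemma all_iotaS (P : pred nat) t : all P (iota 0 t.+1) = all P (iota 0 t) && P t.
Proof. by rewrite -addn1 iotaD all_cat /= andbT. Qed.

Lemma flatten_nil (K X : Type) (F : K -> seq X) s :
  (forall k, F k = [::]) -> flatten (map F s) = [::].
Proof. by move=> F0; elim: s => //= k s ->; rewrite F0. Qed.

End Positions.

(** Per cell: the query (table, row digit, column digit); the position reached in the input (table
    number capped at 2, row digit, column digit); one bit of the entry if collected, the number of
    separators just read, and the flag that the position is the queried one. *)
Notation SL := ((bool * 'I_2 * 'I_2) * ('I_3 * 'I_2 * 'I_2) *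
                (option 'I_2 * 'I_3 * bool))%type.
Notation sym := (option bool).

Definition o2 (c : bool) : 'I_2 := inord c.

(** The position reached is compared with the queried one digit by digit on the way out; [lk1b]
    writes the outcome into every cell on the way back. *)
Definition lk1f (s : bool) (a : SL * sym) :=
  let: ((b, i, j), (cb, ri, ci), _) := a.1 in
  ([&& s, nat_of_bool b == cb, ri == i & ci == j], a).
Definition lk1b (s : bool) (a : SL * sym) := (s, ((a.1.1, (a.1.2.1, s)), a.2)).

(* [z] counts the separators just read: a single one ends an entry, the second
   in a row ends a row and the third one ends the table. *)
Definition lk2 (s : bool * bool) (a : SL * sym) : (bool * bool) * (SL * sym) :=
  let: (tg, (cb, ri, ci), (o, z, e)) := a.1 in
  match a.2 with
  | Some c => let w := [&& e, ~~ s.1 & o == None] in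
      ((s.1 || w, s.2), ((tg, (cb, ri, ci), (if w then Some (o2 c) else o, ord0, e)), a.2))
  | None =>
    match val z with
    | 0 => ((s.1, (incf s.2 ci).1),
            ((tg, (cb, ri, (incf s.2 ci).2), (o, inord 1, e)), a.2))
    | 1 => ((s.1, (incf s.2 ri).1),
            ((tg, (cb, (incf s.2 ri).2, ord0), (o, inord 2, e)), a.2))
    | _ => (s, ((tg, (inord (minn 2 cb.+1), ord0, ord0), (o, ord0, e)), a.2))
    end
  end.

Definition lk_step (w : seq (SL * sym)) : seq (SL * sym) :=
  (scanf lk2 (false, true) (roundtrip lk1f lk1b true w)).2.

Definition lk_fold (x : seq sym) (u : seq SL) : seq SL :=
  foldl (fun v a => unzip1 (lk_step [seq (t, a) | t <- v])) u x.

Lemma LF_lk_fold : LF lk_fold.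
Proof.
have h : LI true (fun (_ : seq sym) w => lk_step w).
  exact: (LI_comp (LI_scan sym lk1f lk1b true) (LI_scanf sym lk2 (false, true))).
exact: (LI_foldin None h).
Qed.

(* Table number, row, column, bits collected and number of trailing separators. *)
Definition lkst := (nat * nat * nat * seq bool * nat)%type.

Section Stream.
Variables (n : nat) (b : bool) (i j : nat).
Hypotheses (n0 : 0 < n) (li : i < 2 ^ n) (lj : j < 2 ^ n).

Definition lkstr (S : lkst) (e : bool) : seq SL :=
  let: (cb, r, c, o, z) := S in
  mkseq (fun t => ((b, dg i t, dg j t), (inord (minn 2 cb), dg r t, dg c t),
                   (nth None [seq Some (o2 d) | d <- o] t, inord z, e))) n.

Definition hit (cb r c : nat) := [&& nat_of_bool b == cb, r == i & c == j].

(** The intended effect of one letter on numbers instead of digits. The counters wrap modulo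
    [2 ^ n], as strings of [n] digits do. *)
Definition ast (S : lkst) (a : sym) : lkst :=
  let: (cb, r, c, o, z) := S in
  match a with
  | Some d => (cb, r, c, if hit cb r c then rcons o d else o, 0)
  | None => match z with
            | 0 => (cb, r, c.+1 %% 2 ^ n, o, 1)
            | 1 => (cb, r.+1 %% 2 ^ n, 0, o, 2)
            | _ => (cb.+1, 0, 0, o, 0)
            end
  end.

Definition lkok (S : lkst) :=
  let: (cb, r, c, o, z) := S in [&& r < 2 ^ n, c < 2 ^ n & z < 3].

Lemma ast_ok S a : lkok S -> lkok (ast S a).
Proof.
case: S => [[[[cb r] c] o] z] /and3P[lr lc lz].
have p2 : 0 < 2 ^ n by rewrite expn_gt0.
by case: a => [d|]; rewrite /= ?lr ?lc //; case: z lz => [|[|z]] lz; rewrite /= ?lr ?lc ?ltn_mod ?p2.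
Qed.

Lemma map_mkseq (T T' : Type) (f : T -> T') (g : nat -> T) k :
  map f (mkseq g k) = mkseq (fun t => f (g t)) k.
Proof. by rewrite /mkseq -map_comp. Qed.

Lemma lk_round S e a : lkok S ->
  roundtrip lk1f lk1b true [seq (t, a) | t <- lkstr S e] =
  [seq (t, a) | t <- lkstr S (let: (cb, r, c, o, z) := S in hit cb r c)].
Proof.
case: S => [[[[cb r] c] o] z] /and3P[lr lc lz]; rewrite /lkstr !map_mkseq /roundtrip.
set A := fun t => _.
(* The comparison starts from [true] and sees the table number only with the first cell, hence the
   exception at [t == 0]. *)
pose st t := [&& (t == 0) || (nat_of_bool b == cb),
  all (fun t => dg r t == dg i t) (iota 0 t) & all (fun t => dg c t == dg j t) (iota 0 t)].
have cbE : (nat_of_bool b == minn 2 cb) = (nat_of_bool b == cb).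
  by case: (b); apply/eqP/eqP; lia.
have -> : true = st 0 by [].
rewrite (@scanf_traj _ _ lk1f st A A) /= => [|t lt_t]; last first.
  rewrite /lk1f /A /=; congr (_, _).
  rewrite inordK ?ltnS ?geq_minl // cbE /st !all_iotaS /=.
  case: (nat_of_bool b == cb); rewrite ?orbT ?orbF ?andbF //=.
  by rewrite -!andbA; do !bool_congr.
rewrite (scanb_keep (fun s (a : SL * sym) => ((a.1.1, (a.1.2.1, s)), a.2))) /=.
rewrite map_mkseq /st gtn_eqF // !dg_eq //.
Qed.

Lemma lk_step_ok S e a : lkok S -> exists e',
  unzip1 (lk_step [seq (t, a) | t <- lkstr S e]) = lkstr (ast S a) e'.
Proof.
move=> okS; rewrite /lk_step lk_round //.
case: S okS => [[[[cb r] c] o] z] /and3P[lr lc lz]; set h := hit cb r c.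
exists h; rewrite /lkstr !map_mkseq; set Ain := fun t => _.
have fin st' A' : (forall t, t < n -> lk2 (st' t) (Ain t) = (st' t.+1, A' t)) ->
   st' 0 = (false, true) ->
   unzip1 (scanf lk2 (false, true) (mkseq Ain n)).2 = mkseq (fun t => (A' t).1) n.
  by move=> H <-; rewrite (@scanf_traj _ _ _ _ _ A') // /unzip1 map_mkseq.
case: a @Ain fin => [d|] Ain fin.
  pose A' t : SL * sym := (((b, dg i t, dg j t), (inord (minn 2 cb), dg r t, dg c t),
    (nth None [seq Some (o2 d) | d <- if h then rcons o d else o] t, ord0, h)), Some d).
  (* The new bit goes into the first free cell, number [size o]; the state records that this cell
     has been passed, so that the bit is written only once. *)
  rewrite (fin (fun t => (h && (size o < t), true)) A'); last 2 first.
  - move=> t lt_t; rewrite /lk2 /Ain /A' /=.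
    have [lt_o|gt_o|->] := ltngtP t (size o).
    + rewrite (nth_map d) // andbF /= !andbF ltnS leqNgt lt_o /= andbF.
      by case: (h); rewrite ?map_rcons ?nth_rcons ?size_map ?lt_o (nth_map d).
    + rewrite nth_default ?size_map 1?ltnW // ?gt_o ?(leqW gt_o) ?andbT.
      by case: (h) => /=; rewrite nth_default ?size_map ?size_rcons // ltnW.
    + rewrite nth_default ?size_map // ?ltnn ?ltnSn ?leqnn ?andbF /= ?andbT.
      case: (h) => /=; last by rewrite nth_default // size_map.
      by rewrite map_rcons nth_rcons size_map ltnn eqxx.
  - by rewrite ltn0 andbF.
  apply: eq_map => t; rewrite /A' /ast /=; congr (_, _, (_, _, _)).
  by apply/val_inj; rewrite /= inordK.
have i0 : (ord0 : 'I_3) = inord 0 by apply/val_inj; rewrite /= inordK.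
have d0 t : dg 0 t = ord0 by apply/val_inj; rewrite /dg div0n mod0n /= inordK.
case: z lz @Ain fin => [|[|[|//]]] lz Ain fin.
- pose A' t : SL * sym := (((b, dg i t, dg j t), (inord (minn 2 cb), dg r t, dg c.+1 t),
    (nth None [seq Some (o2 d) | d <- o] t, inord 1, h)), None).
  rewrite (fin (fun t => (false, c.+1 %% 2 ^ t == 0)) A') ?modn1 //; last first.
    by move=> t lt_t; rewrite /lk2 /Ain /A' /= inordK //=; have [-> ->] := dg_inc c t.
  by apply/eq_in_map => t; rewrite mem_iota => /andP[_ lt_t]; rewrite /A' /= dg_mod.
- pose A' t : SL * sym := (((b, dg i t, dg j t), (inord (minn 2 cb), dg r.+1 t, ord0),
    (nth None [seq Some (o2 d) | d <- o] t, inord 2, h)), None).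
  rewrite (fin (fun t => (false, r.+1 %% 2 ^ t == 0)) A') ?modn1 //; last first.
    by move=> t lt_t; rewrite /lk2 /Ain /A' /= inordK //=; have [-> ->] := dg_inc r t.
  by apply/eq_in_map => t; rewrite mem_iota => /andP[_ lt_t]; rewrite /A' /= dg_mod // d0.
pose A' t : SL * sym := (((b, dg i t, dg j t), (inord (minn 2 cb.+1), ord0, ord0),
    (nth None [seq Some (o2 d) | d <- o] t, ord0, h)), None).
rewrite (fin (fun t => (false, true)) A') //; last first.
  move=> t lt_t; rewrite /lk2 /Ain /A' /= inordK //= inordK; last by rewrite ltnS geq_minl.
  by congr (_, (_, (inord _, _, _), _, _)); lia.
by apply: eq_map => t; rewrite /A' /ast /= !d0 -i0.
Qed.

Lemma lk_fold_ok S e x : lkok S -> exists e',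
  lk_fold x (lkstr S e) = lkstr (foldl ast S x) e'.
Proof.
elim: x S e => [|a x IH] S e okS; first by exists e.
rewrite /lk_fold !foldl_cons; have [e1 ->] := lk_step_ok e a okS.
exact: IH (ast_ok a okS).
Qed.

Definition bits (k v : nat) : seq bool := [seq odd (v %/ 2 ^ t) | t <- iota 0 (trunc_log 2 k).+1].

Lemma ast_bits cb r c o z s : foldl ast (cb, r, c, o, z) (map Some s) =
  (cb, r, c, if hit cb r c then o ++ s else o, if s is [::] then z else 0).
Proof.
elim: s o z => [|d s IH] o z; first by rewrite /= cats0; case: hit.
rewrite map_cons foldl_cons [ast _ _]/= IH; case: hit; rewrite ?cat_rcons //.
  by case: s {IH}.
by case: s {IH}.
Qed.

Lemma ast_entry cb r c o z k v : c.+1 < 2 ^ n ->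
  foldl ast (cb, r, c, o, z) (encode_entry k v) =
  (cb, r, c.+1, o ++ (if hit cb r c then bits k v else [::]), 1).
Proof.
move=> lc; rewrite /encode_entry -cats1 foldl_cat.
have -> : [seq Some (odd (v %/ 2 ^ t)) | t <- iota 0 (trunc_log 2 k).+1] = map Some (bits k v).
  by rewrite /bits -map_comp.
rewrite ast_bits /= modn_small //.
by case: hit; rewrite ?cats0.
Qed.

Lemma flatten_if1 (K X : eqType) (F : K -> seq X) k0 s : uniq s ->
  flatten [seq if k == k0 then F k else [::] | k <- s] = if k0 \in s then F k0 else [::].
Proof.
elim: s => //= k s IH /andP[ks us]; rewrite IH // inE eq_sym.
by case: eqP => [->|]; rewrite ?(negbTE ks) ?cats0.
Qed.

Section Table.
Variables (k : nat) (T : 'I_k -> 'I_k -> 'I_k).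
Hypotheses (k_gt0 : 0 < k) (k_lt : k < 2 ^ n).

Lemma ast_row cb r o z (row : 'I_k -> 'I_k) : r.+1 < 2 ^ n ->
  foldl ast (cb, r, 0, o, z)
    (rcons (flatten [seq encode_entry k (row l) | l <- enum 'I_k]) None) =
  (cb, r.+1, 0, o ++ flatten [seq if hit cb r (val l) then bits k (row l) else [::] | l <- enum 'I_k], 2).
Proof.
move=> lr; rewrite -cats1 foldl_cat.
suff E : forall s c o z, map val s = iota c (size s) -> c + size s <= k ->
   foldl ast (cb, r, c, o, z) (flatten [seq encode_entry k (row l) | l <- s]) =
   (cb, r, c + size s, o ++ flatten [seq if hit cb r (val l) then bits k (row l) else [::] | l <- s],
    if s is [::] then z else 1).
  rewrite E; last 2 first.
  - by rewrite val_enum_ord size_enum_ord.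
  - by rewrite size_enum_ord.
  have : enum 'I_k != [::] by rewrite -size_eq0 size_enum_ord -lt0n.
  by case: (enum 'I_k) => // l s _; rewrite /= modn_small.
elim=> [|l s IH] c o' z'; first by rewrite addn0 cats0.
case=> lc sE le_k.
have -> : flatten [seq encode_entry k (row l0) | l0 <- l :: s] =
  encode_entry k (row l) ++ flatten [seq encode_entry k (row l0) | l0 <- s] by [].
rewrite foldl_cat ast_entry; last first.
  by apply: leq_ltn_trans k_lt; move: le_k => /=; lia.
rewrite IH //; last by move: le_k => /=; lia.
rewrite /= lc addnS addSn -catA; congr (_, _, _).
by case: (s).
Qed.

Lemma ast_table cb o z :
  foldl ast (cb, 0, 0, o, z) (encode_table T) =
  (cb.+1, 0, 0, o ++ (if nat_of_bool b == cb then
     match insub i, insub j with Some i', Some j' => bits k (T i' j') | _, _ => [::] end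
     else [::]), 0).
Proof.
rewrite /encode_table -cats1 foldl_cat.
suff E : forall s r o z, map val s = iota r (size s) -> r + size s <= k ->
   foldl ast (cb, r, 0, o, z) (flatten [seq rcons (flatten
       [seq encode_entry k (T l l') | l' <- enum 'I_k]) None | l <- s]) =
   (cb, r + size s, 0, o ++ flatten [seq flatten
      [seq if hit cb (val l) (val l') then bits k (T l l') else [::] | l' <- enum 'I_k] | l <- s],
    if s is [::] then z else 2).
  rewrite E; last 2 first.
  - by rewrite val_enum_ord size_enum_ord.
  - by rewrite size_enum_ord.
  have : enum 'I_k != [::] by rewrite -size_eq0 size_enum_ord -lt0n.
  have HE : forall s, flatten [seq flatten
      [seq if hit cb (val l) (val l') then bits k (T l l') else [::] | l' <- enum 'I_k] | l <- s]
    = if nat_of_bool b == cb then flatten [seq flatten [seq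
         if (val l == i) && (val l' == j) then bits k (T l l') else [::] | l' <- enum 'I_k] | l <- s] else [::].
    move=> s; rewrite /hit; case: (nat_of_bool b == cb) => //=.
    by apply: flatten_nil => l; apply: flatten_nil.
  rewrite HE.
  have -> : flatten [seq flatten [seq
         if (val l == i) && (val l' == j) then bits k (T l l') else [::] | l' <- enum 'I_k] | l <- enum 'I_k] =
     match insub i, insub j with Some i', Some j' => bits k (T i' j') | _, _ => [::] end.
    case: insubP => [i' _ iE|ni]; last first.
      apply: flatten_nil => l; apply: flatten_nil => l'.
      have -> // : (val l == i) = false.
      by apply/negbTE; apply: contra ni => /eqP <-; apply: ltn_ord.
    case: insubP => [j' _ jE|nj]; last first.
      apply: flatten_nil => l; apply: flatten_nil => l'.
      have -> : (val l' == j) = false; last by rewrite andbF.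
      by apply/negbTE; apply: contra nj => /eqP <-; apply: ltn_ord.
    transitivity (flatten [seq if l == i' then bits k (T l j') else [::] | l <- enum 'I_k]).
      congr flatten; apply: eq_map => l; rewrite -iE (inj_eq val_inj).
      case: (l == i') => /=; last by elim: (enum _).
      rewrite -jE; transitivity (flatten [seq if l' == j' then bits k (T l l') else [::] | l' <- enum 'I_k]).
        by congr flatten; apply: eq_map => l'; rewrite (inj_eq val_inj).
      by rewrite flatten_if1 ?enum_uniq // mem_enum.
    by rewrite flatten_if1 ?enum_uniq // mem_enum.
  by case: (enum 'I_k).
elim=> [|l s IH] r o' z'; first by rewrite addn0 cats0.
case=> lr sE le_k.
rewrite map_cons [flatten (_ :: _)]/= foldl_cat ast_row; last first.
  by apply: leq_ltn_trans k_lt; move: le_k => /=; lia.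
rewrite IH //; last by move: le_k => /=; lia.
rewrite /= lr addnS addSn -catA; congr (_, _, _).
by case: (s).
Qed.

End Table.
End Stream.

Lemma eq_mkseq_trip (X Y Z : Type) (w : seq (X * Y * Z)) f g h n :
  [seq a.1.1 | a <- w] = mkseq f n -> [seq a.1.2 | a <- w] = mkseq g n ->
  [seq a.2 | a <- w] = mkseq h n -> w = mkseq (fun t => (f t, g t, h t)) n.
Proof.
move=> e1 e2 e3.
have sw : size w = n by rewrite -(size_mkseq f n) -e1 size_map.
apply: (@eq_from_nth _ (f 0, g 0, h 0)); first by rewrite size_mkseq.
move=> t; rewrite sw => lt_t; rewrite nth_mkseq //.
have := congr1 (fun s => nth (f 0) s t) e1; rewrite (nth_map (f 0, g 0, h 0)) ?sw // nth_mkseq //.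
have := congr1 (fun s => nth (g 0) s t) e2; rewrite (nth_map (f 0, g 0, h 0)) ?sw // nth_mkseq //.
have := congr1 (fun s => nth (h 0) s t) e3; rewrite (nth_map (f 0, g 0, h 0)) ?sw // nth_mkseq //.
by case: (nth _ _ _) => [[a b] c] /= -> -> ->.
Qed.

Lemma nseq_mkseq (X : Type) (c : X) n : nseq n c = mkseq (fun=> c) n.
Proof. by rewrite /mkseq; move: 0; elim: n => //= n IH k; rewrite -IH. Qed.

Lemma size_flatten_const (K X : Type) (F : K -> seq X) c s :
  (forall k, size (F k) = c) -> size (flatten (map F s)) = size s * c.
Proof. by move=> Fc; elim: s => //= k s IH; rewrite size_cat Fc IH mulSn. Qed.

Lemma size_encode_table n (T : 'I_n -> 'I_n -> 'I_n) :
  size (encode_table T) = (n * (n * (trunc_log 2 n).+2).+1).+1.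
Proof.
rewrite /encode_table size_rcons (size_flatten_const (c := (n * (trunc_log 2 n).+2).+1)) ?size_enum_ord // => i.
rewrite size_rcons (size_flatten_const (c := (trunc_log 2 n).+2)) ?size_enum_ord // => j.
by rewrite /encode_entry size_rcons size_map size_iota.
Qed.

Notation ML := (bool * 'I_2 * 'I_2 * option 'I_2)%type.

Definition lk_init (a : ML) : SL := (a.1, (ord0, ord0, ord0), (None, ord0, false)).
Definition lookF (x : seq sym) (u : seq ML) : seq ML :=
  [seq (a.1.1, a.2.2.1.1) | a <- zip u (lk_fold x (map lk_init u))].

Lemma LF_lookF : LF lookF.
Proof. exact: (LI_call lk_init (fun a c => (a.1, c.2.1.1)) LF_lk_fold). Qed.

(** A query outside the table collects nothing, whereas every entry is written with at least one
    bit. *)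
Definition validP (x : seq sym) (w : seq (bool * 'I_2 * 'I_2)) : bool :=
  ~~ all (fun a : ML => a.2 == None) (lookF x [seq (a, None) | a <- w]).

Lemma LP_validP : LP validP.
Proof.
have h := LP_comp LF_lookF (LP_not (LP_all sym (fun a : ML => a.2 == None))).
exact: (LP_map (fun a => (a, None) : ML) h).
Qed.

Definition tabop1 n (T : 'I_n -> 'I_n -> 'I_n) (i j : nat) : option nat :=
  match insub i, insub j with Some i', Some j' => Some (val (T i' j')) | _, _ => None end.

Section Pair.
Variables (n m : nat) (T : 'I_n -> 'I_n -> 'I_n) (S : 'I_m -> 'I_m -> 'I_m).
Hypotheses (n_gt0 : 0 < n) (m_gt0 : 0 < m).

Let x := encode_table T ++ encode_table S.

(** The tables alone have [n ^ 2 + m ^ 2] entries. The bound on [n * m] is needed because the walk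
    with [W x] levels takes place in a subgroup of the product of both groups. *)
Lemma W_bounds : [/\ n < 2 ^ W x, m < 2 ^ W x, n * m <= 2 ^ W x,
  trunc_log 2 n < W x & trunc_log 2 m < W x].
Proof.
have lx : size x < 2 ^ W x by apply: trunc_log_ltn.
have : n * n + m * m < size x.
  rewrite size_cat !size_encode_table addnS ltnS; apply: leq_trans (leqnSn _).
  by apply: leq_add; rewrite leq_mul2l ?leqW ?leq_pmulr ?orbT.
move=> sx.
have nx : n <= size x by nia.
have mx : m <= size x by nia.
split; rewrite ?ltnS ?leq_trunc_log //; try lia.
by apply: leq_trans (ltnW lx); nia.
Qed.

Definition tabop (b : bool) (i j : nat) : option nat :=
  if b then tabop1 S i j else tabop1 T i j.

Lemma tabop_lt b i j v : tabop b i j = Some v -> v < if b then m else n.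
Proof.
rewrite /tabop; case: b; rewrite /tabop1; case: insub => // i'; case: insub => // j' [<-];
exact: ltn_ord.
Qed.

Lemma lookF_ok b i j (u : seq ML) : i < 2 ^ W x -> j < 2 ^ W x ->
  [seq a.1.1.1 | a <- u] = nseq (W x) b ->
  [seq a.1.1.2 | a <- u] = digs 1 (W x) i ->
  [seq a.1.2 | a <- u] = digs 1 (W x) j ->
  [seq a.1 | a <- lookF x u] = [seq a.1 | a <- u] /\
  [seq a.2 | a <- lookF x u] = match tabop b i j with
     | Some v => mkseq (fun t => if t < (trunc_log 2 (if b then m else n)).+1
                                 then Some (dg v t) else None) (W x)
     | None => nseq (W x) None end.
Proof.
move=> li lj ub ui uj.
have su : size u = W x by rewrite -(size_nseq (W x) b) -ub size_map.
have uE : [seq a.1 | a <- u] = mkseq (fun t => (b, dg i t, dg j t)) (W x).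
  apply: eq_mkseq_trip; rewrite -map_comp.
  - rewrite [LHS]ub; apply: (@eq_from_nth _ b); rewrite ?size_nseq ?size_mkseq // => t lt_t.
    by rewrite nth_nseq nth_mkseq // lt_t.
  - by rewrite [LHS]ui digs_dg.
  - by rewrite [LHS]uj digs_dg.
have n0 : 0 < W x by [].
have d0 t : dg 0 t = ord0 by apply/val_inj; rewrite /dg div0n mod0n /= inordK.
have i0 : (ord0 : 'I_3) = inord 0 by apply/val_inj; rewrite /= inordK.
have st0 : map lk_init u = lkstr (W x) b i j (0, 0, 0, [::], 0) false.
  have -> : map lk_init u = [seq (a, (ord0, ord0, ord0), (None, ord0, false)) : SL | a <- [seq a.1 | a <- u]].
    by rewrite -map_comp.
  rewrite uE /lkstr map_mkseq; apply: eq_map => t /=.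
  by rewrite nth_nil minn0 -i0 !d0.
have [nW mW _ lnW lmW] := W_bounds.
have [|e' fE] := @lk_fold_ok (W x) b i j n0 li lj (0, 0, 0, [::], 0) false x.
  by rewrite /lkok !expn_gt0.
rewrite -st0 in fE.
have sz : size u = size (lk_fold x (map lk_init u)).
  by rewrite (LI_size LF_lk_fold) // size_map.
split; first by rewrite /lookF -map_comp (mapz1 fst).
rewrite /lookF -map_comp (mapz2 (fun c : SL => c.2.1.1)) // fE.
rewrite /x foldl_cat !ast_table // /lkstr map_mkseq -/x /tabop nseq_mkseq.
have nil_ok k : mkseq (fun t => nth None [seq Some (o2 d) | d <- [::]] t) k
    = mkseq (fun=> None : option 'I_2) k by apply: eq_map => t; rewrite nth_nil.
have bit_ok k v w : mkseq (fun t => nth None [seq Some (o2 d) | d <- bits k v] t) w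
  = mkseq (fun t => if t < (trunc_log 2 k).+1 then Some (dg v t) else None) w.
  apply: eq_map => t; rewrite /bits; case: ltnP => lt_t.
    by rewrite -map_comp (nth_map 0) ?size_iota // nth_iota //= /o2 /dg modn2.
  by rewrite nth_default // !size_map size_iota.
case: b {ub uE st0 fE}; rewrite /tabop1 ?cat0s ?cats0 ?[nat_of_bool _ == _]/=.
  by case: insub => [i'|//]; case: insub => [j'|//]; apply: bit_ok.
by case: insub => [i'|//]; case: insub => [j'|//]; rewrite ?cats0; apply: bit_ok.
Qed.

Lemma lookF_val b i j (u : seq ML) : i < 2 ^ W x -> j < 2 ^ W x ->
  [seq a.1.1.1 | a <- u] = nseq (W x) b ->
  [seq a.1.1.2 | a <- u] = digs 1 (W x) i ->
  [seq a.1.2 | a <- u] = digs 1 (W x) j ->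
  [seq odflt ord0 a.2 | a <- lookF x u] = digs 1 (W x) (odflt 0 (tabop b i j)).
Proof.
move=> li lj ub ui uj; have [_ E] := lookF_ok li lj ub ui uj.
have -> : [seq odflt ord0 a.2 | a <- lookF x u] = map (odflt ord0) [seq a.2 | a <- lookF x u].
  by rewrite -map_comp.
rewrite E; case Et: tabop => [v|]; last by rewrite digs0 map_nseq.
rewrite map_mkseq digs_dg; apply: eq_map => t; case: ltnP => //= le_t.
have lv := tabop_lt Et; apply/val_inj; rewrite /= /dg divn_small ?mod0n ?inordK //.
apply: leq_trans lv _; apply: leq_trans (leq_pexp2l _ le_t) => //.
by apply/ltnW/trunc_log_ltn.
Qed.

Lemma validP_ok b i j w : i < 2 ^ W x -> j < 2 ^ W x ->
  [seq a.1.1 | a <- w] = nseq (W x) b ->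
  [seq a.1.2 | a <- w] = digs 1 (W x) i ->
  [seq a.2 | a <- w] = digs 1 (W x) j ->
  validP x w = (tabop b i j != None).
Proof.
move=> li lj ub ui uj; rewrite /validP.
have [|||_ E] := @lookF_ok b i j [seq (a, None) | a <- w] li lj; rewrite -?map_comp //.
have -> : all (fun a : ML => a.2 == None) (lookF x [seq (a, None) | a <- w])
   = all (pred1 None) [seq a.2 | a <- lookF x [seq (a, None) | a <- w]].
  by rewrite [RHS]all_map; apply: eq_all => a.
rewrite E; case: tabop => [v|]; last by rewrite all_nseq /= ?orbT.
apply/allPn; exists (Some (dg v 0)) => //.
by apply/mapP; exists 0; rewrite ?mem_iota.
Qed.

End Pair.

(** * Walking along universal words *)

Lemma digs_rcons b n j k : k < b.+1 ^ n -> j < b.+1 ->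
  digs b n.+1 (j * b.+1 ^ n + k) = rcons (digs b n k) (inord j).
Proof.
elim: n k => [|n IH] k.
  rewrite expn0 ltnS leqn0 => /eqP -> lj.
  by rewrite muln1 addn0 /digs modn_small.
move=> lk lj; rewrite [LHS]/digs -/(digs b) [digs b n.+1 k]/digs -/(digs b).
have -> : (j * b.+1 ^ n.+1 + k) %/ b.+1 = j * b.+1 ^ n + k %/ b.+1.
  by rewrite expnS mulnCA mulnC divnMDl.
have -> : (j * b.+1 ^ n.+1 + k) %% b.+1 = k %% b.+1.
  by rewrite expnS mulnCA mulnC modnMDl.
rewrite rcons_cons; congr (_ :: _).
by rewrite -IH // ltn_divLR // mulnC -expnS.
Qed.

Lemma digs_all0 b n k : k < b.+1 ^ n -> all (pred1 ord0) (digs b n k) = (k == 0).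
Proof.
move=> lk; apply/idP/eqP => [/all_pred1P h|->]; last by rewrite digs0 all_nseq /= eqxx orbT.
by apply: (@digs_inj b n) => //; rewrite ?expn_gt0 // digs0 h size_digs.
Qed.

Lemma foldl_mapE (X Y Z : Type) (f : Z -> Y -> Z) (g : X -> Y) z s :
  foldl f z (map g s) = foldl (fun z a => f z (g a)) z s.
Proof. by elim: s z => //= a s IH z. Qed.

Lemma rcons_nseq (X : Type) (c : X) n : rcons (nseq n c) c = nseq n.+1 c.
Proof. by elim: n => //= n ->. Qed.

Section Odometer.
Variables (D Q : finType) (V : Type) (m' : nat) (lab : Q -> m'.+1.-tuple D) (H : D -> Q -> Q).
Variables (step : Q -> V -> V) (q0 : Q).
Notation walk := (walk lab H step q0).

Definition upd (l : Q) (j : 'I_m'.+1) (q : Q) : Q := H (tnth (lab l) j) q.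

(* One step of the odometer: the innermost level is stored first, and a level
   moves exactly when all the digits of the levels inside it are zero. *)
Fixpoint tick (l : Q) (z : bool) (w : seq 'I_m'.+1) (s : seq Q) : Q * seq Q :=
  match w, s with
  | j :: w', q :: s' =>
      let r := tick l (z && (j == ord0)) w' s' in
      let q' := if z then upd r.1 j q else q in (q', q' :: r.2)
  | _, _ => (l, [::])
  end.

Lemma size_tick l z w s : size w = size s -> size (tick l z w s).2 = size s.
Proof. by elim: w s z => [|j w IH] [|q s] z //= [/IH ->]. Qed.

Lemma tick_rcons l z w s j q : size w = size s ->
  tick l z (rcons w j) (rcons s q) =
  let q' := if z && all (pred1 ord0) w then upd l j q else q in
  ((tick q' z w s).1, rcons (tick q' z w s).2 q').
Proof.
elim: w s z => [|j' w IH] [|q1 s] z //= => [_|[sw]]; first by rewrite andbT.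
by rewrite IH //= andbA.
Qed.

Lemma size_walk k l z : size z.1 = k -> size (walk k l z).1 = k.
Proof.
elim: k l z => [|k IH] l z //= sz.
elim: (tval (lab l)) z sz => //= e t IHt z sz; apply: IHt => /=.
by rewrite IH //= size_behead sz.
Qed.

Definition tk n l (z : seq Q * V) (k : nat) : seq Q * V :=
  ((tick l true (digs m' n k) z.1).2, step (tick l true (digs m' n k) z.1).1 z.2).

(** The recursion is unrolled into a plain loop: the digits of the tick number tell where each level
    stands in its word, so a counter takes the place of the recursion stack. [rev] reconciles
    innermost-first storage with [walk]. *)
Lemma odometer n l s v : size s = n ->
  foldl (tk n l) (rev s, v) (iota 0 (m'.+1 ^ n)) =
  (rev (walk n l (s, v)).1, (walk n l (s, v)).2).
Proof.
elim: n l s v => [|n IH] l s v ss.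
  by rewrite (size0nil ss).
have e0 : D by have := tnth (lab l) ord0.
pose Fb (z : seq Q * V) e :=
  let q := H e (head q0 z.1) in
  let z' := walk n q (behead z.1, z.2) in (q :: z'.1, z'.2).
suff blk J : J <= m'.+1 ->
  foldl (tk n.+1 l) (rev s, v) (iota 0 (J * m'.+1 ^ n)) =
    (rev (foldl Fb (s, v) (take J (lab l))).1, (foldl Fb (s, v) (take J (lab l))).2) /\
  size (foldl Fb (s, v) (take J (lab l))).1 = n.+1.
  have [] := blk _ (leqnn _); rewrite -expnS => -> _.
  by rewrite take_oversize ?size_tuple.
elim: J => [|J IHJ] leJ; first by rewrite mul0n take0.
have [E sz] := IHJ (ltnW leJ).
rewrite mulSn addnC iotaD foldl_cat add0n E.
rewrite (take_nth e0) ?size_tuple // foldl_rcons.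
move: sz; set z := foldl _ _ (take _ _); case: z {E IHJ} => [[|q s1] v1] //= [ss1].
rewrite size_walk //; split=> //.
rewrite -[J * _]addn0 iotaDl foldl_mapE rev_cons.
set q' := H _ q; have q'E : q' = upd l (inord J) q.
  by rewrite /q' /upd (tnth_nth e0) inordK.
have -> : foldl (fun z a => tk n.+1 l z (J * m'.+1 ^ n + a)) (rcons (rev s1) q, v1) (iota 0 (m'.+1 ^ n))
  = (rcons (foldl (tk n q') (rev s1, v1) (iota 0 (m'.+1 ^ n))).1 q',
     (foldl (tk n q') (rev s1, v1) (iota 0 (m'.+1 ^ n))).2).
  have p0 : 0 < m'.+1 ^ n by rewrite expn_gt0.
  (* Within block [J] the outermost label moves from [q] to [q'] at the first tick only, and at
     every tick, the first included, the inner levels are driven by [q']. *)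
  have step1 s2 v2 q2 k : size s2 = n -> k < m'.+1 ^ n -> q2 = (if k == 0 then q else q') ->
     tk n.+1 l (rcons s2 q2, v2) (J * m'.+1 ^ n + k) =
     (rcons (tk n q' (s2, v2) k).1 q', (tk n q' (s2, v2) k).2).
    move=> ss2 lk q2E; rewrite /tk digs_rcons // tick_rcons ?size_digs //= digs_all0 //.
    by rewrite q2E; case: (k == 0); rewrite -?q'E.
  have szt s2 v2 k : size s2 = n -> size (tk n q' (s2, v2) k).1 = n.
    by move=> ss2; rewrite size_tick ?size_digs.
  have -> : iota 0 (m'.+1 ^ n) = 0 :: iota 1 (m'.+1 ^ n).-1 by case: (m'.+1 ^ n) p0.
  rewrite !foldl_cons step1 ?size_rev //.
  have := szt (rev s1) v1 0; rewrite size_rev => /(_ ss1).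
  case: (tk n q' _ _) => s2 v2 /= ss2.
  have : all (fun k => 0 < k < m'.+1 ^ n) (iota 1 (m'.+1 ^ n).-1).
    by apply/allP => k; rewrite mem_iota => /andP[-> ]; rewrite add1n prednK.
  elim: (iota _ _) s2 v2 ss2 => // k r IHr s2 v2 ss2 /andP[/andP[k0 lk] ar].
  rewrite !foldl_cons step1 ?(gtn_eqF k0) //.
  by case: (tk n q' _ _) (szt s2 v2 k ss2) => s3 v3 ss3; apply: IHr.
by rewrite IH //= rev_cons.
Qed.

End Odometer.

(** * A sweep machine that walks in two tables at once *)

Section WalkMachine.
Variables (r m' : nat) (D Q : finType) (lab : Q -> m'.+1.-tuple D) (H : D -> Q -> Q).
Variables (q0 : Q) (base : Q -> 'I_r.+1).

Notation St := ({ffun 'I_r.+1 -> 'I_2} * {ffun 'I_r.+1 -> 'I_2} * bool)%type.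
Notation Om := (St * (option Q * Q) * (bool * 'I_r.+1) * ('I_2 * 'I_2))%type.
Notation TO := (Om * 'I_m'.+1)%type.

(* A cell holds, for the two tuples, one digit of the index of each generator;
   a label still to be walked ([None] once they are used up, when a step does
   nothing) and the label of its level; a carry mark and the generator being
   emitted; one digit of each of the two current vertices. *)
Definition pst (a : Om) : St := a.1.1.1.
Definition plb (a : Om) : option Q := a.1.1.2.1.
Definition pq (a : Om) : Q := a.1.1.2.2.
Definition pmk (a : Om) : bool := a.1.2.1.
Definition pem (a : Om) : 'I_r.+1 := a.1.2.2.
Definition pv1 (a : Om) : 'I_2 := a.2.1.
Definition pv2 (a : Om) : 'I_2 := a.2.2.
Definition mkO s lb q mk em v1 v2 : Om := (s, (lb, q), (mk, em), (v1, v2)).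

(** The forward sweep marks the levels that move and carries the current top label, stored in the
    first cell, to the outermost level in the last cell. The backward sweep [t1b] then performs
    [tick] from the outermost level inwards. *)
Definition t1f (s : bool * option (option Q)) (a : TO) :=
  ((s.1 && (a.2 == ord0), Some (odflt (plb a.1) s.2)),
   (mkO (pst a.1) (plb a.1) (pq a.1) s.1 (pem a.1) (pv1 a.1) (pv2 a.1), a.2)).
Definition t1b (s : bool * option (option Q)) (a : TO) :=
  if odflt None s.2 is Some l then
    let q' := if pmk a.1 then upd lab H l a.2 (pq a.1) else pq a.1 in
    ((s.1, Some (Some q')),
     (mkO (pst a.1) (plb a.1) q' (pmk a.1) (pem a.1) (pv1 a.1) (pv2 a.1), a.2))
  else (s, a).
Definition setem (e : 'I_r.+1) (a : TO) : TO :=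
  (mkO (pst a.1) (plb a.1) (pq a.1) (pmk a.1) e (pv1 a.1) (pv2 a.1), a.2).
(** Once the labels are used up, generator 0 is emitted, which stands for the identity and leaves
    both vertices in place. *)
Definition emit (a : TO) : 'I_r.+1 := if plb a.1 is Some _ then base (pq a.1) else ord0.
Definition t2 (s : option 'I_r.+1) (a : TO) :=
  (Some (odflt (emit a) s), setem (odflt (emit a) s) a).
Definition get4 (a : TO) : ML := ((false, pv1 a.1, (pst a.1).1.1 (pem a.1)), None).
Definition put4 (a : TO) (c : ML) : TO :=
  (mkO (pst a.1) (plb a.1) (pq a.1) (pmk a.1) (pem a.1)
     (if pem a.1 == ord0 then pv1 a.1 else odflt ord0 c.2) (pv2 a.1), a.2).
Definition get5 (a : TO) : ML := (((pst a.1).2, pv2 a.1, (pst a.1).1.2 (pem a.1)), None).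
Definition put5 (a : TO) (c : ML) : TO :=
  (mkO (pst a.1) (plb a.1) (pq a.1) (pmk a.1) (pem a.1) (pv1 a.1)
     (if pem a.1 == ord0 then pv2 a.1 else odflt ord0 c.2), a.2).
(** Swept backwards, this discards the label just walked: each label moves to the preceding cell and
    [None] enters at the end. *)
Definition shf (s : option Q) (a : Om) :=
  (plb a, mkO (pst a) s (pq a) (pmk a) (pem a) (pv1 a) (pv2 a)).

Definition T1 (w : seq TO) := roundtrip t1f t1b (true, None) w.
Definition T2 (w : seq TO) := (scanf t2 None w).2.
Definition T4 x (w : seq TO) := [seq put4 a.1 a.2 | a <- zip w (lookF x (map get4 w))].
Definition T5 x (w : seq TO) := [seq put5 a.1 a.2 | a <- zip w (lookF x (map get5 w))].
Definition tickF x (w : seq TO) := T5 x (T4 x (T2 (T1 w))).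
Definition topF x (u : seq Om) := (scanb shf None
  (foldl (fun v k => unzip1 (tickF x (zip v (digs m' (W x) k)))) u
         (iota 0 (m'.+1 ^ W x)))).2.

Lemma LF_topF : LF topF.
Proof.
have h1 : LF (fun (_ : seq sym) w => T1 w) := LI_weak false (LI_scan sym t1f t1b (true, None)).
have h2 : LF (fun (_ : seq sym) w => T2 w) := LI_weak false (LI_scanf sym t2 None).
have h4 : LF T4 := LI_call get4 put4 LF_lookF.
have h5 : LF T5 := LI_call get5 put5 LF_lookF.
have h := LI_foldstr (LI_comp h1 (LI_comp h2 (LI_comp h4 h5))).
exact: LI_comp h (LI_weak false (LI_scanb sym shf None)).
Qed.

Definition rst1 (a : TO) := (pst a.1, plb a.1, (pv1 a.1, pv2 a.1), a.2).

Lemma T1_lab l z w :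
  let s1 := scanf t1f (z, Some (Some l)) w in
  let s2 := scanb t1b s1.1 s1.2 in
  let r := tick lab H l z [seq a.2 | a <- w] [seq pq a.1 | a <- w] in
  [/\ s1.1.2 = Some (Some l), s2.1.2 = Some (Some r.1),
      [seq pq a.1 | a <- s2.2] = r.2 & map rst1 s2.2 = map rst1 w].
Proof.
elim: w z => [|a w IH] z //=.
have [e1 e2 e3 e4] := IH (z && (a.2 == ord0)).
move: e1 e2 e3 e4; set s2 := scanb t1b _ _; move=> e1 e2 e3 e4.
by rewrite /t1b e2 /= e1 e3 e4.
Qed.

Lemma T1_nolab w z :
  let s1 := scanf t1f (z, Some None) w in
  let s2 := scanb t1b s1.1 s1.2 in
  [/\ s1.1.2 = Some None, s2.1.2 = Some None,
      [seq pq a.1 | a <- s2.2] = [seq pq a.1 | a <- w] & map rst1 s2.2 = map rst1 w].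
Proof.
elim: w z => [|a w IH] z //=.
have [e1 e2 e3 e4] := IH (z && (a.2 == ord0)).
move: e1 e2 e3 e4; set s2 := scanb t1b _ _; move=> e1 e2 e3 e4.
by rewrite /t1b e2 /= e1 e3 e4.
Qed.

Lemma T1_head a w : T1 (a :: w) =
  (let s1 := scanf t1f (true, Some (plb a.1)) (a :: w) in scanb t1b s1.1 s1.2).2.
Proof. by []. Qed.

Lemma T2_head a w : T2 (a :: w) = map (setem (emit a)) (a :: w).
Proof.
rewrite /T2 /=; congr (_ :: _).
by elim: w => //= a' w ->.
Qed.

(** Both walks start at the element of index 0, which need not be the identity. A walk returns to
    index 0 exactly when the product of its generators is 1, so the identity never has to be located
    in the table. *)
Definition mk0 (a : St * (Q * Q)) : Om := mkO a.1 (Some a.2.1) a.2.2 false ord0 ord0 ord0.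

Section Sem.
Variables (n m : nat) (T : 'I_n -> 'I_n -> 'I_n) (S : 'I_m -> 'I_m -> 'I_m).
Hypotheses (n_gt0 : 0 < n) (m_gt0 : 0 < m).
Let x := encode_table T ++ encode_table S.
Variables (c : seq St) (b : bool) (Lv Rv : 'I_r.+1 -> nat).
Hypothesis cb : [seq a.2 | a <- c] = nseq (W x) b.
Hypothesis cL : forall i, [seq a.1.1 i | a : St <- c] = digs 1 (W x) (Lv i).
Hypothesis cR : forall i, [seq a.1.2 i | a : St <- c] = digs 1 (W x) (Rv i).
Hypothesis Lv_lt : forall i, Lv i < 2 ^ W x.
Hypothesis Rv_lt : forall i, Rv i < 2 ^ W x.

Definition vm (b : bool) (v : nat) (i : 'I_r.+1) (w : nat) : nat :=
  if i == ord0 then v else odflt 0 (tabop T S b v w).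
Definition avstep (l : Q) (v : nat * nat) : nat * nat :=
  (vm false v.1 (base l) (Lv (base l)), vm b v.2 (base l) (Rv (base l))).

Lemma vm_lt b' v i w : v < 2 ^ W x -> vm b' v i w < 2 ^ W x.
Proof.
move=> lv; rewrite /vm; case: ifP => // _.
case E: tabop => [k|] /=; last by rewrite expn_gt0.
have [nW mW _ _ _] := W_bounds T S n_gt0 m_gt0.
by apply: leq_trans (tabop_lt E) _; case: (b'); apply: ltnW.
Qed.

Lemma T4_ok e v w : v < 2 ^ W x -> [seq pst a.1 | a <- w] = c ->
  [seq pv1 a.1 | a <- w] = digs 1 (W x) v -> all (fun a => pem a.1 == e) w ->
  [/\ [seq pv1 a.1 | a <- T4 x w] = digs 1 (W x) (vm false v e (Lv e)),
      [seq pv2 a.1 | a <- T4 x w] = [seq pv2 a.1 | a <- w],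
      [seq (pst a.1, plb a.1, pq a.1, a.2) | a <- T4 x w] =
      [seq (pst a.1, plb a.1, pq a.1, a.2) | a <- w]
    & all (fun a => pem a.1 == e) (T4 x w)].
Proof.
move=> lv wc wv we.
have sw : size w = W x by rewrite -(size_digs 1 (W x) v) -wv size_map.
have sz : size w = size (lookF x (map get4 w)) by rewrite (LI_size LF_lookF) // size_map.
have gv : [seq odflt ord0 a.2 | a <- lookF x (map get4 w)]
    = digs 1 (W x) (odflt 0 (tabop T S false v (Lv e))).
  apply: lookF_val; rewrite -?map_comp //.
    by rewrite (@map_nseqE _ _ _ false) ?sw.
  rewrite -cL -wc -map_comp; apply/eq_in_map => a aw /=.
  by rewrite (eqP (allP we _ aw)).
split.
- rewrite /T4 -map_comp /vm; case: eqP => [e0|ne].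
    rewrite -wv -(mapz1 (fun a : TO => pv1 a.1) sz); apply/eq_in_map => a az /=.
    have aw : a.1 \in w by rewrite -(unzip1_zip (eq_leq sz)); apply: map_f.
    by rewrite (eqP (allP we _ aw)) e0 eqxx.
  rewrite -gv -(mapz2 (fun a : ML => odflt ord0 a.2) sz); apply/eq_in_map => a az /=.
  have aw : a.1 \in w by rewrite -(unzip1_zip (eq_leq sz)); apply: map_f.
  by rewrite (eqP (allP we _ aw)); case: eqP ne.
- by rewrite /T4 -map_comp (mapz1 (fun a : TO => pv2 a.1)).
- by rewrite /T4 -map_comp (mapz1 (fun a : TO => (pst a.1, plb a.1, pq a.1, a.2))).
rewrite /T4 all_map; apply/allP => a az /=.
have aw : a.1 \in w by rewrite -(unzip1_zip (eq_leq sz)); apply: map_f.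
exact: (allP we _ aw).
Qed.

Lemma T5_ok e v w : v < 2 ^ W x -> [seq pst a.1 | a <- w] = c ->
  [seq pv2 a.1 | a <- w] = digs 1 (W x) v -> all (fun a => pem a.1 == e) w ->
  [/\ [seq pv2 a.1 | a <- T5 x w] = digs 1 (W x) (vm b v e (Rv e)),
      [seq pv1 a.1 | a <- T5 x w] = [seq pv1 a.1 | a <- w]
    & [seq (pst a.1, plb a.1, pq a.1, a.2) | a <- T5 x w] =
      [seq (pst a.1, plb a.1, pq a.1, a.2) | a <- w]].
Proof.
move=> lv wc wv we.
have sw : size w = W x by rewrite -(size_digs 1 (W x) v) -wv size_map.
have sz : size w = size (lookF x (map get5 w)) by rewrite (LI_size LF_lookF) // size_map.
have gv : [seq odflt ord0 a.2 | a <- lookF x (map get5 w)]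
    = digs 1 (W x) (odflt 0 (tabop T S b v (Rv e))).
  apply: lookF_val; rewrite -?map_comp //.
    by rewrite -cb -wc -map_comp.
  rewrite -cR -wc -map_comp; apply/eq_in_map => a aw /=.
  by rewrite (eqP (allP we _ aw)).
split.
- rewrite /T5 -map_comp /vm; case: eqP => [e0|ne].
    rewrite -wv -(mapz1 (fun a : TO => pv2 a.1) sz); apply/eq_in_map => a az /=.
    have aw : a.1 \in w by rewrite -(unzip1_zip (eq_leq sz)); apply: map_f.
    by rewrite (eqP (allP we _ aw)) e0 eqxx.
  rewrite -gv -(mapz2 (fun a : ML => odflt ord0 a.2) sz); apply/eq_in_map => a az /=.
  have aw : a.1 \in w by rewrite -(unzip1_zip (eq_leq sz)); apply: map_f.
  by rewrite (eqP (allP we _ aw)); case: eqP ne.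
- by rewrite /T5 -map_comp (mapz1 (fun a : TO => pv1 a.1)).
by rewrite /T5 -map_comp (mapz1 (fun a : TO => (pst a.1, plb a.1, pq a.1, a.2))).
Qed.

Definition Inv (lbs : seq (option Q)) (qs : seq Q) (v : nat * nat) (u : seq Om) :=
  [/\ map pst u = c, map plb u = lbs, map pq u = qs,
      map pv1 u = digs 1 (W x) v.1 & map pv2 u = digs 1 (W x) v.2].

Lemma Inv_size lbs qs v u : Inv lbs qs v u -> size u = W x.
Proof. by case=> _ _ _ h _; rewrite -(size_digs 1 (W x) v.1) -h size_map. Qed.

Lemma tickF_ok w lbs v e qs' : v.1 < 2 ^ W x -> v.2 < 2 ^ W x ->
  [seq pst a.1 | a <- w] = c -> [seq plb a.1 | a <- w] = lbs ->
  [seq pv1 a.1 | a <- w] = digs 1 (W x) v.1 -> [seq pv2 a.1 | a <- w] = digs 1 (W x) v.2 ->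
  map rst1 (T1 w) = map rst1 w -> [seq pq a.1 | a <- T1 w] = qs' ->
  (forall a w0, T1 w = a :: w0 -> emit a = e) ->
  Inv lbs qs' (vm false v.1 e (Lv e), vm b v.2 e (Rv e)) (unzip1 (tickF x w)).
Proof.
move=> lv1 lv2 wc wl wv1 wv2 r1 q1 he; rewrite /tickF.
have pr (X : Type) (f : _ -> X) : [seq f (rst1 a) | a <- T1 w] = [seq f (rst1 a) | a <- w].
  by have := congr1 (map f) r1; rewrite -!map_comp.
have E2 : T2 (T1 w) = map (setem e) (T1 w).
  by case E: (T1 w) he => [|a w0] // /(_ _ _ erefl) <-; rewrite T2_head.
rewrite E2; set w2 := map (setem e) _.
have c2 : [seq pst a.1 | a <- w2] = c by rewrite -map_comp -wc; apply: (pr _ (fun a => a.1.1.1)).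
have l2 : [seq plb a.1 | a <- w2] = lbs by rewrite -map_comp -wl; apply: (pr _ (fun a => a.1.1.2)).
have q2 : [seq pq a.1 | a <- w2] = qs' by rewrite -map_comp -q1.
have v12 : [seq pv1 a.1 | a <- w2] = digs 1 (W x) v.1.
  by rewrite -map_comp -wv1; apply: (pr _ (fun a => a.1.2.1)).
have v22 : [seq pv2 a.1 | a <- w2] = digs 1 (W x) v.2.
  by rewrite -map_comp -wv2; apply: (pr _ (fun a => a.1.2.2)).
have e2 : all (fun a => pem a.1 == e) w2 by rewrite all_map; apply/allP => a _ /=.
have [h1 h2 h3 h4] := T4_ok lv1 c2 v12 e2.
have pr4 (X : Type) (f : _ -> X) : [seq f (pst a.1, plb a.1, pq a.1, a.2) | a <- T4 x w2] =
   [seq f (pst a.1, plb a.1, pq a.1, a.2) | a <- w2].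
  by have := congr1 (map f) h3; rewrite -!map_comp.
have c4 : [seq pst a.1 | a <- T4 x w2] = c by rewrite -c2; apply: (pr4 _ (fun a => a.1.1.1)).
have v24 : [seq pv2 a.1 | a <- T4 x w2] = digs 1 (W x) v.2 by rewrite h2.
have [g1 g2 g3] := T5_ok lv2 c4 v24 h4.
have pr5 (X : Type) (f : _ -> X) : [seq f (pst a.1, plb a.1, pq a.1, a.2) | a <- T5 x (T4 x w2)] =
   [seq f (pst a.1, plb a.1, pq a.1, a.2) | a <- T4 x w2].
  by have := congr1 (map f) g3; rewrite -!map_comp.
split; rewrite /unzip1 -map_comp.
- by rewrite -c4; apply: (pr5 _ (fun a => a.1.1.1)).
- by rewrite -l2 -(pr4 _ (fun a => a.1.1.2)); apply: (pr5 _ (fun a => a.1.1.2)).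
- by rewrite -q2 -(pr4 _ (fun a => a.1.2)); apply: (pr5 _ (fun a => a.1.2)).
- by rewrite -h1 -g2.
- by rewrite -g1.
Qed.

Lemma zip_proj u ds : size u = size ds ->
  (forall (X : Type) (f : Om -> X), [seq f a.1 | a <- zip u ds] = map f u) /\
  [seq a.2 | a : TO <- zip u ds] = ds.
Proof.
move=> sz; split=> [X f|]; first exact: mapz1.
by rewrite (mapz2 id) // map_id.
Qed.

Lemma tick_lab l lbs qs v u k : v.1 < 2 ^ W x -> v.2 < 2 ^ W x ->
  Inv (Some l :: lbs) qs v u ->
  Inv (Some l :: lbs) (tk lab H avstep (W x) l (qs, v) k).1 (tk lab H avstep (W x) l (qs, v) k).2
    (unzip1 (tickF x (zip u (digs m' (W x) k)))).
Proof.
move=> lv1 lv2 iu; have su := Inv_size iu.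
have szd : size u = size (digs m' (W x) k) by rewrite size_digs.
have [p1 p2] := zip_proj szd.
set ds := digs m' (W x) k in szd p1 p2 *; case: iu => uc ul uq u1 u2.
have ww : exists a0 w0, zip u ds = a0 :: w0 /\ plb a0.1 = Some l.
  by case: (u) (ds) szd ul => [|a u'] [|d ds'] //= _ [e _]; exists (a, d), (zip u' ds').
case: ww => a0 [w0 [wE la]].
have [_ _ q1 r1] := T1_lab l true (zip u ds).
rewrite wE -la -T1_head -wE p2 (p1 _ pq) uq in q1; rewrite wE -la -T1_head -wE in r1.
apply: (tickF_ok lv1 lv2 _ _ _ _ r1 q1); rewrite ?(p1 _ pst) ?(p1 _ plb) ?(p1 _ pv1) ?(p1 _ pv2) //.
move=> a w' T1E.
have : plb a.1 = Some l.
  have := congr1 (map (fun z => z.1.1.2)) r1; rewrite T1E wE -!map_comp /= => -[-> _].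
  exact: la.
rewrite /emit => ->; congr base.
have := q1; rewrite T1E /=; rewrite /ds -uq.
case: (u) (digs m' (W x) k) szd => [|a1 u'] d'; first by case: d'.
by case: d' => [|d1 d'] //= _ [-> _].
Qed.

Lemma tick_nolab lbs qs v u k : v.1 < 2 ^ W x -> v.2 < 2 ^ W x ->
  Inv (None :: lbs) qs v u ->
  Inv (None :: lbs) qs v (unzip1 (tickF x (zip u (digs m' (W x) k)))).
Proof.
move=> lv1 lv2 iu; have su := Inv_size iu.
have szd : size u = size (digs m' (W x) k) by rewrite size_digs.
have [p1 p2] := zip_proj szd.
set ds := digs m' (W x) k in szd p1 p2 *; case: iu => uc ul uq u1 u2.
have ww : exists a0 w0, zip u ds = a0 :: w0 /\ plb a0.1 = None.
  by case: (u) (ds) szd ul => [|a u'] [|d ds'] //= _ [e _]; exists (a, d), (zip u' ds').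
case: ww => a0 [w0 [wE la]].
have [_ _ q1 r1] := T1_nolab (zip u ds) true.
rewrite wE -la -T1_head -wE (p1 _ pq) uq in q1; rewrite wE -la -T1_head -wE in r1.
have -> : v = (vm false v.1 ord0 (Lv ord0), vm b v.2 ord0 (Rv ord0)).
  by rewrite /vm eqxx -surjective_pairing.
apply: (tickF_ok lv1 lv2 _ _ _ _ r1 q1); rewrite ?(p1 _ pst) ?(p1 _ plb) ?(p1 _ pv1) ?(p1 _ pv2) //.
move=> a w' T1E; rewrite /emit.
have := congr1 (map (fun z => z.1.1.2)) r1; rewrite T1E wE -!map_comp /= => -[-> _].
by rewrite la.
Qed.

Lemma shf_ok l lbs qs v u : Inv (l :: lbs) qs v u ->
  Inv (rcons lbs None) qs v (scanb shf None u).2.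
Proof.
case=> uc ul uq u1 u2.
have E : [/\ (scanb shf None u).1 = head None (map plb u),
   map plb (scanb shf None u).2 = behead (rcons (map plb u) None) &
   [seq (pst a, pq a, (pv1 a, pv2 a)) | a <- (scanb shf None u).2] =
   [seq (pst a, pq a, (pv1 a, pv2 a)) | a <- u]].
  elim: (u) => //= a u' [e1 e2 e3]; rewrite e1 e2 e3; split=> //.
  by case: (u').
case: E => _ e2 e3.
have pr (X : Type) (f : _ -> X) := congr1 (map f) e3.
split.
- by have := pr _ (fun a => a.1.1); rewrite -!map_comp -uc.
- by rewrite e2 ul.
- by have := pr _ (fun a => a.1.2); rewrite -!map_comp -uq.
- by have := pr _ (fun a => a.2.1); rewrite -!map_comp -u1.
- by have := pr _ (fun a => a.2.2); rewrite -!map_comp -u2.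
Qed.

Definition wlk := walk lab H avstep q0 (W x).

Lemma walk_lt k l z : (z.2 : nat * nat).1 < 2 ^ W x -> z.2.2 < 2 ^ W x ->
  let z' := walk lab H avstep q0 k l z in z'.2.1 < 2 ^ W x /\ z'.2.2 < 2 ^ W x.
Proof.
elim: k l z => [|k IH] l z l1 l2 /=; first by split; apply: vm_lt.
elim: (tval (lab l)) z l1 l2 => //= e t IHt z l1 l2.
by have [h1 h2] := IH (H e (head q0 z.1)) (behead z.1, z.2) l1 l2; apply: IHt.
Qed.

Lemma topF_lab l lbs s v u : size s = W x -> v.1 < 2 ^ W x -> v.2 < 2 ^ W x ->
  Inv (Some l :: lbs) (rev s) v u ->
  Inv (rcons lbs None) (rev (wlk l (s, v)).1) (wlk l (s, v)).2 (topF x u).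
Proof.
move=> ss lv1 lv2 iu; apply: (@shf_ok (Some l)).
have := odometer lab H avstep q0 l v ss; rewrite -/wlk.
suff fold ks z u' : (z.2 : nat * nat).1 < 2 ^ W x -> z.2.2 < 2 ^ W x ->
   Inv (Some l :: lbs) z.1 z.2 u' ->
   Inv (Some l :: lbs) (foldl (tk lab H avstep (W x) l) z ks).1 (foldl (tk lab H avstep (W x) l) z ks).2
     (foldl (fun v k => unzip1 (tickF x (zip v (digs m' (W x) k)))) u' ks).
  by move=> E; have := fold (iota 0 (m'.+1 ^ W x)) (rev s, v) u lv1 lv2 iu; rewrite E.
elim: ks z u' => // k ks IH z u' l1 l2 iu'; rewrite !foldl_cons.
apply: IH; try exact: vm_lt.
by case: z l1 l2 iu' => qs v' l1 l2 iu'; apply: tick_lab.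
Qed.

Lemma topF_nolab lbs qs v u : v.1 < 2 ^ W x -> v.2 < 2 ^ W x ->
  Inv (None :: lbs) qs v u -> Inv (rcons lbs None) qs v (topF x u).
Proof.
move=> lv1 lv2 iu; apply: (@shf_ok None).
elim: (iota _ _) u iu => // k ks IH u iu; rewrite foldl_cons.
by apply: IH; apply: tick_nolab.
Qed.

Lemma top_iter ls k s v u : size s = W x -> v.1 < 2 ^ W x -> v.2 < 2 ^ W x ->
  k + size ls = W x -> 
  Inv (map Some ls ++ nseq k None) (rev s) v u ->
  let z := foldl (fun z l => wlk l z) (s, v) ls in
  Inv (nseq (W x) None) (rev z.1) z.2 (iter (size ls) (topF x) u).
Proof.
elim: ls k s v u => [|l ls IH] k s v u ss l1 l2 sk iu.
  by rewrite addn0 in sk; rewrite sk in iu.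
rewrite foldl_cons [size _]/= iterSr.
have [w1 w2] := walk_lt (W x) l (z := (s, v)) l1 l2.
have sw : size (wlk l (s, v)).1 = W x by apply: size_walk.
have := topF_lab ss l1 l2 iu; rewrite -/wlk in w1 w2 *.
case: (wlk l (s, v)) w1 w2 sw => s' v' w1 w2 sw iu'.
apply: (IH k.+1) => //; first by rewrite addSnnS.
by move: iu'; rewrite -cats1 -catA cats1 -rcons_nseq.
Qed.

Lemma top_idle j qs v u : v.1 < 2 ^ W x -> v.2 < 2 ^ W x ->
  Inv (nseq (W x) None) qs v u -> Inv (nseq (W x) None) qs v (iter j (topF x) u).
Proof.
move=> l1 l2 iu; elim: j => // j IH; rewrite iterS.
have e1 : nseq (W x) (None : option Q) = None :: nseq (W x).-1 None by [].
have e2 : nseq (W x) (None : option Q) = rcons (nseq (W x).-1 None) None by rewrite rcons_nseq.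
by rewrite e1 in IH; rewrite e2; apply: topF_nolab.
Qed.

Lemma fold_wlk_lt ls z : (z.2 : nat * nat).1 < 2 ^ W x -> z.2.2 < 2 ^ W x ->
  let z' := foldl (fun z l => wlk l z) z ls in z'.2.1 < 2 ^ W x /\ z'.2.2 < 2 ^ W x.
Proof.
elim: ls z => // l ls IH z l1 l2 /=.
by have [h1 h2] := walk_lt (W x) l l1 l2; apply: IH.
Qed.

Lemma run_ok qs ls : size qs = W x -> size ls = W x ->
  let z := foldl (fun z l => wlk l z) (qs, (0, 0)) ls in
  let u := iter (2 ^ W x) (topF x) (map mk0 (zip c (zip ls (rev qs)))) in
  all (fun a => pv1 a == ord0) u = (z.2.1 == 0) /\
  all (fun a => pv2 a == ord0) u = (z.2.2 == 0).
Proof.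
move=> sq sl z u.
have p0 : 0 < 2 ^ W x by rewrite expn_gt0.
have sc : size c = W x by rewrite -(size_nseq (W x) b) -cb size_map.
have sr : size ls = size (rev qs) by rewrite size_rev sq.
have s2 : size c = size (zip ls (rev qs)) by rewrite size_zip -sr minnn sl.
have i0 : Inv (map Some ls ++ nseq 0 None) (rev qs) (0, 0) (map mk0 (zip c (zip ls (rev qs)))).
  split; rewrite -map_comp.
  - by rewrite (mapz1 id) // map_id.
  - by rewrite cats0 (mapz2 (fun p : Q * Q => Some p.1)) // (mapz1 Some).
  - by rewrite (mapz2 (fun p : Q * Q => p.2)) // (mapz2 id) // map_id.
  - by rewrite (@map_nseqE _ _ _ ord0) // size_zip -s2 minnn sc digs0.
  - by rewrite (@map_nseqE _ _ _ ord0) // size_zip -s2 minnn sc digs0.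
have i1 := top_iter (k := 0) (v := (0, 0)) sq p0 p0 sl i0.
have [l1 l2] := fold_wlk_lt ls (z := (qs, (0, 0))) p0 p0.
have : Inv (nseq (W x) None) (rev z.1) z.2 u.
  (* [LF_iter] repeats a body an exponential number of times in [W x]; there are only [W x] labels,
     and the surplus rounds are idle. *)
  have E : 2 ^ W x = 2 ^ W x - W x + size ls by rewrite sl subnK // ltnW // ltn_expl.
  by rewrite /u [in iter _]E iterD; apply: top_idle.
case=> _ _ _ u1 u2.
have -> : all (fun a => pv1 a == ord0) u = all (pred1 ord0) (map pv1 u) by rewrite all_map.
have -> : all (fun a => pv2 a == ord0) u = all (pred1 ord0) (map pv2 u) by rewrite all_map.
by rewrite u1 u2 !digs_all0.
Qed.

End Sem.

Definition matchP (x : seq sym) (c : seq St) : bool :=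
  all (fun w =>
    let u := iter (2 ^ W x) (topF x) (map mk0 (zip c w)) in
    all (fun a => pv1 a == ord0) u == all (fun a => pv2 a == ord0) u)
  (strs (q0, q0) (W x)).

Lemma LP_matchP : LP matchP.
Proof.
have h1 := LP_eqb (LP_all sym (fun a => pv1 a == ord0)) (LP_all sym (fun a => pv2 a == ord0)).
have h2 := LP_map mk0 (LP_comp (LF_iter 1 LF_topF) h1).
by apply: LP_ext (LP_forall (q0, q0) h2) => x c _.
Qed.

Lemma matchP_ok n m (T : 'I_n -> 'I_n -> 'I_n) (S : 'I_m -> 'I_m -> 'I_m)
    (x := encode_table T ++ encode_table S) c b Lv Rv :
  0 < n -> 0 < m ->
  [seq a.2 | a <- c] = nseq (W x) b ->
  (forall i, [seq a.1.1 i | a : St <- c] = digs 1 (W x) (Lv i)) ->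
  (forall i, [seq a.1.2 i | a : St <- c] = digs 1 (W x) (Rv i)) ->
  (forall i, Lv i < 2 ^ W x) -> (forall i, Rv i < 2 ^ W x) ->
  matchP x c <-> (forall qs ls, size qs = W x -> size ls = W x ->
     let z := foldl (fun z l => walk lab H (avstep T S b Lv Rv) q0 (W x) l z) (qs, (0, 0)) ls in
     (z.2.1 == 0) = (z.2.2 == 0)).
Proof.
move=> n0 m0 cb cL cR lL lR; split=> [/allP mP qs ls sq sl|h].
  have := mP (zip ls (rev qs)); rewrite mem_strs size_zip size_rev sq sl minnn eqxx => /(_ isT).
  have [e1 e2] := run_ok n0 m0 cb cL cR lL lR sq sl; rewrite -/x in e1 e2.
  by cbv zeta beta; rewrite e1 e2 => /eqP.
apply/allP => w; rewrite mem_strs => /eqP sw.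
have sq : size (rev (unzip2 w)) = W x by rewrite size_rev size_map.
have sl : size (unzip1 w) = W x by rewrite size_map.
have [e1 e2] := run_ok n0 m0 cb cL cR lL lR sq sl; rewrite -/x revK zip_unzip in e1 e2.
by cbv zeta beta; rewrite e1 e2; apply/eqP/(h _ _ sq sl).
Qed.

End WalkMachine.

(** * Words and marked isomorphism *)

Section Words.
Variable k : nat.

(** The identity is added as generator 0, as [universal_words] demands. *)
Definition ext1 (gT : finGroupType) (t : k.-tuple gT) (i : 'I_k.+1) : gT :=
  if unlift ord0 i is Some j then tnth t j else 1%g.

Definition evt (gT : finGroupType) (t : k.-tuple gT) (w : seq 'I_k) : gT :=
  (\prod_(i <- w) tnth t i)%g.

Definition pairs (gT hT : finGroupType) (t : k.-tuple gT) (u : k.-tuple hT) :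
    {set gT * hT} := <<[set (ext1 t i, ext1 u i) | i : 'I_k.+1]>>%g.

Lemma pair_evt (gT hT : finGroupType) (t : k.-tuple gT) (u : k.-tuple hT) w :
  (evt t w, evt u w) \in pairs t u.
Proof.
rewrite /evt; elim: w => [|i w IH]; first by rewrite !big_nil group1.
rewrite !big_cons; apply: (groupM (x := (tnth t i, tnth u i)) _ IH).
apply: mem_gen; apply/imsetP; exists (lift ord0 i) => //.
by rewrite /ext1 liftK.
Qed.

Lemma pairs_evt (gT hT : finGroupType) (t : k.-tuple gT) (u : k.-tuple hT) p :
  p \in pairs t u -> exists w, p = (evt t w, evt u w).
Proof.
case/gen_prodgP => n [c cA ->]; elim: n c cA => [|n IH] c cA.
  by exists [::]; rewrite big_ord0 /evt !big_nil.
rewrite big_ord_recl; have [w ->] := IH (fun i => c (lift ord0 i)) (fun i => cA _).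
have /imsetP[i _ ->] := cA ord0; rewrite /ext1.
case: unliftP => [j _|_]; last by exists w; rewrite mul1g.
by exists (j :: w); rewrite /evt !big_cons.
Qed.

Lemma gen_evt (gT : finGroupType) (t : k.-tuple gT) x :
  x \in <<[set y in t]>>%g -> exists w, x = evt t w.
Proof.
case/gen_prodgP => n [c cA ->]; elim: n c cA => [|n IH] c cA.
  by exists [::]; rewrite big_ord0 /evt big_nil.
rewrite big_ord_recl; have [w ->] := IH (fun i => c (lift ord0 i)) (fun i => cA _).
by have := cA ord0; rewrite inE => /tnthP[i ->]; exists (i :: w); rewrite /evt big_cons.
Qed.

Lemma evt_gen (gT : finGroupType) (t : k.-tuple gT) w : evt t w \in <<[set y in t]>>%g.
Proof. by apply: group_prod => i _; rewrite mem_gen // inE mem_tnth. Qed.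

Lemma evt_inv (gT hT : finGroupType) (t : k.-tuple gT) (u : k.-tuple hT) w :
  exists w', evt t w' = (evt t w)^-1%g /\ evt u w' = (evt u w)^-1%g.
Proof.
have : (evt t w, evt u w)^-1%g \in pairs t u by rewrite groupV pair_evt.
by case/pairs_evt => w' [-> ->]; exists w'.
Qed.

(** If the same words are trivial at [t] and at [u], then [pairs t u] is the graph of the required
    isomorphism. Words without inverse letters suffice, since the groups are finite. *)
Lemma marked_isog_evt (gT hT : finGroupType) (t : k.-tuple gT) (u : k.-tuple hT) :
  marked_isog t u <-> forall w, (evt t w == 1%g) = (evt u w == 1%g).
Proof.
split=> [/marked_isogP[f [injf _ ft]] w|h].
  have <- : f (evt t w) = evt u w.
    rewrite /evt morph_prod => [|i _]; last by rewrite mem_gen // inE mem_tnth.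
    by apply: eq_bigr => i _.
  by rewrite morph_injm_eq1 // evt_gen.
have evM (kT : finGroupType) (s : k.-tuple kT) w w' : evt s (w ++ w') = (evt s w * evt s w')%g.
  by rewrite /evt big_cat.
have inj w w' : (evt t w == evt t w') = (evt u w == evt u w').
  have [v [v1 v2]] := evt_inv t u w'.
  by have := h (w ++ v); rewrite !evM v1 v2 -!eq_mulgV1.
pose f x : hT := if [pick p in pairs t u | p.1 == x] is Some p then p.2 else 1%g.
have fE w : f (evt t w) = evt u w.
  rewrite /f; case: pickP => [p /andP[/pairs_evt[w' ->] /= ]|/(_ (evt t w, evt u w))].
    by rewrite inj => /eqP.
  by rewrite pair_evt eqxx.
have fM : {in <<[set x in t]>>%g &, {morph f : x y / (x * y)%g}}.
  move=> x y /gen_evt[w ->] /gen_evt[w' ->].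
  by rewrite -evM !fE evM.
apply/marked_isogP; exists (Morphism fM).
have ft i : f (tnth t i) = tnth u i.
  by have := fE [:: i]; rewrite /evt !big_seq1.
split=> //=.
- apply/injmP => x y /gen_evt[w ->] /gen_evt[w' ->] /=; rewrite !fE => /eqP.
  by rewrite -inj => /eqP.
rewrite morphim_gen; last exact: subset_gen.
congr <<_>>%g; apply/setP => y; rewrite inE; apply/morphimP/tnthP => [[x _]|[i ->]].
  by rewrite inE => /tnthP[i ->] ->; exists i => /=.
by exists (tnth t i); rewrite ?mem_gen ?inE ?mem_tnth //= ft.
Qed.

Lemma marked_isog_sym (gT hT : finGroupType) (t : k.-tuple gT) (u : k.-tuple hT) :
  marked_isog t u = marked_isog u t.
Proof. by apply/idP/idP => /marked_isog_evt h; apply/marked_isog_evt => w; rewrite h. Qed.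

Lemma marked_isog_trans (gT hT kT : finGroupType) (t : k.-tuple gT) (u : k.-tuple hT)
  (v : k.-tuple kT) : marked_isog t u -> marked_isog u v -> marked_isog t v.
Proof.
by move=> /marked_isog_evt h /marked_isog_evt h'; apply/marked_isog_evt => w; rewrite h h'.
Qed.

End Words.

Section WalkMorphism.
Variables (D Q : finType) (V V' : Type) (m : nat) (lab : Q -> m.-tuple D) (H : D -> Q -> Q).
Variables (step : Q -> V -> V) (step' : Q -> V' -> V') (q0 : Q) (phi : V -> V').
Hypothesis phiE : forall l v, phi (step l v) = step' l (phi v).

Lemma walk_morph k l z :
  walk lab H step' q0 k l (z.1, phi z.2) =
  ((walk lab H step q0 k l z).1, phi (walk lab H step q0 k l z).2).
Proof.
elim: k l z => [|k IH] l z /=; first by rewrite phiE.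
elim: (tval (lab l)) z => //= e t IHt z.
by rewrite (IH _ (behead z.1, z.2)) /= -IHt.
Qed.

Lemma fold_walk_morph k ls z :
  foldl (fun z l => walk lab H step' q0 k l z) (z.1, phi z.2) ls =
  ((foldl (fun z l => walk lab H step q0 k l z) z ls).1,
   phi (foldl (fun z l => walk lab H step q0 k l z) z ls).2).
Proof. by elim: ls z => //= l ls IH z; rewrite walk_morph IH. Qed.

End WalkMorphism.

Section MatchIsog.
Variables (k m' : nat) (D Q : finType) (lab : Q -> m'.+1.-tuple D) (H : D -> Q -> Q).
Variables (q0 : Q) (base : Q -> 'I_k.+1).
Hypothesis universal : forall (gT : finGroupType) (s : 'I_k.+1 -> gT) (W : nat) (v : gT),
  s ord0 = 1%g -> <<[set s i | i : 'I_k.+1]>>%g = [set: gT] ->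
  (0 < W)%N -> (#|gT| <= 2 ^ W)%N ->
  exists qs ls : seq Q, [/\ size qs = W, size ls = W &
    (foldl (fun z l => walk lab H (cstep s base) q0 W l z) (qs, 1%g) ls).2 = v].

Variables (n m : nat) (T : 'I_n -> 'I_n -> 'I_n) (S : 'I_m -> 'I_m -> 'I_m).
Variables (gT hT : finGroupType) (b : bool) (n' : nat) (T' : 'I_n' -> 'I_n' -> 'I_n').
Variables (e : 'I_n -> gT) (f : gT -> 'I_n) (e' : 'I_n' -> hT) (f' : hT -> 'I_n').
Hypotheses (eK : cancel e f) (fK : cancel f e) (eK' : cancel e' f') (fK' : cancel f' e').
Hypothesis eM : forall i j, e (T i j) = (e i * e j)%g.
Hypothesis eM' : forall i j, e' (T' i j) = (e' i * e' j)%g.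
Hypothesis tabE : forall i j, tabop T S b i j = tabop1 T' i j.
Variables (t : k.-tuple gT) (u : k.-tuple hT) (Lv Rv : 'I_k.+1 -> nat).
Hypothesis LvE : forall j, Lv (lift ord0 j) = f (tnth t j).
Hypothesis RvE : forall j, Rv (lift ord0 j) = f' (tnth u j).
Variable w : nat.
Hypotheses (w_gt0 : 0 < w) (nw : n * n' <= 2 ^ w).

(** The universal walk is run in the group generated by the pairs. It reaches the pair of values of
    any word, so comparing the two coordinates with the identity at all end points tests all
    relations, and no word can mislead because every end point is such a pair. *)
Lemma match_isog :
  (forall qs ls, size qs = w -> size ls = w ->
     let z := foldl (fun z l => walk lab H (avstep base T S b Lv Rv) q0 w l z) (qs, (0, 0)) ls in
     (z.2.1 == 0) = (z.2.2 == 0)) <-> marked_isog t u.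
Proof.
have n0 : 0 < n by apply: leq_ltn_trans (ltn_ord (f 1%g)).
have n'0 : 0 < n' by apply: leq_ltn_trans (ltn_ord (f' 1%g)).
pose i0 := Ordinal n0; pose i0' := Ordinal n'0.
pose G := <<[set (ext1 t i, ext1 u i) | i : 'I_k.+1]>>%G.
have inG i : (ext1 t i, ext1 u i) \in G by apply: mem_gen; apply: imset_f.
pose s i : subg_of G := subg G (ext1 t i, ext1 u i).
have sE i : sgval (s i) = (ext1 t i, ext1 u i) by rewrite subgK.
have s0 : s ord0 = 1%g.
  apply: val_inj; rewrite [val _]sE /ext1; case: unliftP => [j|] //.
have s_gen : <<[set s i | i : 'I_k.+1]>>%g = [set: subg_of G].
  apply/eqP; rewrite eqEsubset subsetT /=; apply/subsetP => g _.
  have sub : G \subset (sgval @* <<[set s i | i : 'I_k.+1]>>)%g.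
    rewrite gen_subG; apply/subsetP => p /imsetP[i _ ->]; rewrite -sE.
    by apply: mem_morphim; rewrite ?inE // mem_gen // imset_f.
  have /morphimP[g' _ g'in /val_inj -> //] := subsetP sub _ (subgP g).
have cG : #|subg_of G| <= 2 ^ w.
  apply: leq_trans nw; have -> : n * n' = #|{: gT * hT}|.
    rewrite card_prod -(bij_eq_card (Bijective eK fK)) -(bij_eq_card (Bijective eK' fK')).
    by rewrite !card_ord.
  by apply: (leq_card (fun g : subg_of G => sgval g)); apply: val_inj.
(* Steps multiply on the right, so the walk from the elements of index 0 is the left translate of
   the walk from the identity. *)
pose phi (g : subg_of G) : nat * nat :=
  (val (f (e i0 * (sgval g).1)%g), val (f' (e' i0' * (sgval g).2)%g)).
have phiM l g : phi (cstep s base l g) = avstep base T S b Lv Rv l (phi g).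
  have sgM (g1 g2 : subg_of G) : sgval (g1 * g2)%g = (sgval g1 * sgval g2)%g by [].
  rewrite /cstep /avstep /phi /vm sgM sE.
  case: (unliftP ord0 (base l)) => [j ->|->].
    rewrite eq_sym (negbTE (neq_lift _ _)) LvE RvE tabE /tabop /tabop1 !valK /=.
    by rewrite /ext1 liftK -[T _ _]eK -[T' _ _]eK' eM eM' !fK !fK' !mulgA.
  by rewrite eqxx /ext1; case: unliftP => // _; rewrite !mulg1.
have phi1 : phi 1%g = (0, 0) by rewrite /phi /= !mulg1 eK eK'.
have phi0 g : (((phi g).1 == 0) = ((sgval g).1 == 1%g)) *
              (((phi g).2 == 0) = ((sgval g).2 == 1%g)).
  split.
    apply/eqP/eqP => [h|h]; last by rewrite /phi h /= mulg1 eK.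
    have {}h : f (e i0 * (sgval g).1)%g = i0 by apply: val_inj.
    have := congr1 e h; rewrite fK => /(canRL (mulKg _)) ->.
    by rewrite mulVg.
  apply/eqP/eqP => [h|h]; last by rewrite /phi h /= mulg1 eK'.
  have {}h : f' (e' i0' * (sgval g).2)%g = i0' by apply: val_inj.
  have := congr1 e' h; rewrite fK' => /(canRL (mulKg _)) ->.
  by rewrite mulVg.
have run qs ls : (foldl (fun z l => walk lab H (avstep base T S b Lv Rv) q0 w l z) (qs, (0, 0)) ls).2
   = phi (foldl (fun z l => walk lab H (cstep s base) q0 w l z) (qs, 1%g) ls).2.
  by have := fold_walk_morph lab H q0 phiM w ls (qs, 1%g); rewrite /= phi1 => ->.
split=> [h|iso qs ls sq sl].
  apply/marked_isog_evt => wd.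
  have pG : (evt t wd, evt u wd) \in G by apply: pair_evt.
  have [qs [ls [sq sl E]]] := universal (subg G (evt t wd, evt u wd)) s0 s_gen w_gt0 cG.
  by have := h qs ls sq sl; rewrite /= run E !phi0 subgK.
rewrite /= run !phi0; set g := sgval _.
have /pairs_evt[wd ->] : g \in pairs t u by apply: subgP.
by have /marked_isog_evt -> := iso.
Qed.

End MatchIsog.

(** * The decision procedure *)

Lemma LP_allfin (A I T : finType) (P : I -> seq A -> seq T -> bool) s :
  (forall i, LP (P i)) -> LP (fun x u => all (fun i => P i x u) s).
Proof.
move=> hP; elim: s => [|i s IH]; last exact: LP_and.
by apply: LP_ext (LP_all A (fun=> true)) => x u _; apply/allP.
Qed.

Lemma zip_mkseq (X Y : Type) (f : nat -> X) (g : nat -> Y) n :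
  zip (mkseq f n) (mkseq g n) = mkseq (fun t => (f t, g t)) n.
Proof. by rewrite /mkseq; move: 0; elim: n => //= n IH k; rewrite IH. Qed.

Lemma mkseq_digs (s : seq 'I_2) : exists2 i, i < 2 ^ size s & s = mkseq (dg i) (size s).
Proof. by have [i li E] := @digs_surj 1 _ s erefl; exists i; rewrite // {1}E digs_dg. Qed.

Lemma mkseq_inj (X : Type) (f g : nat -> X) n :
  mkseq f n = mkseq g n -> forall t, t < n -> f t = g t.
Proof.
move=> E t lt_t; have := congr1 (fun s => nth (f 0) s t) E.
by rewrite !nth_mkseq.
Qed.

Lemma dg_inj n i j : i < 2 ^ n -> j < 2 ^ n -> (forall t, t < n -> dg i t = dg j t) -> i = j.
Proof.
move=> li lj E; apply/eqP; rewrite -(dg_eq li lj); apply/allP => t.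
by rewrite mem_iota => /E ->.
Qed.

Lemma count_strs (G Z : finType) (g0 : G) (enc : Z -> seq G) (P : pred (seq G)) n :
  injective enc -> (forall z, size (enc z) = n) ->
  (forall w, size w = n -> P w -> exists z, w = enc z) ->
  count P (strs g0 n) = #|[pred z | P (enc z)]|.
Proof.
move=> inj sz surj; rewrite -size_filter cardE -(size_map enc).
apply/perm_size/uniq_perm; first by rewrite filter_uniq // uniq_strs.
  by rewrite map_inj_uniq // enum_uniq.
move=> w; rewrite mem_filter mem_strs; apply/andP/mapP => [[Pw /eqP sw]|[z]].
  by have [z E] := surj w sw Pw; exists z; rewrite // mem_enum inE -E.
by rewrite mem_enum inE => Pz ->; rewrite sz eqxx.
Qed.

Section Decider.
Variable d : nat.
Variables (m' : nat) (D Q : finType) (lab : Q -> m'.+1.-tuple D) (H : D -> Q -> Q).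
Variables (q0 : Q) (base : Q -> 'I_d.+3).

Notation Gh := {ffun 'I_d -> 'I_2}.
Notation Gp := ('I_2 * 'I_2)%type.
Notation St := ({ffun 'I_d.+3 -> 'I_2} * {ffun 'I_d.+3 -> 'I_2} * bool)%type.

(** The order is that of [tup2] behind the additional generator 0. Its value [o] is a dummy, since a
    lookup for generator 0 is discarded. *)
Definition tsel (X : Type) (o : X) (h : 'I_d -> X) (p : X * X) (i : 'I_d.+3) : X :=
  if unlift ord0 i is Some j then
    if unlift ord0 j is Some j' then
      if unlift ord0 j' is Some l then h l else p.2
    else p.1
  else o.

Lemma tnth_tup2E (X : Type) (o : X) (h : d.-tuple X) a c j :
  tsel o (tnth h) (a, c) (lift ord0 j) = tnth (tup2 h a c) j.
Proof.
rewrite /tsel liftK; case: unliftP => [j' ->|->]; last by rewrite (tnth_nth o).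
case: unliftP => [l ->|->]; last by rewrite (tnth_nth o).
by rewrite tnth_tup2.
Qed.

Lemma tsel_map (X Y : Type) (g : X -> Y) o h p i :
  g (tsel o h p i) = tsel (g o) (fun k => g (h k)) (g p.1, g p.2) i.
Proof. by rewrite /tsel; do 3!case: unlift => //= ?. Qed.

Definition gens (h : Gh) (p : Gp) : {ffun 'I_d.+3 -> 'I_2} := [ffun i => tsel ord0 h p i].

(** An index denotes a group element exactly when the table has a diagonal entry there. *)
Definition vidx (b : bool) (x : seq sym) (s : seq 'I_2) := validP x [seq (b, a, a) | a <- s].
Definition vp2 (b : bool) (x : seq sym) (p : seq Gp) :=
  vidx b x [seq a.1 | a <- p] && vidx b x [seq a.2 | a <- p].
Definition vph (b : bool) (x : seq sym) (h : seq Gh) :=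
  all (fun k => vidx b x [seq a k | a : Gh <- h]) (enum 'I_d).
(** The first tuple always lies in the first group; [b] says whether the second one is built on [h]
    in the same group or on [h'] in the other. *)
Definition mch (b : bool) (x : seq sym) (w : seq (unit * Gh * Gh * Gp * Gp)) :=
  vp2 b x [seq a.2 | a <- w] &&
  matchP lab H q0 base x
    [seq (gens a.1.1.1.2 a.1.2, gens (if b then a.1.1.2 else a.1.1.1.2) a.2, b) | a <- w].

Lemma LP_vidx b : LP (vidx b).
Proof. exact: (LP_map (fun a => (b, a, a)) LP_validP). Qed.

Lemma LP_vp2 b : LP (vp2 b).
Proof. exact: LP_and (LP_map fst (LP_vidx b)) (LP_map snd (LP_vidx b)). Qed.

Lemma LP_vph b : LP (vph b).
Proof. exact: LP_allfin (fun k => LP_map (fun a : Gh => a k) (LP_vidx b)). Qed.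

Lemma LP_mch b : LP (mch b).
Proof.
apply: LP_and (LP_map snd (LP_vp2 b)) _.
exact: (LP_map (fun a : unit * Gh * Gh * Gp * Gp =>
  (gens a.1.1.1.2 a.1.2, gens (if b then a.1.1.2 else a.1.1.1.2) a.2, b)) (LP_matchP lab H q0 base)).
Qed.

Definition h0 : Gh := [ffun=> ord0].
Definition p0 : Gp := (ord0, ord0).

(** The first conjunct compares the orders through the sets of valid indices. The second ranges over
    all tuples [h] and does not test whether they generate a complement: an isomorphism transports
    every tuple, and conversely one suitable [h] is enough. *)
Definition decide (x : seq sym) (u : seq unit) : bool :=
  all (fun s => vidx false x (unzip2 (zip u s)) == vidx true x (unzip2 (zip u s))) (strs ord0 (W x)) &&
  all (fun h => vph false x (unzip2 (zip u h)) ==>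
    has (fun h' => vph true x (unzip2 (zip (zip u h) h')) &&
      all (fun p => vp2 false x (unzip2 (zip (zip (zip u h) h') p)) ==>
         (count (fun p' => mch false x (zip (zip (zip (zip u h) h') p) p')) (strs p0 (W x)) ==
          count (fun p' => mch true x (zip (zip (zip (zip u h) h') p) p')) (strs p0 (W x))))
      (strs p0 (W x)))
    (strs h0 (W x)))
  (strs h0 (W x)).

Lemma LP_decide : LP decide.
Proof.
have hs := LP_forall (T := unit) (ord0 : 'I_2) (LP_eqb (LP_map snd (LP_vidx false)) (LP_map snd (LP_vidx true))).
have hc := LP_count_eq p0 (LP_mch false) (LP_mch true).
have hp := LP_forall p0 (LP_imply (LP_map (T := (unit * Gh * Gh * Gp)%type) snd (LP_vp2 false)) hc).
have hh' := LP_exists h0 (LP_and (LP_map (T := (unit * Gh * Gh)%type) snd (LP_vph true)) hp).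
have hh := LP_forall h0 (LP_imply (LP_map (T := (unit * Gh)%type) snd (LP_vph false)) hh').
exact: LP_and hs hh.
Qed.

Definition decider (x : seq sym) : bool :=
  (head (tt, false) [seq (a.1, decide x (unzip1 (nseq (W x) (tt, false)))) | a <- nseq (W x) (tt, false)]).2.

Lemma deciderE x : decider x = decide x (nseq (W x) tt).
Proof.
rewrite /decider; have -> : unzip1 (nseq (W x) (tt, false)) = nseq (W x) tt by rewrite /unzip1 map_nseq.
by [].
Qed.

Lemma decider_logspace : in_logspace decider.
Proof. exact: (LI_logspace (tt, false) snd LP_decide). Qed.

Section Side.
Variables (n m : nat) (T : 'I_n -> 'I_n -> 'I_n) (S : 'I_m -> 'I_m -> 'I_m).
Hypotheses (n_gt0 : 0 < n) (m_gt0 : 0 < m).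
Let x := encode_table T ++ encode_table S.
Variables (b : bool) (n' : nat) (T' : 'I_n' -> 'I_n' -> 'I_n') (hT : finGroupType).
Variables (e' : 'I_n' -> hT) (f' : hT -> 'I_n').
Hypotheses (eK' : cancel e' f') (fK' : cancel f' e').
Hypothesis tabE : forall i j, tabop T S b i j = tabop1 T' i j.
Hypothesis n'W : n' < 2 ^ W x.

Lemma vidx_ok i : i < 2 ^ W x -> vidx b x (mkseq (dg i) (W x)) = (i < n').
Proof.
move=> li; rewrite /vidx (@validP_ok _ _ T S n_gt0 m_gt0 b i i) //; last 3 first.
- by rewrite -map_comp (@map_nseqE _ _ _ b) // size_mkseq.
- by rewrite -map_comp map_id digs_dg.
- by rewrite -map_comp map_id digs_dg.
rewrite tabE /tabop1; case: ltnP => [lt|ge].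
  by rewrite insubT.
by rewrite insubF // ltnNge ge.
Qed.

Lemma vidx_surj s : size s = W x -> vidx b x s -> exists z : hT, s = mkseq (dg (f' z)) (W x).
Proof.
move=> ss; have [i] := mkseq_digs s; rewrite ss => li ->; rewrite vidx_ok // => lt.
by exists (e' (Ordinal lt)); rewrite eK'.
Qed.

Lemma f'_lt z : f' z < 2 ^ W x.
Proof. exact: ltn_trans n'W. Qed.

Definition enc2 (z : hT * hT) : seq Gp := mkseq (fun t => (dg (f' z.1) t, dg (f' z.2) t)) (W x).
Definition encd (h : d.-tuple hT) : seq Gh :=
  mkseq (fun t => [ffun k => dg (f' (tnth h k)) t]) (W x).

Lemma enc2_inj : injective enc2.
Proof.
move=> [a c] [a' c'] /mkseq_inj E; congr (_, _); apply: (can_inj fK'); apply: val_inj;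
  apply: (@dg_inj (W x)); rewrite ?f'_lt // => t /E [].
  by [].
by [].
Qed.

Lemma vp2_enc z : vp2 b x (enc2 z).
Proof. by rewrite /vp2 /enc2 !map_mkseq !vidx_ok ?f'_lt // !ltn_ord. Qed.

Lemma vp2_surj w : size w = W x -> vp2 b x w -> exists z, w = enc2 z.
Proof.
move=> sw /andP[/vidx_surj[|z1 E1]]; first by rewrite size_map.
case/vidx_surj; rewrite ?size_map // => z2 E2.
exists (z1, z2); rewrite -[w]zip_unzip /unzip1 /unzip2 E1 E2.
exact: zip_mkseq.
Qed.

Lemma vph_enc h : vph b x (encd h).
Proof.
apply/allP => k _; rewrite /encd map_mkseq.
have -> : mkseq (fun t => [ffun k => dg (f' (tnth h k)) t] k) (W x) = mkseq (dg (f' (tnth h k))) (W x).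
  by apply: eq_map => t; rewrite ffunE.
by rewrite vidx_ok ?f'_lt.
Qed.

Lemma vph_surj w : size w = W x -> vph b x w -> exists h, w = encd h.
Proof.
move=> sw /allP vw.
have ex k : exists z, [seq a k | a : Gh <- w] = mkseq (dg (f' z)) (W x).
  by apply: vidx_surj; rewrite ?size_map // vw // mem_enum.
have [z zE] := fin_all_exists ex.
exists [tuple z k | k < d]; apply: (@eq_from_nth _ h0); first by rewrite sw size_mkseq.
move=> t; rewrite sw => lt_t; rewrite nth_mkseq //; apply/ffunP => k; rewrite ffunE tnth_mktuple.
have := congr1 (fun s => nth ord0 s t) (zE k).
by rewrite (nth_map h0) ?sw // nth_mkseq.
Qed.

End Side.

(** When a tuple is compared with another one of the first group, the walk takes place in the square
    of that group. *)
Lemma sq_bound n m (T : 'I_n -> 'I_n -> 'I_n) (S : 'I_m -> 'I_m -> 'I_m) :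
  n * n <= 2 ^ W (encode_table T ++ encode_table S).
Proof.
apply/ltnW; apply: leq_ltn_trans (trunc_log_ltn _ (ltnSn 1)).
rewrite size_cat !size_encode_table; apply: leq_trans (leq_addr _ _).
by apply: leqW; rewrite leq_mul2l ?leqW ?leq_pmulr ?orbT.
Qed.

Hypothesis universal : forall (gT : finGroupType) (s : 'I_d.+3 -> gT) (W : nat) (v : gT),
  s ord0 = 1%g -> <<[set s i | i : 'I_d.+3]>>%g = [set: gT] ->
  (0 < W)%N -> (#|gT| <= 2 ^ W)%N ->
  exists qs ls : seq Q, [/\ size qs = W, size ls = W &
    (foldl (fun z l => walk lab H (cstep s base) q0 W l z) (qs, 1%g) ls).2 = v].

Section Correct.
Variables (n m : nat) (T : 'I_n -> 'I_n -> 'I_n) (S : 'I_m -> 'I_m -> 'I_m).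
Let x := encode_table T ++ encode_table S.
Variables (gT hT : finGroupType).
Variables (e : 'I_n -> gT) (f : gT -> 'I_n) (e' : 'I_m -> hT) (f' : hT -> 'I_m).
Hypotheses (eK : cancel e f) (fK : cancel f e) (eK' : cancel e' f') (fK' : cancel f' e').
Hypothesis eM : forall i j, e (T i j) = (e i * e j)%g.
Hypothesis eM' : forall i j, e' (S i j) = (e' i * e' j)%g.

Lemma n_gt0 : 0 < n. Proof. exact: leq_ltn_trans (ltn_ord (f 1%g)). Qed.
Lemma m_gt0 : 0 < m. Proof. exact: leq_ltn_trans (ltn_ord (f' 1%g)). Qed.

Let nW : n < 2 ^ W x. Proof. by have [] := W_bounds T S n_gt0 m_gt0. Qed.
Let mW : m < 2 ^ W x. Proof. by have [] := W_bounds T S n_gt0 m_gt0. Qed.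

Local Notation U := (nseq (W x) tt).
Local Notation e2 := (enc2 T S f).
Local Notation e2' := (enc2 T S f').
Local Notation ed := (encd T S f).
Local Notation ed' := (encd T S f').

Lemma mch_gen (b : bool) (kT : finGroupType) n' (T' : 'I_n' -> 'I_n' -> 'I_n')
    (e1 : 'I_n' -> kT) (f1 : kT -> 'I_n') (h : d.-tuple gT) (h' : d.-tuple hT)
    (h1 : d.-tuple kT) z z1 :
  cancel e1 f1 -> cancel f1 e1 -> (forall i j, e1 (T' i j) = (e1 i * e1 j)%g) ->
  (forall i j, tabop T S b i j = tabop1 T' i j) -> n' < 2 ^ W x -> n * n' <= 2 ^ W x ->
  (if b then ed' h' else ed h) = encd T S f1 h1 ->
  mch b x (zip (zip (zip (zip U (ed h)) (ed' h')) (e2 z)) (enc2 T S f1 z1)) =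
  marked_isog (tup2 h z.1 z.2) (tup2 h1 z1.1 z1.2).
Proof.
move=> eK1 fK1 eM1 tabE n'W nn' hE.
rewrite /mch nseq_mkseq /encd /enc2 !zip_mkseq !map_mkseq /=.
have -> : vp2 b x (mkseq (fun t => (dg (f1 z1.1) t, dg (f1 z1.2) t)) (W x)).
  exact: (vp2_enc n_gt0 m_gt0 f1 tabE n'W).
rewrite andTb; set c := mkseq _ _.
pose Lv := tsel 0 (fun k => val (f (tnth h k))) (val (f z.1), val (f z.2)).
pose Rv := tsel 0 (fun k => val (f1 (tnth h1 k))) (val (f1 z1.1), val (f1 z1.2)).
have d0 t : dg 0 t = ord0 by apply/val_inj; rewrite /dg div0n mod0n /= inordK.
have l0 : 0 < 2 ^ W x by rewrite expn_gt0.
have fl k : f k < 2 ^ W x by apply: ltn_trans nW.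
have fl1 k : f1 k < 2 ^ W x by apply: ltn_trans n'W.
have cb : [seq a.2 | a <- c] = nseq (W x) b.
  by rewrite /c map_mkseq nseq_mkseq.
have cL i : [seq a.1.1 i | a : St <- c] = digs 1 (W x) (Lv i).
  rewrite /c map_mkseq digs_dg; apply: eq_map => t /=.
  rewrite ffunE /Lv (tsel_map (dg^~ t)) d0 /tsel.
  by do 3!case: unlift => //= ?; rewrite ffunE.
have hE' t k : t < W x -> (if b then [ffun k => dg (f' (tnth h' k)) t]
    else [ffun k => dg (f (tnth h k)) t] : Gh) k = dg (f1 (tnth h1 k)) t.
  move=> lt_t; have := congr1 (fun s => nth h0 s t k) hE; rewrite /encd.
  by case: (b); rewrite !nth_mkseq // => ->; rewrite ffunE.
have cR i : [seq a.1.2 i | a : St <- c] = digs 1 (W x) (Rv i).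
  rewrite /c map_mkseq digs_dg; apply/eq_in_map => t; rewrite mem_iota => /andP[_ lt_t] /=.
  rewrite ffunE /Rv (tsel_map (dg^~ t)) d0 /tsel.
  by do 3!case: unlift => //= ?; rewrite hE'.
have lL i : Lv i < 2 ^ W x by rewrite /Lv /tsel; do 3!case: unlift => //= ?.
have lR i : Rv i < 2 ^ W x by rewrite /Rv /tsel; do 3!case: unlift => //= ?.
apply/idP/idP.
  move/(matchP_ok lab H q0 base n_gt0 m_gt0 cb cL cR lL lR).
  apply: (match_isog universal eK fK eK1 fK1 eM eM1 tabE _ _ _ nn').1 => // j.
    by rewrite /Lv -(tnth_tup2E (1%g : gT)) (tsel_map (fun k => val (f k))) /tsel liftK.
  by rewrite /Rv -(tnth_tup2E (1%g : kT)) (tsel_map (fun k => val (f1 k))) /tsel liftK.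
move=> iso; apply/(matchP_ok lab H q0 base n_gt0 m_gt0 cb cL cR lL lR).
apply: (match_isog universal eK fK eK1 fK1 eM eM1 tabE _ _ _ nn').2 iso => // j.
  by rewrite /Lv -(tnth_tup2E (1%g : gT)) (tsel_map (fun k => val (f k))) /tsel liftK.
by rewrite /Rv -(tnth_tup2E (1%g : kT)) (tsel_map (fun k => val (f1 k))) /tsel liftK.
Qed.

Definition cnt1 (h : d.-tuple gT) z :=
  #|[pred z' | marked_isog (tup2 h z.1 z.2) (tup2 h z'.1 z'.2)]|.
Definition cnt2 (h : d.-tuple gT) (h' : d.-tuple hT) z :=
  #|[pred z' | marked_isog (tup2 h z.1 z.2) (tup2 h' z'.1 z'.2)]|.

Lemma count_false h h' z :
  count (fun p' => mch false x (zip (zip (zip (zip U (ed h)) (ed' h')) (e2 z)) p')) (strs p0 (W x))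
  = cnt1 h z.
Proof.
rewrite (count_strs (enc := e2) p0); last 3 first.
- exact: enc2_inj fK nW.
- by move=> z'; rewrite size_mkseq.
- move=> w sw /andP[]; rewrite (mapz2 id) ?map_id; last first.
    by rewrite sw !size_zip size_nseq !size_mkseq !minnn.
  by move=> v _; apply: (vp2_surj n_gt0 m_gt0 eK) v.
apply: eq_card => z'; rewrite !inE.
by apply: (@mch_gen false gT n T e f) => //; apply: sq_bound.
Qed.

Lemma count_true h h' z :
  count (fun p' => mch true x (zip (zip (zip (zip U (ed h)) (ed' h')) (e2 z)) p')) (strs p0 (W x))
  = cnt2 h h' z.
Proof.
rewrite (count_strs (enc := e2') p0); last 3 first.
- exact: enc2_inj fK' mW.
- by move=> z'; rewrite size_mkseq.
- move=> w sw /andP[]; rewrite (mapz2 id) ?map_id; last first.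
    by rewrite sw !size_zip size_nseq !size_mkseq !minnn.
  by move=> v _; apply: (vp2_surj n_gt0 m_gt0 eK') v.
apply: eq_card => z'; rewrite !inE.
apply: (@mch_gen true hT m S e' f') => //.
by have [] := W_bounds T S n_gt0 m_gt0.
Qed.

Lemma decideP :
  decide x U <-> n = m /\ forall h, exists h', forall z, cnt1 h z = cnt2 h h' z.
Proof.
have uz (X Y : Type) (s : seq X) (s' : seq Y) : size s = W x -> size s' = W x ->
    unzip2 (zip s s') = s' /\ size (zip s s') = W x.
  by move=> h1 h2; rewrite unzip2_zip ?h1 ?h2 // size_zip h1 h2 minnn.
have sU : size U = W x by rewrite size_nseq.
split.
  case/andP => /allP szs /allP hs; split.
    have vs i : i < 2 ^ W x -> (i < n) = (i < m).
      move=> li; have := szs (mkseq (dg i) (W x)); rewrite mem_strs size_mkseq eqxx => /(_ isT).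
      rewrite (uz _ _ _ _ sU (size_mkseq _ _)).1 => /eqP.
      rewrite (@vidx_ok n m T S n_gt0 m_gt0 false n T) //.
      by rewrite (@vidx_ok n m T S n_gt0 m_gt0 true m S).
    by have := vs n nW; have := vs m mW; rewrite !ltnn; lia.
  move=> h; have := hs (ed h); rewrite mem_strs size_mkseq eqxx => /(_ isT).
  have [-> sz1] := uz _ _ _ _ sU (size_mkseq (fun t => [ffun k => dg (f (tnth h k)) t] : Gh) (W x)).
  rewrite (vph_enc n_gt0 m_gt0 (b := false) (T' := T) f _ nW) //.
  case/hasP => w'; rewrite mem_strs => /eqP sw'.
  have [-> sz2] := uz _ _ _ _ sz1 sw'.
  case/andP => /(vph_surj n_gt0 m_gt0 eK' (b := true) (fun _ _ => erefl) sw')[h' w'E].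
  rewrite w'E in sz2 *; move/allP => ps; exists h' => z.
  have := ps (e2 z); rewrite mem_strs size_mkseq eqxx => /(_ isT).
  have [-> sz3] := uz _ _ _ _ sz2 (size_mkseq (fun t => (dg (f z.1) t, dg (f z.2) t)) (W x)).
  rewrite (vp2_enc n_gt0 m_gt0 (b := false) (T' := T) f _ nW) //.
  by rewrite implyTb -/(e2 z) count_false count_true => /eqP.
case=> nm ch; apply/andP; split.
  apply/allP => s; rewrite mem_strs => /eqP ss; rewrite (uz _ _ _ _ sU ss).1.
  have [i] := mkseq_digs s; rewrite ss => li ->.
  rewrite (@vidx_ok n m T S n_gt0 m_gt0 false n T) //.
  by rewrite (@vidx_ok n m T S n_gt0 m_gt0 true m S) // nm.
apply/allP => w; rewrite mem_strs => /eqP sw; have [-> sz1] := uz _ _ _ _ sU sw.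
apply/implyP => /(vph_surj n_gt0 m_gt0 eK (b := false) (fun _ _ => erefl) sw)[h wE].
rewrite wE in sz1 *; have [h' hh'] := ch h.
apply/hasP; exists (ed' h'); first by rewrite mem_strs size_mkseq.
have [-> sz2] := uz _ _ _ _ sz1 (size_mkseq (fun t => [ffun k => dg (f' (tnth h' k)) t] : Gh) (W x)).
rewrite (vph_enc n_gt0 m_gt0 (b := true) (T' := S) f' _ mW) // andTb.
apply/allP => p; rewrite mem_strs => /eqP sp.
have [-> sz3] := uz _ _ _ _ sz2 sp.
apply/implyP => /(vp2_surj n_gt0 m_gt0 eK (b := false) (fun _ _ => erefl) sp)[z ->].
by rewrite count_false count_true hh'.
Qed.

Lemma decide_isog : coprime_abelian_sdprod d gT ->
  decide x U = ([set: gT] \isog [set: hT]).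
Proof.
have cg : #|gT| = n by rewrite -(bij_eq_card (Bijective eK fK)) card_ord.
have ch : #|hT| = m by rewrite -(bij_eq_card (Bijective eK' fK')) card_ord.
move=> [N [K [defG cNN le_d coHN]]]; apply/idP/idP => [/decideP[nm dh]|].
  have [h genH] := grank_tuple le_d; have [h' cE] := dh h.
  (* Pairs of either group are coloured by a set of pairs of the first group, their
     marked-isomorphism class there; a common type of colours is what [colour_bij] needs. *)
  pose F z : {set gT * gT} := [set w | marked_isog (tup2 h w.1 w.2) (tup2 h z.1 z.2)].
  pose F' z : {set gT * gT} := [set w | marked_isog (tup2 h w.1 w.2) (tup2 h' z.1 z.2)].
  have Fe z z' : (F z' == F z) = marked_isog (tup2 h z.1 z.2) (tup2 h z'.1 z'.2).
    apply/eqP/idP => [/setP /(_ z)|iso]; first by rewrite !inE marked_isog_refl.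
    apply/setP => w; rewrite !inE; apply/idP/idP => hw.
      by apply: marked_isog_trans hw _; rewrite marked_isog_sym.
    exact: marked_isog_trans hw iso.
  have Fe' z z' : (F' z' == F z) = marked_isog (tup2 h z.1 z.2) (tup2 h' z'.1 z'.2).
    apply/eqP/idP => [/setP /(_ z)|iso]; first by rewrite !inE marked_isog_refl.
    apply/setP => w; rewrite !inE; apply/idP/idP => hw.
      by apply: marked_isog_trans hw _; rewrite marked_isog_sym.
    exact: marked_isog_trans hw iso.
  have [||Phi [Pbij PE]] := @colour_bij _ _ _ F F'.
  - by rewrite !card_prod cg ch nm.
  - move=> z; transitivity (cnt1 h z); first by apply: eq_card => z'; rewrite !inE Fe.
    by rewrite cE; apply: eq_card => z'; rewrite !inE Fe'.
  have iso z : marked_isog (tup2 h z.1 z.2) (tup2 h' (Phi z).1 (Phi z).2).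
    by have <- := Fe' z (Phi z); rewrite PE.
  exact: core_isog defG cNN coHN genH Pbij iso.
case/isogP => g injg gT_hT; apply/decideP; split.
  by rewrite -cg -ch -!cardsT -gT_hT card_injm.
move=> h; exists [tuple g (tnth h i) | i < d] => z.
have gbij : bijective g.
  apply: inj_card_bij; first by move=> a c E; apply: (injmP injg); rewrite ?inE.
  by rewrite -!cardsT -gT_hT card_injm.
have gpbij : bijective (fun z : gT * gT => (g z.1, g z.2)).
  case: gbij => g' gK g'K; exists (fun z => (g' z.1, g' z.2)) => -[a c] /=.
    by rewrite !gK.
  by rewrite !g'K.
rewrite /cnt2 /cnt1 -!sum1_card (reindex _ (onW_bij _ gpbij)) /=.
apply: eq_bigl => z'; rewrite !inE /=.
have evg w : evt (tup2 [tuple g (tnth h i) | i < d] (g z'.1) (g z'.2)) w = g (evt (tup2 h z'.1 z'.2) w).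
  rewrite /evt morph_prod => [|i _]; last by rewrite inE.
  apply: eq_bigr => i _; rewrite -!(tnth_tup2E 1%g (X := hT)) -(tnth_tup2E 1%g (X := gT)) /tsel !liftK.
  by do 2!case: unlift => //= ?; rewrite tnth_mktuple.
have g1 y : (g y == 1%g) = (y == 1%g) by rewrite morph_injm_eq1 ?inE.
by apply/idP/idP => /marked_isog_evt hw; apply/marked_isog_evt => w; rewrite hw evg g1.
Qed.

End Correct.
End Decider.

Theorem mainTheorem1 (d : nat) :
  (exists k r : nat,
     [/\ 2 <= k, 1 <= r &
         forall gT : finGroupType,
           coprime_abelian_sdprod d gT -> wl2_identifies k r gT])
  /\
  (exists L : pred (seq (option bool)),
     in_logspace L /\
     forall (gT hT : finGroupType) (n m : nat)
            (T : 'I_n -> 'I_n -> 'I_n) (S : 'I_m -> 'I_m -> 'I_m),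
       coprime_abelian_sdprod d gT ->
       cayley_table_of T gT -> cayley_table_of S hT ->
       L (encode_table T ++ encode_table S) = ([set: gT] \isog [set: hT])).
Proof.
split; first by exists d.+2, 3; split=> // gT; apply: wl2_identifies_sdprod.
(* The generators are the [d + 2] entries of [tup2], besides the identity as generator 0. *)
have [[|m'] [D [Q [lab [H [q0 [base [m0 univ]]]]]]]] // := universal_words d.+2.
exists (decider lab H q0 base); split; first exact: decider_logspace.
move=> gT hT n m T S cop [e [[f eK fK] eM]] [e' [[f' eK' fK'] eM']].
by rewrite deciderE; apply: (decide_isog univ eK fK eK' fK').
Qed.
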